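(* Let $p\in(1,2)$ and $\delta\in(0,1]$. Assume that $\mathrm{P}\left(|\langle w_p^{*},X\rangle-Y|^{2-p}>0\right)=1$ and $\mathrm{E}\left[|\langle w_p^{*},X\rangle-Y|^{2(p-2)}\right]<\infty$. Further assume that $\mathrm{E}[|Y|^p]<\infty$, $\mathrm{E}[(X^j)^2]<\infty$, and $\mathrm{E}\left[|\langle w_p^{*},X\rangle-Y|^{2(p-2)}(X^j)^4\right]<\infty$ for all $j\in[d]$. If $$n\ge196\,\sigma_p^2\,\bigl(d+2\log(4/\delta)\bigr),$$ then with probability at least $1-\delta$, $$R_p(\hat w_p)-R_p(w_p^{*})\le\frac{32768}{p-1}\,\frac{\mathrm{E}\left[\|\nabla\ell_p(\langle w_p^{*},X\rangle-Y)\|_{H_p^{-1}}^2\right]}{n\delta}+\frac{1}{p-1}\left(\frac{2097152\,\mathrm{E}\left[\|\nabla\ell_p(\langle w_p^{*},X\rangle-Y)\|_{H_p^{-1}}^2\right]\sigma_p^{6-2p}c_p^{2-p}c_p^{*}}{n\delta}\right)^{1/(p-1)},$$ where $c_p^{*}:=\mathrm{E}\left[|Y-\langle w_p^{*},X\rangle|^{2(p-2)}\right]$ and $c_p:=\mathrm{Tr}(H_p^{-1}\Sigma)$ with $\Sigma:=\mathrm{E}[XX^T]$.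
   Context: $X=(X^1,\dots,X^d)$ is a random vector in $\mathbb{R}^d$, $Y$ a real random variable, $(X_i,Y_i)_{i=1}^n$ i.i.d. copies of $(X,Y)$, $[d]=\{1,\dots,d\}$. Standing assumption: the support of $X$ is not contained in any hyperplane, i.e. $\mathrm{P}(\langle w,X\rangle=0)=1$ only if $w=0$. Let $\ell_p(t):=|t|^p/[p(p-1)]$, $R_p(w):=\mathrm{E}[\ell_p(\langle w,X\rangle-Y)]$, $R_{p,n}(w):=\frac1n\sum_{i=1}^n\ell_p(\langle w,X_i\rangle-Y_i)$. Let $w_p^{*}$ be the minimizer of $R_p$ over $\mathbb{R}^d$ and $\hat w_p\in\arg\min_{w\in\mathbb{R}^d}R_{p,n}(w)$ any empirical risk minimizer. Gradients and Hessians of the loss are with respect to $w$: $\nabla\ell_p(\langle w,X\rangle-Y)=\ell_p'(\langle w,X\rangle-Y)X$ and, when $\langle w,X\rangle\ne Y$, $\nabla^2\ell_p(\langle w,X\rangle-Y)=|\langle w,X\rangle-Y|^{p-2}XX^T$. $H_p:=\nabla^2R_p(w_p^{*})$. For a positive semi-definite matrix $A$, $\|v\|_A:=\sqrt{v^TAv}$. For $q\in[1,\infty)$ define $\|w\|_{L^q,p}:=\mathrm{E}\left[\|w\|_{\nabla^2\ell_p(\langle w_p^{*},X\rangle-Y)}^q\right]^{1/q}$ (so $\|w\|_{L^2,p}=\|w\|_{H_p}$). Then $\sigma_p^2:=\left(\sup_{w\in\mathbb{R}^d\setminus\{0\}}\|w\|_{L^4,p}/\|w\|_{L^2,p}\right)^4$,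 and $\sigma_p:=\sqrt{\sigma_p^2}$. *)

(* Defs.v *)
From HB Require Import structures.
From mathcomp Require Import all_boot all_order all_algebra.
From mathcomp Require Import all_classical all_reals all_analysis.

Set Implicit Arguments.
Unset Strict Implicit.
Unset Printing Implicit Defensive.

Import Order.TTheory GRing.Theory Num.Theory.
Import numFieldNormedType.Exports.

Local Open Scope classical_set_scope.
Local Open Scope ring_scope.

(* Random vectors are valued in [d.-tuple R], which carries the product Borel
   sigma-algebra; [vect] moves them to the normed space of column vectors. *)
Definition vect (R : realType) (d : nat) (x : d.-tuple R) : 'cV[R]_d :=
  \col_i tnth x i.

Definition dot (R : realType) (d : nat) (w v : 'cV[R]_d) : R :=
  (w^T *m v) 0 0.

Definition gradient (R : realType) (d : nat) (f : 'cV[R]_d -> R)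
    (w : 'cV[R]_d) : 'cV[R]_d :=
  \col_i 'D_(delta_mx i 0) f w.

Definition hessian (R : realType) (d : nat) (f : 'cV[R]_d -> R)
    (w : 'cV[R]_d) : 'M[R]_d :=
  \matrix_(i, j) 'D_(delta_mx i 0) (fun v => 'D_(delta_mx j 0) f v) w.

Definition mxnorm (R : realType) (d : nat) (A : 'M[R]_d) (v : 'cV[R]_d) : R :=
  Num.sqrt ((v^T *m A *m v) 0 0).

Definition ell (R : realType) (p t : R) : R := `|t| `^ p / (p * (p - 1)).

Definition residual (R : realType) (d : nat) (x : d.-tuple R) (y : R)
    (w : 'cV[R]_d) : R :=
  dot w (vect x) - y.

(* The parameter [w] comes last so that [gradient] and [hessian] of
   [loss p x y] differentiate in [w]. *)
Definition loss (R : realType) (d : nat) (p : R) (x : d.-tuple R) (y : R)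
    (w : 'cV[R]_d) : R :=
  ell p (residual x y w).

(* Population quantities that may a priori be infinite take values in
   [\bar R]: reading an infinite expectation as [0] through [fine] would
   change the meaning of the bounds in which they occur. *)
Definition risk (dT : measure_display) (T : measurableType dT) (R : realType)
    (P : probability T R) (d : nat) (X : T -> d.-tuple R) (Y : T -> R)
    (p : R) (w : 'cV[R]_d) : \bar R :=
  'E_P[fun t => loss p (X t) (Y t) w]%E.

Definition empirical_risk (R : realType) (d n : nat)
    (x : 'I_n -> d.-tuple R) (y : 'I_n -> R) (p : R) (w : 'cV[R]_d) : R :=
  n%:R^-1 * \sum_(i < n) loss p (x i) (y i) w.

(* Derivatives are taken of the real-valued function [fine \o risk]; the risk
   is finite everywhere when [|Y|^p] and [|X|^p] are integrable. *)
Definition risk_hessian (dT : measure_display) (T : measurableType dT)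
    (R : realType) (P : probability T R) (d : nat)
    (X : T -> d.-tuple R) (Y : T -> R) (p : R) (w : 'cV[R]_d) : 'M[R]_d :=
  hessian (fun v => fine (risk P X Y p v)) w.

(* For [p < 2] the Hessian of the loss at [wstar] need not exist at data points
   with zero residual; its value there is irrelevant when the residual is
   nonzero almost surely. *)
Definition Lq_norm (dT : measure_display) (T : measurableType dT)
    (R : realType) (P : probability T R) (d : nat)
    (X : T -> d.-tuple R) (Y : T -> R) (p : R) (wstar : 'cV[R]_d)
    (q : R) (w : 'cV[R]_d) : \bar R :=
  Lnorm P q%:E
    (fun t => (mxnorm (hessian (loss p (X t) (Y t)) wstar) w)%:E).

Definition sigma2 (dT : measure_display) (T : measurableType dT)
    (R : realType) (P : probability T R) (d : nat)
    (X : T -> d.-tuple R) (Y : T -> R) (p : R) (wstar : 'cV[R]_d) : \bar R :=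
  (ereal_sup [set Lq_norm P X Y p wstar 4 w / Lq_norm P X Y p wstar 2 w
             | w in [set w : 'cV[R]_d | w != 0%R]] ^+ 4)%E.

Definition sigma (dT : measure_display) (T : measurableType dT)
    (R : realType) (P : probability T R) (d : nat)
    (X : T -> d.-tuple R) (Y : T -> R) (p : R) (wstar : 'cV[R]_d) : \bar R :=
  sqrte (sigma2 P X Y p wstar).

Definition second_moment (dT : measure_display) (T : measurableType dT)
    (R : realType) (P : probability T R) (d : nat)
    (X : T -> d.-tuple R) : 'M[R]_d :=
  \matrix_(i, j) fine 'E_P[fun t => (tnth (X t) i * tnth (X t) j)%R]%E.

Definition gradient_moment (dT : measure_display) (T : measurableType dT)
    (R : realType) (P : probability T R) (d : nat)
    (X : T -> d.-tuple R) (Y : T -> R) (p : R) (wstar : 'cV[R]_d) : \bar R :=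
  'E_P[fun t => (mxnorm (invmx (risk_hessian P X Y p wstar))
                        (gradient (loss p (X t) (Y t)) wstar) ^+ 2)%R]%E.

Definition c_p (dT : measure_display) (T : measurableType dT)
    (R : realType) (P : probability T R) (d : nat)
    (X : T -> d.-tuple R) (Y : T -> R) (p : R) (wstar : 'cV[R]_d) : R :=
  \tr (invmx (risk_hessian P X Y p wstar) *m second_moment P X).

Definition c_p_star (dT : measure_display) (T : measurableType dT)
    (R : realType) (P : probability T R) (d : nat)
    (X : T -> d.-tuple R) (Y : T -> R) (p : R) (wstar : 'cV[R]_d) : \bar R :=
  'E_P[fun t => (`|Y t - dot wstar (vect (X t))| `^ (2 * (p - 2)))%R]%E.

Definition identically_distributed (dT dS : measure_display)
    (T : measurableType dT) (S : measurableType dS) (R : realType)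
    (P : probability T R) (Z Z' : T -> S) : Prop :=
  forall B : set S, measurable B -> P (Z @^-1` B) = P (Z' @^-1` B).

Definition mutually_independent (dT dS : measure_display)
    (T : measurableType dT) (S : measurableType dS) (R : realType)
    (P : probability T R) (n : nat) (Z : 'I_n -> T -> S) : Prop :=
  forall (J : {set 'I_n}) (B : 'I_n -> set S),
    (forall i, measurable (B i)) ->
    P (\bigcap_(i in [set` J]) (Z i @^-1` B i)) =
      (\prod_(i in J) P (Z i @^-1` B i))%E.

Definition iid_copies (dT dS : measure_display)
    (T : measurableType dT) (S : measurableType dS) (R : realType)
    (P : probability T R) (Z : T -> S) (n : nat) (Zs : 'I_n -> T -> S) : Prop :=
  mutually_independent P Zs /\
  forall i, identically_distributed P (Zs i) Z.

(* Main.v *)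
Require Import Defs.
From HB Require Import structures.
From mathcomp Require Import all_boot all_order all_algebra.
From mathcomp Require Import all_classical all_reals all_analysis.
From mathcomp Require Import measurable_realfun.
From mathcomp Require Import zify ring lra.

Import Order.TTheory GRing.Theory Num.Theory.
Import numFieldNormedType.Exports.

Local Open Scope classical_set_scope.
Local Open Scope ring_scope.

Set Implicit Arguments.
Unset Strict Implicit.
Unset Printing Implicit Defensive.

(** Why the bound holds. At the population minimizer wstar let r be the
residual, [om = |r|^(p-2)] the curvature of the loss, H the Hessian of the risk
and G the gradient moment. For a competitor w, put [s = <w - wstar, X>], and let
D be the norm of [w - wstar] for H.

The Bregman divergence of [ell p] between r and [r + s] lies between
[s^2 (|r| + |s|)^(p-2) / 4] and [2 / (p-1) om s^2] ([bregman_ge],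
[bregman_le_quadratic]). The upper bound, averaged over the population where the
linear term vanishes, gives an excess risk of at most [2 / (p-1) D^2]
([excess_risk_le]), so that D remains to be bounded. The lower bound, averaged
over the sample, gives for an empirical minimizer
   [\sum_i s_i^2 (|r_i| + |s_i|)^(p-2) / 4 <= - \sum_i dell p r_i * s_i]
([empirical_basic_inequality]). By Cauchy-Schwarz the right-hand side is at most
D times the dual norm of the sum of the gradients. The gradients are centered and
independent, so the square of that norm has mean n G, and Markov's inequality
bounds it outside an event of probability delta / 2 ([gradient_event]).

The left-hand side has to be bounded below by a multiple of [n D^2], uniformly
in w, although [(|r| + |s|)^(p-2)] can be much smaller than om and the data have
few moments. Both difficulties are met by keeping only the data points in a set
[good], on which om and the dual norm of x are bounded. There [|s|] is at most
a multiple of D, hence [(|r| + |s|)^(p-2) >= m om / 2] where m is the minimum of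
1 and of [(D^(2-p) kap)^-1] for an explicit constant kap
([truncated_weight_le]). In coordinates in which H is the identity
([posdef_factor]), what is left is a lower bound for
[\sum_i <theta, v_i>^2] over all theta, where the v_i are independent bounded
vectors whose second moments are still at least half of the identity: the
truncation loses little because [sigma2] compares fourth and second moments
([truncated_lower_tail]). For one theta, the sum of nonnegative terms
has an exponential lower tail as soon as their second moment is finite
([iid_lower_tail]). To treat all theta at once, a unit vector is rounded to one of
[2^(7d)] grid points, coordinate by coordinate, always to the neighbour at which
the form minus n / 4 times the squared norm is smaller. The only cost is a
quarter of the squared mesh times the trace of the empirical form
([round_vector]), for which a crude upper tail bound suffices ([quadratic_form_lower_tail]).

Altogether [(3 / 128) m D <= sqrt (2 G / (n delta))] outside an event of probability
delta. If [m = 1] this bounds [D^2] by the first term of the theorem. Otherwise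
[m D = D^(p-1) / kap], and solving for D gives the second term, of exponent
[1 / (p-1)] ([excess_from_truncated_bound]). Two degenerate cases are excluded
beforehand: an infinite G makes the bound trivial, and in dimension 0 the
supremum over the empty set makes [sigma2] infinite, which contradicts the
condition on the sample size. *)

(** * Convexity and concavity of real powers *)
Section power_functions.
Context {R : realType}.
Implicit Types a x y m r v p s : R.

(** Between 0 and [m] a concave power lies above its chord, of slope [m^(a-1)]. *)
Lemma powR_lb_monomial a x m : 0 < a < 1 -> 0 <= x <= m ->
  x * m `^ (a - 1) <= x `^ a.
Proof.
move=> /andP[a0 a1] /andP[]; rewrite le_eqVlt => /predU1P[<- _|x0 xm].
  by rewrite mul0r powR_ge0.
rewrite -[leRHS]mulr_powRB1//; last exact: ltW.
apply: ler_pM => //; rewrite ?powR_ge0//; first exact: ltW.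
rewrite -opprB !powRN lef_pV2 ?posrE ?powR_gt0//; last exact: lt_le_trans xm.
by apply: ge0_ler_powR; rewrite ?subr_ge0 ?nnegrE// ltW//; exact: lt_le_trans xm.
Qed.

(** Concavity, as Young's inequality with exponents [1/a] and [1/(1-a)] for
[x^a] and [y^(1-a)]. *)
Lemma powR_le_tangent a x y : 0 < a < 1 -> 0 <= x -> 0 < y ->
  x `^ a <= y `^ a + a * y `^ (a - 1) * (x - y).
Proof.
move=> /andP[a0 a1] x0 y0.
have a1' : 0 < 1 - a by rewrite subr_gt0.
have := @conjugate_powR R (x `^ a) (y `^ (1 - a)) a^-1 (1 - a)^-1
  (powR_ge0 _ _) (powR_ge0 _ _).
rewrite !invr_gt0 !invrK => /(_ a0 a1').
rewrite addrC subrK => /(_ erefl).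
rewrite -!powRrM !mulfV ?gt_eqF// !powRr1//; last exact: ltW.
move=> h.
have yy : y `^ (1 - a) * y `^ (a - 1) = 1.
  rewrite -powRD; last by rewrite (gt_eqF y0) implybT.
  by rewrite (_ : 1 - a + (a - 1) = 0) ?powRr0//; ring.
rewrite -[leLHS]mulr1 -[X in _ * X <= _]yy mulrA.
apply: (le_trans (ler_wpM2r (powR_ge0 _ _) h)).
rewrite -(@mulr_powRB1 _ y a) ?(ltW y0)//.
lra.
Qed.

(** Convexity, as Young's inequality with exponents [p] and [p/(p-1)] for [x]
and [y^(p-1)]. *)
Lemma powR_ge_tangent p x y : 1 < p -> 0 <= x -> 0 <= y ->
  y `^ p + p * y `^ (p - 1) * (x - y) <= x `^ p.
Proof.
move=> p1 x0 y0.
have p0 : 0 < p by exact: lt_trans p1.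
have p1' : 0 < p - 1 by rewrite subr_gt0.
have pn : p != 0 by rewrite gt_eqF.
have pn' : p - 1 != 0 by rewrite gt_eqF.
have := @conjugate_powR R x (y `^ (p - 1)) p (p / (p - 1)) x0
  (powR_ge0 _ _) p0 (divr_gt0 p0 p1').
rewrite -powRrM mulrCA mulfV// mulr1.
have -> : p^-1 + (p / (p - 1))^-1 = 1 by field; rewrite pn pn'.
move=> /(_ erefl) h.
rewrite -[y `^ p](@mulr_powRB1 _ y p)// in h *.
have := ler_wpM2l (ltW p0) h.
have -> : p * (x `^ p / p + y * y `^ (p - 1) / (p / (p - 1))) =
  x `^ p + (p - 1) * (y * y `^ (p - 1)) by field; rewrite pn pn'.
lra.
Qed.

End power_functions.

(** * Bregman divergence of the loss *)
Section loss_derivative.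
Context {R : realType}.
Implicit Types x y m r v s t : R.
Variable p : R.
Hypothesis p12 : 1 < p < 2.

(** [dell] is the derivative of [ell p]; the odd power [spow] carries the
estimates because their constants do not depend on [p]. *)
Definition spow (t : R) : R := Num.sg t * `|t| `^ (p - 1).
Definition dell (t : R) : R := spow t / (p - 1).

Let p1_gt0 : 0 < p - 1. Proof. by move: p12; lra. Qed.
Let a01 : 0 < p - 1 < 1. Proof. by move: p12; lra. Qed.
Let p_m2 : p - 2 = (p - 1) - 1. Proof. by ring. Qed.

Lemma spow_pos x : 0 <= x -> spow x = x `^ (p - 1).
Proof.
move=> x0; rewrite /spow ger0_norm//; move: x0.
rewrite le_eqVlt => /predU1P[<-|x0]; last by rewrite gtr0_sg// mul1r.
by rewrite sgr0 mul0r powR0// gt_eqF.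
Qed.

Lemma spowN x : spow (- x) = - spow x.
Proof. by rewrite /spow sgrN normrN mulNr. Qed.

Lemma spow_neg x : x <= 0 -> spow x = - (- x) `^ (p - 1).
Proof. by move=> x0; rewrite -{1}(opprK x) spowN spow_pos// oppr_ge0. Qed.

Lemma dellN x : dell (- x) = - dell x.
Proof. by rewrite /dell spowN mulNr. Qed.

Lemma mulr_powR_subr2 r : 0 <= r -> r * r `^ (p - 2) = r `^ (p - 1).
Proof. by move=> r0; rewrite p_m2 mulr_powRB1. Qed.

(** Steps away from the origin are controlled by the tangent at [r], steps
towards it by the chord from the origin; a step that crosses the origin needs
both, whence the factor 2. *)
Lemma spow_lipschitz r v : r != 0 ->
  `|spow (r + v) - spow r| <= 2 * `|v| * `|r| `^ (p - 2).
Proof.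
wlog r0 : r v / 0 < r => [H|_].
  case: (ltrgtP r 0) => // [r0|r0] _; last by apply: H => //; rewrite gt_eqF.
  have := H (- r) (- v); rewrite oppr_gt0 oppr_eq0 => /(_ r0 (ltr0_neq0 r0)).
  by rewrite -opprD !spowN !normrN -opprD normrN.
rewrite (gtr0_norm r0) (spow_pos (ltW r0)) p_m2.
have [xr|xr] := leP r (r + v).
  have v0 : 0 <= v by lra.
  rewrite spow_pos; last lra.
  have h := powR_le_tangent a01 (addr_ge0 (ltW r0) v0) r0.
  rewrite ger0_norm ?subr_ge0; last first.
    by apply: ge0_ler_powR; rewrite ?nnegrE; move: a01; lra.
  rewrite ger0_norm// -mulrA.
  have : 0 <= v * r `^ (p - 1 - 1) by rewrite mulr_ge0 ?powR_ge0.
  move: h p12; set X := r `^ _; set Y := r `^ _; set Z := _ `^ _.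
  by rewrite (_ : r + v - r = v); [nra|ring].
have v0 : v < 0 by lra.
have [x0|x0] := leP 0 (r + v).
  rewrite spow_pos// ler0_norm ?subr_le0; last first.
    by apply: ge0_ler_powR; rewrite ?nnegrE; move: a01; lra.
  rewrite (ltr0_norm v0).
  have h : (r + v) * r `^ (p - 1 - 1) <= (r + v) `^ (p - 1).
    by apply: powR_lb_monomial => //; rewrite x0 ltW.
  have e : r * r `^ (p - 1 - 1) = r `^ (p - 1) by rewrite mulr_powRB1// ltW.
  have : 0 <= - v * r `^ (p - 1 - 1).
    by rewrite mulr_ge0 ?powR_ge0 ?oppr_ge0// ltW.
  lra.
rewrite spow_neg ?(ltW x0)// (ltr0_norm v0).
have Z0 := powR_ge0 r (p - 1 - 1).
have h : (- (r + v)) `^ (p - 1) <= _ := powR_le_tangent a01 _ r0.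
have {h}/h : 0 <= - (r + v) by lra.
have e : r * r `^ (p - 1 - 1) = r `^ (p - 1) by rewrite mulr_powRB1// ltW.
have Y0 := powR_ge0 r (p - 1).
have X0 := powR_ge0 (- (r + v)) (p - 1).
rewrite ler0_norm; last lra.
set Y := r `^ (p - 1 - 1) in Z0 e *.
have h1 : 0 <= - (r + v) * Y * (2 - p) by rewrite !mulr_ge0//; move: p12; lra.
have h2 : 0 <= - (r + v) * Y by rewrite mulr_ge0//; lra.
have h3 : 0 <= r * Y * (p - 1) by rewrite e mulr_ge0 ?(ltW p1_gt0).
lra.
Qed.

(** Subadditivity: [y^(p-1)] and [(x-y)^(p-1)] both lie above the chord of
slope [x^(p-2)] through the origin. *)
Lemma powR_sub_le x y : 0 <= y <= x ->
  x `^ (p - 1) - y `^ (p - 1) <= (x - y) `^ (p - 1).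
Proof.
move=> /andP[y0 yx].
have x0 : 0 <= x by lra.
have h1 : y * x `^ (p - 1 - 1) <= y `^ (p - 1).
  by apply: powR_lb_monomial => //; rewrite y0.
have h2 : (x - y) * x `^ (p - 1 - 1) <= (x - y) `^ (p - 1).
  by apply: powR_lb_monomial => //; lra.
have e : x * x `^ (p - 1 - 1) = x `^ (p - 1) by rewrite mulr_powRB1.
lra.
Qed.

(** Subadditivity of [t^(p-1)] on either side of the origin; the factor 2
accounts for a step that crosses it. *)
Lemma spow_holder r v :
  `|spow (r + v) - spow r| <= 2 * `|v| `^ (p - 1).
Proof.
wlog r0 : r v / 0 <= r => [H|].
  case: (leP 0 r) => [|r0]; first exact: H.
  have := H (- r) (- v); rewrite oppr_ge0 => /(_ (ltW r0)).
  by rewrite -opprD !spowN !normrN -opprD normrN.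
have V0 := powR_ge0 `|v| (p - 1).
rewrite (spow_pos r0).
have [xr|xr] := leP r (r + v).
  have v0 : 0 <= v by lra.
  rewrite spow_pos; last lra.
  rewrite ger0_norm ?subr_ge0; last first.
    by apply: ge0_ler_powR; rewrite ?nnegrE; move: a01; lra.
  have : (r + v) `^ (p - 1) - r `^ (p - 1) <= (r + v - r) `^ (p - 1).
    by apply: powR_sub_le; lra.
  move: V0; rewrite ger0_norm// (_ : r + v - r = v); [lra|ring].
have v0 : v < 0 by lra.
move: V0; rewrite (ltr0_norm v0).
have [x0|x0] := leP 0 (r + v) => V0.
  rewrite spow_pos// ler0_norm ?subr_le0; last first.
    by apply: ge0_ler_powR; rewrite ?nnegrE; move: a01; lra.
  have : r `^ (p - 1) - (r + v) `^ (p - 1) <= (r - (r + v)) `^ (p - 1).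
    by apply: powR_sub_le; lra.
  rewrite (_ : r - (r + v) = - v); [lra|ring].
rewrite spow_neg ?(ltW x0)//.
have Y0 := powR_ge0 r (p - 1).
have X0 := powR_ge0 (- (r + v)) (p - 1).
rewrite ler0_norm; last lra.
have : r `^ (p - 1) <= (- v) `^ (p - 1).
  by apply: ge0_ler_powR; rewrite ?nnegrE; move: a01; lra.
have : (- (r + v)) `^ (p - 1) <= (- v) `^ (p - 1).
  by apply: ge0_ler_powR; rewrite ?nnegrE; move: a01; lra.
lra.
Qed.

(** On the segment from [r] to [r + v] the slope of [spow] is at least
[(p-1) (|r| + |v|)^(p-2)], because the slope decreases with the distance to the
origin. *)
Lemma spow_monotone r v :
  (p - 1) * (v ^+ 2 * (`|r| + `|v|) `^ (p - 2)) <= v * (spow (r + v) - spow r).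
Proof.
wlog v0 : r v / 0 < v => [H|].
  case: (ltrgtP 0 v) => [|v0|<-]; first exact: H.
    have := H (- r) (- v); rewrite oppr_gt0 => /(_ v0).
    by rewrite -opprD !spowN !normrN sqrrN -opprD mulrNN.
  by rewrite expr0n/= !mul0r mulr0.
rewrite (gtr0_norm v0) expr2 -mulrA mulrCA ler_pM2l// p_m2.
have M0 := powR_ge0 (`|r| + v) (p - 1 - 1).
have [r0|r0] := leP 0 r.
  rewrite ger0_norm// in M0 *.
  rewrite !spow_pos//; last lra.
  have := @powR_le_tangent R (p - 1) r (r + v) a01 r0.
  have -> : 0 < r + v by lra.
  move=> /(_ isT); rewrite (_ : r - (r + v) = - v); [lra|ring].
have [x0|x0] := leP (r + v) 0.
  rewrite !spow_neg ?(ltW r0)//.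
  have := @powR_le_tangent R (p - 1) (- (r + v)) (- r) a01.
  rewrite oppr_ge0 oppr_gt0 => /(_ x0 r0).
  have : v * (`|r| + v) `^ (p - 1 - 1) <= v * (- r) `^ (p - 1 - 1).
    rewrite ler_pM2l// (ltr0_norm r0) -opprB !powRN lef_pV2 ?posrE ?powR_gt0//; try lra.
    by apply: ge0_ler_powR; rewrite ?nnegrE; move: a01; lra.
  rewrite (_ : - (r + v) - - r = - v); last ring.
  move: p12; set X := _ `^ _; set Y := _ `^ _; set Z := _ `^ _; set W := _ `^ _.
  nra.
rewrite (spow_neg (ltW r0)) (spow_pos (ltW x0)).
rewrite (ltr0_norm r0) in M0 *.
have : (r + v) * (- r + v) `^ (p - 1 - 1) <= (r + v) `^ (p - 1).
  by apply: powR_lb_monomial => //; lra.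
have : (- r) * (- r + v) `^ (p - 1 - 1) <= (- r) `^ (p - 1).
  by apply: powR_lb_monomial => //; lra.
have : (p - 1) * (v * (- r + v) `^ (p - 1 - 1)) <= v * (- r + v) `^ (p - 1 - 1).
  by rewrite ler_piMl ?mulr_ge0//; move: p12; lra.
lra.
Qed.

Lemma ell_convex r s : ell p r + s * dell r <= ell p (r + s).
Proof.
have p1 : 1 < p by move: p12; lra.
rewrite /ell /dell.
have h := @powR_ge_tangent R p `|r + s| `|r| p1 (normr_ge0 _) (normr_ge0 _).
have h2 : s * spow r <= `|r| `^ (p - 1) * (`|r + s| - `|r|).
  rewrite /spow mulrA mulrC ler_wpM2l ?powR_ge0//.
  have e := normrEsg r.
  suff : Num.sg r * (r + s) <= `|r + s| by lra.
  rewrite (le_trans (ler_norm _))// normrM.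
  by rewrite ler_piMl// normr_sg lern1 leq_b1.
have ppos : 0 < p * (p - 1) by rewrite mulr_gt0//; lra.
rewrite ler_pdivlMr// mulrDl mulfVK ?gt_eqF//.
have -> : s * (spow r / (p - 1)) * (p * (p - 1)) = p * (s * spow r).
  by field; rewrite gt_eqF.
apply: le_trans h; rewrite lerD2l -mulrA ler_wpM2l//; lra.
Qed.

Definition bregman r s : R := ell p (r + s) - ell p r - s * dell r.

Lemma bregman_ge0 r s : 0 <= bregman r s.
Proof. by rewrite /bregman; have := ell_convex r s; lra. Qed.

(** The divergence is at most its symmetrization, so that bounds on the
increments of [dell] become upper bounds on it. *)
Lemma bregman_le_monotone r s : bregman r s <= s * (dell (r + s) - dell r).
Proof.
rewrite /bregman; have := ell_convex (r + s) (- s); rewrite addrK; lra.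
Qed.

(** Uniform in [r] and of order larger than 1 in [s]: this bound
differentiates the risk, and makes divergences integrable. *)
Lemma bregman_le_holder r s : bregman r s <= 2 / (p - 1) * `|s| `^ p.
Proof.
apply: (le_trans (bregman_le_monotone r s)).
rewrite -(@mulr_powRB1 _ `|s| p)//; last by move: p12; lra.
rewrite /dell -mulrBl mulrA ler_pdivrMr// mulrAC divfK ?gt_eqF//.
rewrite (le_trans (ler_norm _))// normrM [leRHS]mulrCA ler_wpM2l//.
exact: spow_holder.
Qed.

Lemma bregman_le_quadratic r s : r != 0 ->
  bregman r s <= 2 / (p - 1) * (`|r| `^ (p - 2) * s ^+ 2).
Proof.
move=> r0; apply: (le_trans (bregman_le_monotone r s)).
rewrite /dell -mulrBl mulrA ler_pdivrMr// mulrAC divfK ?gt_eqF//.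
rewrite (le_trans (ler_norm _))// normrM.
rewrite (le_trans (ler_wpM2l (normr_ge0 _) (spow_lipschitz s r0)))//.
by rewrite -real_normK ?num_real// le_eqVlt; apply/orP; left; apply/eqP; ring.
Qed.

(** Convexity at [r] and at the midpoint [r + s/2] leaves [s/2] times the
increment of [dell] over the first half step, which [spow_monotone] bounds
below; 1/4 is the ratio of [(s/2)^2] to [s^2]. *)
Lemma bregman_ge r s :
  4^-1 * (s ^+ 2 * (`|r| + `|s|) `^ (p - 2)) <= bregman r s.
Proof.
have e : s / 2 + s / 2 = s by field.
have h1 := ell_convex (r + s / 2) (s / 2).
rewrite -addrA e in h1.
have h2 := ell_convex r (s / 2).
have h3 := spow_monotone r (s / 2).
have h4 : s ^+ 2 * (`|r| + `|s|) `^ (p - 2) <=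
          s ^+ 2 * (`|r| + `|s / 2|) `^ (p - 2).
  have [->|s0] := eqVneq s 0; first by rewrite expr0n/= !mul0r.
  have s2 : 0 < `|s / 2| by rewrite normr_gt0 mulf_neq0.
  rewrite ler_wpM2l ?sqr_ge0// -opprB !powRN.
  have ss : `|s| = `|s / 2| + `|s / 2| by rewrite normrM (@ger0_norm _ 2^-1); lra.
  rewrite lef_pV2 ?posrE ?powR_gt0//; [|have := normr_ge0 r; lra..].
  by apply: ge0_ler_powR; rewrite ?nnegrE; have := normr_ge0 r; move: p12; lra.
have h5 : s / 2 * (dell (r + s / 2) - dell r) =
    s / 2 * (spow (r + s / 2) - spow r) / (p - 1).
  by rewrite /dell -mulrBl mulrA.
have h6 : (s / 2) ^+ 2 * (`|r| + `|s / 2|) `^ (p - 2) <=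
    s / 2 * (dell (r + s / 2) - dell r).
  by rewrite h5 ler_pdivlMr// mulrC.
have h7 : (s / 2) ^+ 2 = 4^-1 * s ^+ 2 by rewrite expr_div_n; field.
rewrite h7 -mulrA in h6.
rewrite /bregman; lra.
Qed.

End loss_derivative.

(** * Gradient and Hessian of the loss *)
Section directional_derivatives.
Context {R : realType}.

Lemma derive_along_line (V : normedModType R) (f : V -> R) (a v : V) :
  'D_v f a = 'D_1 (fun h : R => f (a + h *: v)) 0.
Proof.
rewrite /derive; set F := (X in lim (X @ _) = _).
set G := (X in _ = lim (X @ _)); suff -> : F = G by [].
apply/funext => h; rewrite /F /G /=.
by rewrite addr0 scale0r addr0 [h *: 1]mulr1 (addrC _ a).
Qed.

(** A remainder bound with an explicit constant survives integration; this
form is used pointwise for the loss and again for the risk. *)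
Lemma is_derive_superlinear (f : R -> R) (l C q : R) : 1 < q ->
  (forall h, `|f h - f 0 - h * l| <= C * `|h| `^ q) -> is_derive (0 : R) (1 : R) f l.
Proof.
move=> q1 H.
suff L : h^-1 *: ((f \o shift 0) (h *: 1) - f 0) @[h --> 0^'] --> l.
  by apply: DeriveDef; [apply/cvg_ex; exists l | exact: cvg_lim L].
have C0 : 0 <= C.
  have := H 1; rewrite normr1 powR1 mulr1; exact: le_trans.
apply/cvgrPdist_le => e e0.
have q0 : 0 < q - 1 by lra.
have d0 : 0 < (e / (C + 1)) `^ (q - 1)^-1 by rewrite powR_gt0// divr_gt0//; lra.
near=> h.
have h0 : h != 0 by near: h; exact: nbhs_dnbhs_neq.
have hd : `|h| <= (e / (C + 1)) `^ (q - 1)^-1.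
  near: h; apply: nbhs_dnbhs; near=> h; near: h.
  have := @nbhs0_le R R^o _ d0; apply.
rewrite /= addr0 [h *: 1]mulr1.
have hn : 0 < `|h| by rewrite normr_gt0.
rewrite distrC -(ler_pM2l hn) -normrM mulrBr /GRing.scale/= mulVKf//.
apply: (le_trans (H h)).
rewrite -(@mulr_powRB1 _ _ q)//; last lra.
rewrite mulrCA ler_pM2l//.
have : `|h| `^ (q - 1) <= e / (C + 1).
  rewrite -[leRHS](@powRr1 _ (e / (C + 1))); last by rewrite divr_ge0//; lra.
  have qq : 1 = (q - 1)^-1 * (q - 1) by rewrite mulVf ?gt_eqF.
  rewrite [X in _ <= _ `^ X]qq powRrM.
  by apply: ge0_ler_powR; rewrite ?nnegrE ?powR_ge0 ?normr_ge0// ltW.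
rewrite ler_pdivlMr; last lra.
have := powR_ge0 `|h| (q - 1); lra.
Unshelve. all: by end_near. Qed.

End directional_derivatives.

Section loss_derivatives.
Context {R : realType}.
Variable p : R.
Hypothesis p12 : 1 < p < 2.

Lemma is_derive_ell_affine (r c : R) :
  is_derive (0 : R) (1 : R) (fun h => ell p (r + h * c)) (dell p r * c).
Proof.
apply: (@is_derive_superlinear _ _ _ (2 / (p - 1) * `|c| `^ p) p).
  by move: p12; lra.
move=> h; rewrite mul0r addr0.
rewrite (_ : _ - _ - _ = bregman p r (h * c)); last by rewrite /bregman; ring.
rewrite ger0_norm ?bregman_ge0//.
rewrite (le_trans (bregman_le_holder p12 _ _))//.
by rewrite normrM powRM// (mulrC (`|h| `^ p)) mulrA.
Qed.

Lemma is_derive_dell (r : R) : r != 0 ->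
  is_derive r 1 (dell p) (`|r| `^ (p - 2)).
Proof.
have p1 : p - 1 != 0 by rewrite gt_eqF//; move: p12; lra.
have pos (x : R) : 0 < x -> is_derive x 1 (dell p) (x `^ (p - 2)).
  move=> x0.
  apply: (@near_eq_is_derive _ _ _ (fun y => (p - 1)^-1 *: (y `^ (p - 1)))).
    near=> y; rewrite /dell spow_pos//; first by rewrite mulrC.
    apply: ltW.
    near: y; exact: lt_nbhsr.
  rewrite (_ : _ `^ (p - 2) = (p - 1)^-1 *: ((p - 1) * x `^ (p - 1 - 1))).
    by apply: is_deriveZ; exact: is_derive1_powR.
  rewrite /GRing.scale/= mulrA mulVf// mul1r; congr (_ `^ _); ring.
case: (ltrgtP r 0) => // r0 _; last by rewrite gtr0_norm//; exact: pos.
have -> : dell p = - (dell p \o -%R).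
  by apply/funext => x; rewrite !fctE dellN opprK.
rewrite (_ : _ `^ _ = - ((- r) `^ (p - 2) * -1)); last first.
  by rewrite mulrN1 opprK ltr0_norm.
apply: is_deriveN; apply: is_derive1_comp.
by apply: pos; rewrite oppr_gt0.
Unshelve. all: by end_near. Qed.

Lemma is_derive_dell_affine (r c k : R) : r != 0 ->
  is_derive (0 : R) (1 : R) (fun h => dell p (r + h * c) * k) (`|r| `^ (p - 2) * c * k).
Proof.
move=> r0.
rewrite (_ : (fun _ => _) = k \*: (dell p \o (fun h => r + h * c))); last first.
  by apply/funext => h; rewrite /= mulrC.
rewrite mulrC; apply: is_deriveZ; apply: is_derive1_comp.
  by rewrite mul0r addr0; exact: is_derive_dell.
apply: is_derive_eq.
by rewrite scaler0 !add0r mul1r [c%:A]mulr1.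
Qed.

Lemma dell_homogeneous (h c : R) : 0 < h ->
  dell p (h * c) = h `^ (p - 1) * dell p c.
Proof.
move=> h0; rewrite /dell /spow sgrM (gtr0_sg h0) mul1r normrM (gtr0_norm h0).
by rewrite powRM ?(ltW h0)// mulrCA !mulrA.
Qed.

(** The formula also holds at [r = 0], where the derivative need not exist: if
[dell p c * k] is nonzero the difference quotients diverge, so that their limit
is the default value 0, and [0 `^ (p - 2)] is 0 as well. Hence the Hessian of the
loss has a single expression, valid at every data point. *)
Lemma derive_dell_affine (r c k : R) :
  'D_1 (fun h : R => dell p (r + h * c) * k) (0 : R) = `|r| `^ (p - 2) * c * k.
Proof.
have [->|r0] := eqVneq r 0; last first.
  by have /@derive_val := @is_derive_dell_affine r c k r0.
rewrite normr0 powR0 ?mul0r; last by rewrite lt_eqF//; move: p12; lra.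
have [kc0|kc0] := eqVneq (dell p c * k) 0.
  rewrite (_ : (fun _ => _) = cst (0 : R)) ?derive_cst//; apply/funext => h /=.
  move/eqP: kc0; rewrite add0r mulf_eq0 => /orP[/eqP c0|/eqP->]; last by rewrite mulr0.
  have {}c0 : c = 0.
    apply/eqP; move/eqP: c0; rewrite /dell /spow !mulf_eq0 sgr_eq0 invr_eq0.
    rewrite powR_eq0 normr_eq0 subr_eq0 (gt_eqF (proj1 (andP p12))) orbF.
    by case: (c == 0).
  by rewrite c0 mulr0 /dell spow_pos// powR0 ?mul0r// gt_eqF//; move: p12; lra.
rewrite /derive dvgP// => /cvg_ex[l /= Hl].
move/eqP: kc0; apply.
(* For h > 0 the quotient is h^(p-2) * (dell p c * k). If it converged, its
   product with h^(2-p), which tends to 0, would vanish in the limit; but this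
   product is the nonzero constant dell p c * k. *)
have {}Hl : h `^ (p - 2) * (dell p c * k) @[h --> (0 : R)^'+] --> l.
  apply: cvg_trans (cvg_dnbhs_at_right Hl); apply: near_eq_cvg.
  near=> h; have h0 : 0 < h by near: h; exact: nbhs_right_gt.
  rewrite /GRing.scale/= mulr1 addr0 mul0r !add0r dell_homogeneous//.
  rewrite [dell p 0]/dell [spow p 0]/spow sgr0 !mul0r subr0 -(@mulr_powRB1 _ h (p - 1)) ?(ltW h0)//.
    rewrite !mulrA mulVf ?gt_eqF// mul1r.
    by rewrite (_ : p - 1 - 1 = p - 2)//; ring.
  by move: p12; lra.
have p2 : 0 < 2 - p by move: p12; lra.
have := cvgM (powR_cvg0 p2) Hl.
rewrite mul0r => H.
suff H2 : (fun h : R => h `^ (2 - p)) * (fun h : R => h `^ (p - 2) * (dell p c * k))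
     @ (0 : R)^'+ --> dell p c * k.
  exact: (cvg_unique _ H2 (H _)).
apply: cvg_near_cst; near=> h.
have h0 : 0 < h by near: h; exact: nbhs_right_gt.
rewrite [LHS](_ : _ = h `^ (2 - p) * (h `^ (p - 2) * (dell p c * k)))//.
rewrite mulrA -powRD; last by rewrite (gt_eqF h0) implybT.
by rewrite (_ : 2 - p + (p - 2) = 0) ?powRr0 ?mul1r//; ring.
Unshelve. all: by end_near. Qed.

Variables (d : nat) (x : d.-tuple R) (y : R).

Lemma residual_line (w v : 'cV[R]_d) (h : R) :
  residual x y (w + h *: v) = residual x y w + h * dot v (vect x).
Proof.
rewrite /residual /dot linearD linearZ/= mulmxDl -scalemxAl.
rewrite [X in X - _]mxE [X in _ + X - _]mxE.
ring.
Qed.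

Lemma dot_delta (i : 'I_d) : dot (delta_mx i 0) (vect x) = tnth x i.
Proof. by rewrite /dot trmx_delta -rowE !mxE. Qed.

Lemma derive_loss (w : 'cV[R]_d) (i : 'I_d) :
  'D_(delta_mx i 0) (loss p x y) w = dell p (residual x y w) * tnth x i.
Proof.
rewrite derive_along_line; under eq_fun do rewrite /loss residual_line dot_delta.
by have /@derive_val := is_derive_ell_affine (residual x y w) (tnth x i).
Qed.

Lemma gradient_loss (w : 'cV[R]_d) :
  gradient (loss p x y) w = dell p (residual x y w) *: vect x.
Proof. by apply/colP => i; rewrite !mxE derive_loss. Qed.

Lemma hessian_loss (w : 'cV[R]_d) :
  hessian (loss p x y) w =
  `|residual x y w| `^ (p - 2) *: (vect x *m (vect x)^T).
Proof.
apply/matrixP => i j; rewrite !mxE big_ord1 !mxE.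
rewrite derive_along_line; under eq_fun do rewrite derive_loss residual_line dot_delta.
by rewrite derive_dell_affine mulrA.
Qed.

End loss_derivatives.

(** * Expectations and independence *)
Section level_sets.
Context {R : realType} {dT : measure_display} {T : measurableType dT}.
Implicit Types f : T -> R.

Lemma measurable_sublevel f (c : R) : measurable_fun setT f ->
  measurable [set t | f t <= c].
Proof.
move=> mf; rewrite (_ : [set s | _] = f @^-1` `]-oo, c]%classic).
  by rewrite -[X in measurable X]setTI; exact: mf.
by apply/seteqP; split => s /=; rewrite in_itv.
Qed.

Lemma measurable_superlevel f (c : R) : measurable_fun setT f ->
  measurable [set t | c <= f t].
Proof.
move=> mf; rewrite (_ : [set s | _] = f @^-1` `[c, +oo[%classic).
  by rewrite -[X in measurable X]setTI; exact: mf.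
by apply/seteqP; split => s /=; rewrite in_itv/= andbT.
Qed.

Lemma measurable_zero_set f : measurable_fun setT f ->
  measurable [set t | f t = 0].
Proof.
by move=> mf; rewrite -[X in measurable X]setTI -/(f @^-1` [set 0]); exact: mf.
Qed.

Lemma measurable_neq0_set f : measurable_fun setT f ->
  measurable [set t | f t != 0].
Proof.
move=> mf; rewrite (_ : [set t | _] = ~` [set t | f t = 0]).
  by apply: measurableC; exact: measurable_zero_set.
by apply/seteqP; split => t /=; [move/eqP|move=> h; apply/eqP].
Qed.

Lemma measurable_fun_natr (b : T -> bool) : measurable [set t | b t] ->
  measurable_fun setT (fun t => (b t)%:R : R).
Proof.
move=> mb; rewrite (_ : (fun _ => _) = \1_[set t | b t]).
  exact: measurable_indic.
apply/funext => t; rewrite indicE; congr (_%:R).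
by case E : (b t); [rewrite mem_set|rewrite memNset//= E].
Qed.

End level_sets.

Section expectation_toolkit.
Context {R : realType} {dT : measure_display} {T : measurableType dT}.
Variable P : probability T R.
Implicit Types (f g : T -> R) (a c k : R).

Definition integ (f : T -> R) : Prop := P.-integrable setT (EFin \o f).

Lemma integ_measurable f : integ f -> measurable_fun setT f.
Proof. by move=> /integrableP[/measurable_EFinP]. Qed.

Lemma integE f : integ f -> (\int[P]_t (f t)%:E)%E = (\int[P]_t f t)%:E.
Proof. by move=> fi; rewrite /Rintegral fineK//; exact: integrable_fin_num. Qed.

Lemma integ_le f g : measurable_fun setT f -> (forall t, `|f t| <= g t) ->
  integ g -> integ f.
Proof.
move=> mf fg; apply: le_integrable => //; first exact/measurable_EFinP.
by move=> t _; rewrite /= lee_fin (le_trans (fg t))// ler_norm.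
Qed.

Lemma integD f g : integ f -> integ g -> integ (fun t => f t + g t).
Proof. by move=> fi gi; exact: (integrableD measurableT fi gi). Qed.

Lemma integZ k f : integ f -> integ (fun t => k * f t).
Proof. by move=> fi; exact: (integrableZl measurableT k fi). Qed.

Lemma integB f g : integ f -> integ g -> integ (fun t => f t - g t).
Proof. by move=> fi gi; exact: (integrableB measurableT fi gi). Qed.

Lemma integ_cst k : integ (fun=> k).
Proof. exact: finite_measure_integrable_cst. Qed.

Lemma integ_sum (I : Type) (s : seq I) (Q : pred I) (f : I -> T -> R) :
  (forall i, Q i -> integ (f i)) -> integ (fun t => \sum_(i <- s | Q i) f i t).
Proof.
move=> fi; have := @integrable_sum _ _ _ P setT measurableT _ s Q _ fi.
by congr (_.-integrable _ _); apply/funext => t /=; rewrite sumEFin.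
Qed.

Lemma integ_ge0 f : measurable_fun setT f -> (forall t, 0 <= f t) ->
  (\int[P]_t (f t)%:E < +oo)%E -> integ f.
Proof.
move=> mf f0 foo; apply/integrableP; split; first exact/measurable_EFinP.
apply: le_lt_trans foo; apply: ge0_le_integral => //=.
- by apply/measurable_EFinP; exact: measurableT_comp.
- exact/measurable_EFinP.
- by move=> t _; rewrite ger0_norm.
Qed.

Lemma integ_lty f : integ f -> (\int[P]_t (f t)%:E < +oo)%E.
Proof. by move=> fi; rewrite integE// ltry. Qed.

Lemma integ_bounded f c : measurable_fun setT f -> (forall t, `|f t| <= c) ->
  integ f.
Proof. by move=> mf fc; apply: (integ_le mf fc); exact: integ_cst. Qed.

Lemma mean_sum (I : Type) (s : seq I) (Q : pred I) (f : I -> T -> R) :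
  (forall i, Q i -> integ (f i)) ->
  \int[P]_t (\sum_(i <- s | Q i) f i t) = \sum_(i <- s | Q i) \int[P]_t f i t.
Proof.
move=> fi; elim: s => [|x s IH].
  rewrite big_nil (_ : (fun _ => _) = fun=> 0); last first.
    by apply/funext => t; rewrite big_nil.
  by rewrite Rintegral_cst// mul0r.
rewrite big_cons; case: ifPn => Qx; last first.
  by rewrite -IH; apply: eq_Rintegral => t _; rewrite big_cons (negbTE Qx).
rewrite -IH -RintegralD//; last exact: integ_sum.
- by apply: eq_Rintegral => t _; rewrite big_cons Qx.
- exact: fi.
Qed.

Lemma mean_cst k : \int[P]_t k = k :> R.
Proof.
have P1 : P setT = 1%E by exact: probability_setT.
by rewrite Rintegral_cst// [fine _](congr1 fine P1) mulr1.
Qed.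

Lemma mean_le f g : integ f -> integ g -> (forall t, f t <= g t) ->
  \int[P]_t f t <= \int[P]_t g t.
Proof. by move=> fi gi fg; exact: le_Rintegral. Qed.

Lemma mean_eq0 f : integ f -> (forall t, 0 <= f t) -> \int[P]_t f t = 0 ->
  P [set t | f t = 0] = 1%E.
Proof.
move=> fi f0 E0.
have mf := integ_measurable fi.
have H : (\int[P]_t `|(EFin \o f) t| = 0)%E.
  by under eq_integral => t _ do rewrite /= ger0_norm//; rewrite integE ?E0.
have mf' : measurable_fun setT (EFin \o f) by exact/measurable_EFinP.
have /(ae_eq_integral_abs P measurableT mf') [N [mN N0 HN]] := H.
have mA := measurable_zero_set mf.
apply/eqP; rewrite eq_le probability_le1//=.
have <- : P (~` N) = 1%E by rewrite probability_setC// N0 sube0.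
apply: le_measure; rewrite ?inE//; first exact: measurableC.
move=> t Nt /=; apply: contrapT => ft; apply: Nt; apply: HN => /=.
by move=> /(_ Logic.I)[].
Qed.

Lemma markov_ge0 g a : measurable_fun setT g -> (forall t, 0 <= g t) -> 0 < a ->
  (a%:E * P [set t | a <= g t]%R <= \int[P]_t (g t)%:E)%E.
Proof.
move=> mg g0 a0.
have mA := measurable_superlevel a mg.
rewrite -[X in P X]setIT -integral_indic// -ge0_integralZl//; last 2 first.
  by apply/measurable_EFinP.
  by rewrite lee_fin ltW.
apply: ge0_le_integral => //.
- by move=> t _; rewrite -EFinM lee_fin mulr_ge0// ltW.
- by apply/measurable_EFinP; apply: measurable_funM.
- exact/measurable_EFinP.
move=> t _; rewrite -EFinM lee_fin indicE.
have [ta|ta] := pselect ([set t | a <= g t]%R t).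
  by rewrite mem_set// mulr1.
by rewrite memNset// mulr0.
Qed.

End expectation_toolkit.

Section independence.
Context {R : realType} {dT dS : measure_display}.
Context {T : measurableType dT} {S : measurableType dS}.
Variable P : probability T R.
Local Open Scope ereal_scope.
Import HBNNSimple.

(** Linearity extends the identity from indicators to simple functions,
and monotone convergence to nonnegative functions. Below [W] is the product of
the other factors of an independent family. *)
Lemma factorize_of_indicators (W : T -> R) (Z : T -> S) (c : R) :
  measurable_fun setT W -> measurable_fun setT Z ->
  (forall t, 0 <= W t)%R ->
  (forall B, measurable B ->
     \int[P]_t (W t * \1_B (Z t))%:E = c%:E * P (Z @^-1` B)) ->
  forall f : S -> R, measurable_fun setT f -> (forall s, 0 <= f s)%R ->
  \int[P]_t (W t * f (Z t))%:E = c%:E * \int[P]_t (f (Z t))%:E.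
Proof.
move=> mW mZ W0 H f mf f0.
have mZi B : measurable B -> measurable (Z @^-1` B).
  by move=> mB; rewrite -[X in measurable X]setTI; exact: mZ.
have simple (g : {nnsfun S >-> R}) :
    \int[P]_t (W t * g (Z t))%:E = c%:E * \int[P]_t (g (Z t))%:E.
  have mgZ : measurable_fun setT (g \o Z) by exact: measurableT_comp.
  have mi (y : R) : measurable_fun setT (fun t => \1_(g @^-1` [set y]) (Z t) : R).
    exact: measurableT_comp.
  have step (V : T -> R) : measurable_fun setT V -> (forall t, 0 <= V t)%R ->
      \int[P]_t (V t * g (Z t))%:E = \sum_(y \in range g)
        y%:E * \int[P]_t (V t * \1_(g @^-1` [set y]) (Z t))%:E.
    move=> mV V0.
    have yge0 y t : (0 <= V t * (y * \1_(g @^-1` [set y]) (Z t)))%R.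
      by rewrite mulr_ge0//; have := nnfun_muleindic_ge0 g y (Z t); rewrite lee_fin.
    under eq_integral => t _.
      rewrite EFinM fimfunE -fsumEFin// ge0_mule_fsumr; last first.
        by move=> y; rewrite EFinM nnfun_muleindic_ge0.
      over.
    rewrite ge0_integral_fsum//; last 2 first.
      - move=> y; apply/measurable_EFinP; apply: measurable_funM => //.
        exact: measurable_funM.
      - by move=> y t _; rewrite -EFinM lee_fin.
    apply: eq_fsbigr => y /set_mem[s _ sy].
    have y0 : (0 <= y)%R by rewrite -sy.
    rewrite -ge0_integralZl//.
    - by apply: eq_integral => t _; rewrite -!EFinM; congr (_%:E); rewrite mulrCA.
    - by apply/measurable_EFinP; exact: measurable_funM.
    - by move=> t _; rewrite lee_fin mulr_ge0.
  rewrite step//.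
  have -> : \int[P]_t (g (Z t))%:E = \int[P]_t (cst 1%R t * g (Z t))%:E.
    by apply: eq_integral => t _; rewrite mul1r.
  rewrite step// ge0_mule_fsumr; last first.
    move=> y; have [ [s _ <-]|yg] := pselect (range g y).
      apply: mule_ge0; rewrite ?lee_fin//; apply: integral_ge0 => t _.
      by rewrite lee_fin mulr_ge0.
    rewrite (_ : g @^-1` [set y] = set0).
      by rewrite integral0_eq ?mule0// => t _; rewrite indic0 mulr0.
    by apply/seteqP; split => // s /= sy; apply: yg; exists s.
  apply: eq_fsbigr => y _.
  rewrite H// muleCA; congr (_ * (_ * _)).
  under eq_integral do rewrite mul1r.
  rewrite -[RHS]/(\int[P]_t (\1_(Z @^-1` (g @^-1` [set y])) t)%:E).
  by rewrite integral_indic ?setIT//; exact: mZi.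
have mfE : measurable_fun setT (EFin \o f) by exact/measurable_EFinP.
pose g := nnsfun_approx measurableT mfE.
have cvgg t : (g n (Z t))%:E @[n --> \oo] --> (f (Z t))%:E.
  by apply: (cvg_nnsfun_approx measurableT mfE) => // s _; rewrite lee_fin.
have ndg t : {homo (fun n => g n (Z t)) : m n / (m <= n)%N >-> (m <= n)%R}.
  by move=> m n mn; exact/lefP/nd_nnsfun_approx.
have mgZ n : measurable_fun setT (g n \o Z) by exact: measurableT_comp.
have L1 : \int[P]_t (W t * g n (Z t))%:E @[n --> \oo] -->
          \int[P]_t (W t * f (Z t))%:E.
  have := @cvg_monotone_convergence _ _ _ P setT measurableT
    (fun n t => (W t * g n (Z t))%:E).
  rewrite (_ : \int[P]_t (W t * f (Z t))%:E =
     \int[P]_(t in setT) (limn (fun n => (W t * g n (Z t))%:E))).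
    apply => [n|n t _|t _ m n mn].
    - by apply/measurable_EFinP; apply: measurable_funM => //; exact: mgZ.
    - by rewrite lee_fin mulr_ge0.
    - by rewrite lee_fin ler_wpM2l// ndg.
  apply: eq_integral => t _; apply/esym/cvg_lim => //.
  under eq_fun do rewrite EFinM.
  by rewrite EFinM; apply: cvgeZl => //; exact: cvgg.
have L2 : \int[P]_t (g n (Z t))%:E @[n --> \oo] --> \int[P]_t (f (Z t))%:E.
  have := @cvg_monotone_convergence _ _ _ P setT measurableT
    (fun n t => (g n (Z t))%:E).
  rewrite (_ : \int[P]_t (f (Z t))%:E =
     \int[P]_(t in setT) (limn (fun n => (g n (Z t))%:E))).
    apply => [n|n t _|t _ m n mn].
    - by apply/measurable_EFinP; exact: mgZ.
    - by rewrite lee_fin.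
    - by rewrite lee_fin ndg.
  by apply: eq_integral => t _; apply/esym/cvg_lim => //; exact: cvgg.
have E : (fun n => \int[P]_t (W t * g n (Z t))%:E) =
         (fun n => c%:E * \int[P]_t (g n (Z t))%:E).
  by apply/funext => n; exact: simple.
rewrite E in L1.
by apply: (cvg_unique _ L1) => //; exact: cvgeZl.
Qed.

Variables (n : nat) (Z : 'I_n -> T -> S).
Hypothesis mZ : forall i, measurable_fun setT (Z i).
Hypothesis indep : mutually_independent P Z.

Let integral_indic_comp i (B : set S) : measurable B ->
  \int[P]_t (\1_B (Z i t))%:E = P (Z i @^-1` B).
Proof.
move=> mB; rewrite -[LHS]/(\int[P]_t (\1_(Z i @^-1` B) t)%:E) integral_indic ?setIT//.
by rewrite -[X in measurable X]setTI; exact: mZ.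
Qed.

(** Independence is a statement on indicators. By induction on [k], the
factors of index at least [k] being indicators, one more factor at a time is
replaced by an arbitrary function. *)
Lemma independent_integral_prod (f : 'I_n -> S -> R) :
  (forall i, measurable_fun setT (f i)) -> (forall i s, 0 <= f i s)%R ->
  (forall i, \int[P]_t (f i (Z i t))%:E < +oo) ->
  \int[P]_t (\prod_i f i (Z i t))%:E = \prod_i \int[P]_t (f i (Z i t))%:E.
Proof.
move=> mf f0 foo.
suff H (k : nat) : (k <= n)%N -> forall f : 'I_n -> S -> R,
   (forall i, measurable_fun setT (f i)) -> (forall i s, 0 <= f i s)%R ->
   (forall i, \int[P]_t (f i (Z i t))%:E < +oo) ->
   (forall i : 'I_n, (k <= i)%N ->
     exists2 B, measurable B & f i = \1_B) ->
   \int[P]_t (\prod_i f i (Z i t))%:E = \prod_i \int[P]_t (f i (Z i t))%:E.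
  by apply: (H n) => // i; rewrite leqNgt ltn_ord.
clear f mf f0 foo.
elim: k => [_|k IH kn] f mf f0 foo fB.
  have /choice[B HB] : forall i, exists B, measurable B /\ f i = \1_B.
    by move=> i; have [B mB fiB] := fB i (leq0n i); exists B.
  have := indep [set: 'I_n]%SET (fun i => (HB i).1).
  rewrite (_ : [set` _] = setT); last by apply/seteqP; split => // i _ /=; rewrite finset.in_setT.
  have -> : (\prod_(i in [set: 'I_n]%SET) P (Z i @^-1` B i))%E =
      \prod_i \int[P]_t (f i (Z i t))%:E.
    apply: eq_big => [i|i _]; first by rewrite finset.in_setT.
    by rewrite (HB i).2 integral_indic_comp//; exact: (HB i).1.
  move=> <-.
  transitivity (\int[P]_t (\1_(\bigcap_i (Z i @^-1` B i)) t)%:E).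
    apply: eq_integral => t _; congr (_%:E); rewrite indicE.
    have [tB|tB] := pselect ((\bigcap_i (Z i @^-1` B i)) t).
      rewrite mem_set// big1// => i _.
      by rewrite (HB i).2 indicE mem_set//; exact: tB.
    rewrite memNset//.
    move/existsNP : tB => [i /not_implyP[_ tBi]].
    by rewrite (bigD1 i)//= (HB i).2 indicE memNset// mul0r.
  have mA : measurable (\bigcap_i (Z i @^-1` B i)).
    apply: fin_bigcap_measurable => // i _.
    by rewrite -[X in measurable X]setTI; apply: mZ => //; exact: (HB i).1.
  by rewrite integral_indic ?setIT.
pose i0 := Ordinal kn.
pose W t : R := (\prod_(i < n | i != i0) f i (Z i t))%R.
pose f' B (i : 'I_n) : S -> R := if i == i0 then \1_B else f i.
have foo1 B i : measurable B -> \int[P]_t (f' B i (Z i t))%:E < +oo.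
  move=> mB; rewrite /f'; case: eqP => [->|_]; last exact: foo.
  by rewrite integral_indic_comp// (le_lt_trans (probability_le1 _ _)) ?ltry//; 
    rewrite -[X in measurable X]setTI; exact: mZ.
have Hf' B : measurable B -> \int[P]_t (W t * \1_B (Z i0 t))%:E =
   (\prod_(i < n | i != i0) \int[P]_t (f i (Z i t))%:E) * P (Z i0 @^-1` B).
  move=> mB.
  have e0 : f' B i0 = \1_B by rewrite /f' eqxx.
  have eN i : i != i0 -> f' B i = f i by rewrite /f' => /negbTE ->.
  have H : \int[P]_t (\prod_i f' B i (Z i t))%:E =
           \prod_i \int[P]_t (f' B i (Z i t))%:E.
    apply: (IH (ltnW kn)).
    - by move=> i; rewrite /f'; case: eqP.
    - by move=> i s; rewrite /f'; case: eqP.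
    - by move=> i; exact: foo1.
    - move=> i; have [-> _|ii0] := eqVneq i i0; first by rewrite e0; exists B.
      rewrite eN// leq_eqVlt => /predU1P[ki|]; last exact: fB.
      by move: ii0; rewrite -val_eqE/= ki eqxx.
  rewrite muleC -integral_indic_comp//.
  have -> : \prod_(i < n | i != i0) \int[P]_t (f i (Z i t))%:E =
     \prod_(i < n | i != i0) \int[P]_t (f' B i (Z i t))%:E.
    by apply: eq_bigr => i /eN ->.
  rewrite (bigD1 i0)//= e0 in H; rewrite -H.
  apply: eq_integral => t _; rewrite (bigD1 i0)//= e0 mulrC.
  by congr (_%:E); congr (_ * _)%R; apply: eq_bigr => i /eN ->.
have c_fin : \prod_(i < n | i != i0) \int[P]_t (f i (Z i t))%:E \is a fin_num.
  apply: (big_ind (fun x => x \is a fin_num)) => // [x y|i _]; first exact: fin_numM.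
  by rewrite ge0_fin_numE//; apply: integral_ge0 => t _; rewrite lee_fin.
rewrite (bigD1 i0)//= muleC -(fineK c_fin).
rewrite -(@factorize_of_indicators W)//.
- by apply: eq_integral => t _; rewrite (bigD1 i0)//= mulrC.
- rewrite /W; under eq_fun do rewrite -big_filter.
  apply: measurable_prod => i _; exact: measurableT_comp.
- by move=> t; apply: prodr_ge0.
- by move=> B mB; rewrite Hf' ?fineK.
Qed.

End independence.

(** * Moments of sums of independent copies *)
Section iid.
Context {R : realType} {dT dS : measure_display}.
Context {T : measurableType dT} {S : measurableType dS}.
Variables (P : probability T R) (n : nat) (Z0 : T -> S) (Z : 'I_n -> T -> S).
Hypothesis mZ0 : measurable_fun setT Z0.
Hypothesis mZ : forall i, measurable_fun setT (Z i).
Hypothesis iid : iid_copies P Z0 Z.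
Implicit Types f g : S -> R.

Lemma iid_integral f i : measurable_fun setT f -> (forall s, 0 <= f s) ->
  (\int[P]_t (f (Z i t))%:E = \int[P]_t (f (Z0 t))%:E)%E.
Proof.
move=> mf f0.
have mfE : measurable_fun setT (EFin \o f) by exact/measurable_EFinP.
have fE0 : {in setT, forall s, (0 <= (EFin \o f) s)%E}.
  by move=> s _; rewrite lee_fin.
have := @ge0_integral_pushforward _ _ _ _ _ _ (mZ i) P _ _ measurableT mfE fE0.
have := @ge0_integral_pushforward _ _ _ _ _ _ mZ0 P _ _ measurableT mfE fE0.
rewrite !preimage_setT /= => <- <-.
by apply: eq_measure_integral => A mA _; exact: iid.2.
Qed.

Lemma iid_integ f i : measurable_fun setT f -> integ P (f \o Z0) ->
  integ P (f \o Z i).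
Proof.
move=> mf /integrableP[_ foo]; apply/integrableP; split.
  by apply/measurable_EFinP; exact: measurableT_comp.
have := @iid_integral (fun s => `|f s|) i; rewrite /= => ->//.
exact: measurableT_comp.
Qed.

Lemma iid_mean f i : measurable_fun setT f -> integ P (f \o Z0) ->
  \int[P]_t f (Z i t) = \int[P]_t f (Z0 t).
Proof.
move=> mf fi.
(* f is the difference of the nonnegative functions |f| + f and |f| *)
pose fm s := `|f s|; pose fp s := `|f s| + f s.
have mfm : measurable_fun setT fm by exact: measurableT_comp.
have mfp : measurable_fun setT fp by exact: measurable_funD.
have fE s : f s = fp s - fm s by rewrite /fp /fm addrAC subrr add0r.
have fm0 s : 0 <= fm s by exact: normr_ge0.
have fp0 s : 0 <= fp s.
  by rewrite /fp; have := ler_norm (- f s); rewrite normrN; lra.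
have ifm : integ P (fm \o Z0) by exact: (integrable_abse fi).
have ifp : integ P (fp \o Z0) by exact: integD.
transitivity (\int[P]_t fp (Z i t) - \int[P]_t fm (Z i t)).
  rewrite -RintegralB//; [|exact: iid_integ..].
  by apply: eq_Rintegral => t _; rewrite fE.
transitivity (\int[P]_t fp (Z0 t) - \int[P]_t fm (Z0 t)).
  by rewrite /Rintegral !iid_integral.
by rewrite -RintegralB//; apply: eq_Rintegral => t _; rewrite fE.
Qed.

(** Independence of two samples, as the product over all samples with constant
factors 1 at the other indices. *)
Lemma iid_mean_mul_ge0 f g i j : i != j ->
  measurable_fun setT f -> measurable_fun setT g ->
  (forall s, 0 <= f s) -> (forall s, 0 <= g s) ->
  integ P (f \o Z0) -> integ P (g \o Z0) ->
  integ P (fun t => f (Z i t) * g (Z j t)) /\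
  \int[P]_t (f (Z i t) * g (Z j t)) = \int[P]_t f (Z0 t) * \int[P]_t g (Z0 t).
Proof.
move=> ij mf mg f0 g0 fi gi.
pose h k := if k == i then f else if k == j then g else cst 1.
have hk k : k != i -> k != j -> h k = cst 1.
  by rewrite /h => /negbTE -> /negbTE ->.
have mh k : measurable_fun setT (h k).
  by rewrite /h; case: ifP => // _; case: ifP => // _; exact: measurable_cst.
have h0 k s : 0 <= h k s.
  by rewrite /h; case: ifP => // _; case: ifP => // _; exact: ler01.
have hi : integ P (h i \o Z0) by rewrite /h eqxx.
have hj : integ P (h j \o Z0) by rewrite /h eq_sym (negbTE ij) eqxx.
have hint k : integ P (h k \o Z0).
  have [->//|ki] := eqVneq k i; have [->//|kj] := eqVneq k j.
  by rewrite hk//; exact: integ_cst.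
have := @independent_integral_prod _ _ _ _ _ P n Z mZ iid.1 h mh h0.
have hoo (k : 'I_n) : (\int[P]_t (h k (Z k t))%:E < +oo)%E.
  by rewrite iid_integral//; exact: (integ_lty (hint k)).
move=> /(_ hoo).
have ji : j != i by rewrite eq_sym.
under eq_integral => t _.
  rewrite (bigD1 i)//= (bigD1 j)//= big1 ?mulr1; last first.
    by move=> k /andP[ki kj]; rewrite hk.
  over.
rewrite (bigD1 i)//= (bigD1 j)//= big1 ?mule1; last first.
  move=> k /andP[ki kj]; rewrite hk//=; by rewrite (integE (integ_cst P 1)) mean_cst.
rewrite !iid_integral// (integE hi) (integE hj) /h eqxx (negbTE ji) eqxx => H.
have ifg : integ P (fun t => f (Z i t) * g (Z j t)).
  apply: integ_ge0; first by apply: measurable_funM; exact: measurableT_comp.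
    by move=> t; exact: mulr_ge0.
  by rewrite H ltry.
by split=> //; move: H; rewrite (integE ifg) -EFinM => -[].
Qed.

Lemma iid_mean_mul g i j : i != j -> measurable_fun setT g ->
  integ P (fun t => g (Z0 t)) -> \int[P]_t g (Z0 t) = 0 ->
  integ P (fun t => g (Z i t) * g (Z j t)) /\
  \int[P]_t (g (Z i t) * g (Z j t)) = 0.
Proof.
move=> ij mf fi fE0.
pose fm s := `|g s|; pose fp s := `|g s| + g s.
have mfm : measurable_fun setT fm by exact: measurableT_comp.
have mfp : measurable_fun setT fp by exact: measurable_funD.
have fE s : g s = fp s - fm s by rewrite /fp /fm addrAC subrr add0r.
have fm0 s : 0 <= fm s by exact: normr_ge0.
have fp0 s : 0 <= fp s.
  by rewrite /fp; have := ler_norm (- g s); rewrite normrN; lra.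
have ifm : integ P (fm \o Z0) by exact: (integrable_abse fi).
have ifp : integ P (fp \o Z0) by exact: integD.
have [ipp Epp] := iid_mean_mul_ge0 ij mfp mfp fp0 fp0 ifp ifp.
have [ipm Epm] := iid_mean_mul_ge0 ij mfp mfm fp0 fm0 ifp ifm.
have [imp Emp] := iid_mean_mul_ge0 ij mfm mfp fm0 fp0 ifm ifp.
have [imm Emm] := iid_mean_mul_ge0 ij mfm mfm fm0 fm0 ifm ifm.
have e0 : \int[P]_t fp (Z0 t) - \int[P]_t fm (Z0 t) = 0.
  by rewrite -fE0 -RintegralB//; apply: eq_Rintegral => t _; rewrite fE.
have e : (fun t => g (Z i t) * g (Z j t)) = (fun t =>
   (fp (Z i t) * fp (Z j t) - fp (Z i t) * fm (Z j t)) -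
   (fm (Z i t) * fp (Z j t) - fm (Z i t) * fm (Z j t))).
  by apply/funext => t; rewrite !fE; ring.
rewrite e; split; first by apply: integB; apply: integB.
rewrite !RintegralB//; [|exact: integB..].
rewrite Epp Epm Emp Emm.
by rewrite -mulrBr -mulrBr e0 !mulr0 subrr.
Qed.

(** The mixed terms vanish by independence and centering: the second moment
grows like [n] rather than [n^2], which is the source of the rate [1/n]. *)
Lemma iid_second_moment g : measurable_fun setT g ->
  integ P (fun t => g (Z0 t)) -> \int[P]_t g (Z0 t) = 0 ->
  integ P (fun t => g (Z0 t) ^+ 2) ->
  integ P (fun t => (\sum_i g (Z i t)) ^+ 2) /\
  \int[P]_t ((\sum_i g (Z i t)) ^+ 2) = n%:R * \int[P]_t (g (Z0 t) ^+ 2).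
Proof.
move=> mg ig E0 ig2.
have e : (fun t => (\sum_i g (Z i t)) ^+ 2) =
         (fun t => \sum_i \sum_j g (Z i t) * g (Z j t)).
  apply/funext => t; rewrite expr2 mulr_suml; apply: eq_bigr => i _.
  by rewrite mulr_sumr.
have mg2 : measurable_fun setT (fun s => g s ^+ 2) by exact: measurable_funX.
have iij i j : integ P (fun t => g (Z i t) * g (Z j t)).
  have [<-|ij] := eqVneq i j; last exact: (iid_mean_mul ij mg ig E0).1.
  exact: (@iid_integ (fun s => g s * g s) i mg2 ig2).
rewrite e; split; first by apply: integ_sum => i _; apply: integ_sum => j _.
rewrite mean_sum; last by move=> i _; apply: integ_sum.
rewrite (eq_bigr (fun=> \int[P]_t (g (Z0 t) ^+ 2))).
  by rewrite sumr_const card_ord mulr_natl.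
move=> i _; rewrite mean_sum//.
rewrite (bigD1 i)//= big1 ?addr0.
  exact: (@iid_mean (fun s => g s * g s) i mg2 ig2).
by move=> j ji; apply: (iid_mean_mul _ mg ig E0).2; rewrite eq_sym.
Qed.

(** Chernoff's method: the exponential of a sum of independent terms is a
product of independent factors. *)
Lemma markov_iid_prod f a c : 0 < a -> measurable_fun setT f ->
  (forall s, 0 <= f s) -> (\int[P]_t (f (Z0 t))%:E <= c%:E)%E ->
  (P [set t | a <= \prod_i f (Z i t)]%R <= (c ^+ n / a)%:E)%E.
Proof.
move=> a0 mf f0 fc.
have mp : measurable_fun setT (fun t => \prod_i f (Z i t)).
  by apply: measurable_prod => i _; exact: measurableT_comp.
have p0 t : 0 <= \prod_i f (Z i t) by exact: prodr_ge0.
have := markov_ge0 P mp p0 a0.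
rewrite (@independent_integral_prod _ _ _ _ _ P n Z mZ iid.1 (fun=> f))//; last first.
  by move=> i; rewrite iid_integral// (le_lt_trans fc) ?ltry.
move=> H.
have {}H : (a%:E * P [set t | a <= \prod_i f (Z i t)]%R <= (c ^+ n)%:E)%E.
  apply: (le_trans H).
  under eq_bigr do rewrite iid_integral//.
  have I0 : (0 <= \int[P]_t (f (Z0 t))%:E)%E.
    by apply: integral_ge0 => t _; rewrite lee_fin.
  have Ifin : (\int[P]_t (f (Z0 t))%:E)%E \is a fin_num.
    by rewrite ge0_fin_numE// (le_lt_trans fc) ?ltry.
  rewrite (eq_bigr (fun=> (fine (\int[P]_t (f (Z0 t))%:E))%:E)); last first.
    by move=> i _; rewrite fineK.
  rewrite prodEFin prodr_const card_ord lee_fin lerXn2r ?nnegrE//.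
  - exact: fine_ge0.
  - by rewrite -lee_fin (le_trans I0).
  - by rewrite -lee_fin fineK.
by rewrite EFinM lee_pdivlMr// muleC.
Qed.

End iid.

(** * One-sided exponential tail bounds *)
Section exponential_bounds.
Context {R : realType}.
Implicit Types x : R.

Lemma expR_ge_taylor2 x : 0 <= x -> 1 + x + x ^+ 2 / 2 <= expR x.
Proof.
move=> x0; rewrite [leLHS](_ : _ = series (exp_coeff x) 3).
  rewrite /expR; apply: nondecreasing_cvgn_le; last exact: is_cvg_series_exp_coeff.
  by apply: nondecreasing_series => i _ _; rewrite /exp_coeff/= divr_ge0// exprn_ge0.
rewrite /series/= !big_nat_recr//= big_geq// /exp_coeff/= !factS fact0 !muln1.
by rewrite expr0 expr1 add0r !divr1.
Qed.

Lemma expRN_le_taylor2 x : 0 <= x -> expR (- x) <= 1 - x + x ^+ 2 / 2.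
Proof.
move=> x0; have h := expR_ge_taylor2 x0.
have p1 : 0 < 1 + x + x ^+ 2 / 2 by have := sqr_ge0 x; lra.
rewrite expRN (@le_trans _ _ (1 + x + x ^+ 2 / 2)^-1)//.
  by rewrite lef_pV2 ?posrE ?expR_gt0.
rewrite -div1r ler_pdivrMr//.
(* the two quadratic Taylor polynomials have product 1 + x^4 / 4 *)
have -> : (1 - x + x ^+ 2 / 2) * (1 + x + x ^+ 2 / 2) = 1 + (x ^+ 2 / 2) ^+ 2.
  by field.
by rewrite lerDl sqr_ge0.
Qed.

Lemma expR_le_chord x : 0 <= x <= 2^-1 -> expR x <= 1 + 2 * x.
Proof.
move=> /andP[x0 x1]; rewrite -[x in expR x]opprK expRN.
have h := expR_ge1Dx (- x).
have p1 : 0 < 1 - x by lra.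
rewrite (@le_trans _ _ (1 - x)^-1)//; first by rewrite lef_pV2 ?posrE ?expR_gt0.
by rewrite -div1r ler_pdivrMr//; nra.
Qed.

End exponential_bounds.

Section iid_tails.
Context {R : realType} {dT dS : measure_display}.
Context {T : measurableType dT} {S : measurableType dS}.
Variables (P : probability T R) (n : nat) (Z0 : T -> S) (Z : 'I_n -> T -> S).
Hypothesis mZ0 : measurable_fun setT Z0.
Hypothesis mZ : forall i, measurable_fun setT (Z i).
Hypothesis iid : iid_copies P Z0 Z.

(** Nonnegative terms have a sub-Gaussian lower tail with only two moments,
because [exp (- x) <= 1 - x + x^2 / 2] for [x >= 0]. *)
Lemma iid_lower_tail (V : S -> R) (m v lam x : R) :
  measurable_fun setT V -> (forall s, 0 <= V s) ->
  integ P (fun t => V (Z0 t)) -> integ P (fun t => V (Z0 t) ^+ 2) ->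
  m <= \int[P]_t V (Z0 t) -> \int[P]_t (V (Z0 t) ^+ 2) <= v -> 0 < lam ->
  (P [set t | \sum_i V (Z i t) <= x]%R <=
    (expR (n%:R * (- lam * m + lam ^+ 2 * v / 2) + lam * x))%:E)%E.
Proof.
move=> mV V0 iV iV2 hm hv lam0.
pose c := expR (- lam * m + lam ^+ 2 * v / 2).
have mf : measurable_fun setT (fun s => expR (- lam * V s)).
  by apply: measurableT_comp => //; apply: measurable_funM.
have fle s : expR (- lam * V s) <= 1 - lam * V s + lam ^+ 2 / 2 * V s ^+ 2.
  rewrite mulNr (le_trans (expRN_le_taylor2 _)) ?mulr_ge0 ?(ltW lam0)//.
  by rewrite exprMn le_eqVlt; apply/orP; left; apply/eqP; ring.
have i1 : integ P (fun t => 1 - lam * V (Z0 t)).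
  by apply: integB; [exact: integ_cst|exact: integZ].
have i2 : integ P (fun t => lam ^+ 2 / 2 * V (Z0 t) ^+ 2) by exact: integZ.
have fc : (\int[P]_t (expR (- lam * V (Z0 t)))%:E <= c%:E)%E.
  have ie : integ P (fun t => expR (- lam * V (Z0 t))).
    apply: (integ_le _ _ (integD i1 i2)); first exact: (measurableT_comp mf).
    by move=> t; rewrite ger0_norm ?expR_ge0.
  rewrite (integE ie) lee_fin.
  rewrite (le_trans (mean_le ie (integD i1 i2) (fun t => fle (Z0 t))))//.
  rewrite RintegralD// RintegralB//; [|exact: integ_cst|exact: integZ].
  rewrite mean_cst !RintegralZl//.
  rewrite (le_trans _ (expR_ge1Dx _))//.
  have := ler_wpM2l (ltW lam0) hm.
  have l2 : 0 <= lam ^+ 2 / 2 by rewrite mulr_ge0// sqr_ge0.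
  have := ler_wpM2l l2 hv; lra.
have -> : [set t | \sum_i V (Z i t) <= x]%R =
   [set t | expR (- lam * x) <= \prod_i expR (- lam * V (Z i t))]%R.
  apply/seteqP; split=> t /=; rewrite -expR_sum ler_expR -mulr_sumr !mulNr lerN2 ler_pM2l//.
have := markov_iid_prod mZ0 mZ iid (expR_gt0 (- lam * x)) mf
  (fun s => expR_ge0 _) fc.
by rewrite -expRN -expRM_natl -expRD mulNr opprK.
Qed.

(** At the Chernoff parameter [1 / (2 M)] the argument x of the exponential
stays between 0 and 1/2, where the exponential is at most [1 + 2 x]; only the mean
and the bound enter. *)
Lemma iid_upper_tail (U : S -> R) (u M x : R) :
  measurable_fun setT U -> (forall s, 0 <= U s <= M) -> 0 < M ->
  \int[P]_t U (Z0 t) <= u ->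
  (P [set t | x <= \sum_i U (Z i t)]%R <=
    (expR ((n%:R * (2 * u) - x) / (2 * M)))%:E)%E.
Proof.
move=> mU U0M M0 hu.
have M2 : 0 < (2 * M)^-1 by rewrite invr_gt0 mulr_gt0.
pose c := expR (u / M).
have mf : measurable_fun setT (fun s => expR (U s / (2 * M))).
  by apply: measurableT_comp => //; apply: measurable_funM.
have fle s : expR (U s / (2 * M)) <= 1 + M^-1 * U s.
  have /andP[U0 UM] := U0M s.
  rewrite (le_trans (expR_le_chord _))//.
    rewrite divr_ge0//=; last by rewrite mulr_ge0// ltW.
    by rewrite ler_pdivrMr ?mulr_gt0// mulrA mulVf ?mul1r// pnatr_eq0.
  rewrite lerD2l le_eqVlt; apply/orP; left; apply/eqP; field.
  by rewrite gt_eqF.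
have iU : integ P (fun t => U (Z0 t)).
  apply: (@integ_bounded _ _ _ _ _ M); first exact: measurableT_comp.
  by move=> t; have /andP[? ?] := U0M (Z0 t); rewrite ger0_norm.
have i1 : integ P (fun t => M^-1 * U (Z0 t)) by exact: integZ.
have i2 := integD (integ_cst P 1) i1.
have fc : (\int[P]_t (expR (U (Z0 t) / (2 * M)))%:E <= c%:E)%E.
  have ie : integ P (fun t => expR (U (Z0 t) / (2 * M))).
    apply: (integ_le _ _ i2); first exact: (measurableT_comp mf).
    by move=> t; rewrite ger0_norm ?expR_ge0.
  rewrite (integE ie) lee_fin.
  rewrite (le_trans (mean_le ie i2 (fun t => fle (Z0 t))))//.
  rewrite RintegralD//; last exact: integ_cst.
  rewrite mean_cst RintegralZl//.
  rewrite (le_trans _ (expR_ge1Dx _))// lerD2l mulrC ler_pM2r ?invr_gt0//.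
have -> : [set t | x <= \sum_i U (Z i t)]%R =
   [set t | expR (x / (2 * M)) <= \prod_i expR (U (Z i t) / (2 * M))]%R.
  by apply/seteqP; split=> t /=; rewrite -expR_sum ler_expR -mulr_suml ler_pM2r.
have := markov_iid_prod mZ0 mZ iid (expR_gt0 (x / (2 * M))) mf
  (fun s => expR_ge0 _) fc.
rewrite -expRN -expRM_natl -expRD; congr (_ <= (expR _)%:E)%E.
by field; rewrite gt_eqF.
Qed.

End iid_tails.

(** * Rounding to a grid *)
Section rounding.
Context {R : realType}.

(** As a function of one coordinate the form is a quadratic polynomial, of
leading coefficient at most [A], the sum of the [a i ^+ 2]. Its average over [l] and [u]
with weights [1 - q] and [q] exceeds its value at the barycenter by at most
[q (1 - q) (u - l)^2 A], and one of the two end points is below the average. *)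
Lemma round_coordinate (I : Type) (r : seq I) (a b : I -> R) (B c q l u : R) :
  0 <= c -> 0 <= q <= 1 ->
  let phi x := \sum_(i <- r) (b i + x * a i) ^+ 2 - c * (B + x ^+ 2) in
  exists2 x, x = l \/ x = u &
    phi x <= phi ((1 - q) * l + q * u) +
             (u - l) ^+ 2 / 4 * \sum_(i <- r) a i ^+ 2.
Proof.
move=> c0 /andP[q0 q1] phi.
pose A := \sum_(i <- r) a i ^+ 2; pose D := \sum_(i <- r) a i * b i.
pose C := \sum_(i <- r) b i ^+ 2.
have A0 : 0 <= A by apply: sumr_ge0 => i _; exact: sqr_ge0.
have phiE x : phi x = (A - c) * x ^+ 2 + 2 * D * x + (C - c * B).
  rewrite /phi (_ : \sum_(i <- r) _ = A * x ^+ 2 + 2 * x * D + C); first by ring.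
  rewrite /A /D /C mulr_suml mulr_sumr -!big_split/=.
  by apply: eq_bigr => i _; ring.
have key : (1 - q) * phi l + q * phi u =
    phi ((1 - q) * l + q * u) + q * (1 - q) * (u - l) ^+ 2 * (A - c).
  by rewrite !phiE; ring.
have d0 := sqr_ge0 (u - l).
have qq : q * (1 - q) <= 4^-1 by have := sqr_ge0 (q - 2^-1); lra.
have qq0 : 0 <= q * (1 - q) by rewrite mulr_ge0//; lra.
have bnd : q * (1 - q) * (u - l) ^+ 2 * (A - c) <= (u - l) ^+ 2 / 4 * A.
  have h1 : q * (1 - q) * (u - l) ^+ 2 * (A - c) <= q * (1 - q) * (u - l) ^+ 2 * A.
    by apply: ler_wpM2l; [exact: mulr_ge0|lra].
  apply: (le_trans h1); rewrite ler_wpM2r// mulrC ler_wpM2l//.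
have [h|h] := leP (phi l) (phi u).
  exists l; first by left.
  have : (1 - q) * phi l + q * phi l <= (1 - q) * phi l + q * phi u.
    by rewrite lerD2l ler_wpM2l.
  rewrite -/A; lra.
exists u; first by right.
have : (1 - q) * phi u + q * phi u <= (1 - q) * phi l + q * phi u.
  by rewrite lerD2r ler_wpM2l ?subr_ge0// ltW.
rewrite -/A; lra.
Qed.

(** Rounding one coordinate after the other costs only the diagonal of the
quadratic form, whereas the difference between the form at [w] and at a nearby
point would involve its operator norm. *)
Lemma round_vector (n d : nat) (a : 'I_n -> 'I_d -> R) (c : R)
  (w q l u : 'I_d -> R) : 0 <= c -> (forall j, 0 <= q j <= 1) ->
  (forall j, w j = (1 - q j) * l j + q j * u j) ->
  let g (z : 'I_d -> R) :=
    \sum_i (\sum_j z j * a i j) ^+ 2 - c * \sum_j z j ^+ 2 in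
  exists2 z, (forall j, z j = l j \/ z j = u j) &
    g z <= g w + \sum_j ((u j - l j) ^+ 2 / 4 * \sum_i a i j ^+ 2).
Proof.
move=> c0 q01 wE g.
suff H (k : nat) : (k <= d)%N -> exists z : 'I_d -> R,
  [/\ forall j : 'I_d, (j < k)%N -> z j = l j \/ z j = u j,
      forall j : 'I_d, (k <= j)%N -> z j = w j &
      g z <= g w + \sum_(j < d | (j < k)%N)
                     ((u j - l j) ^+ 2 / 4 * \sum_i a i j ^+ 2)].
  have [z [z1 _ z3]] := H d (leqnn d); exists z; first by move=> j; apply: z1.
  by rewrite (eq_bigl (fun j : 'I_d => (j < d)%N))// => j; rewrite ltn_ord.
elim: k => [_|k IH kd].
  exists w; split=> //; rewrite big_pred0 ?addr0// => j; by rewrite ltn0.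
have [z [z1 z2 z3]] := IH (ltnW kd).
pose j0 := Ordinal kd.
pose upd x j : R := if j == j0 then x else z j.
have gE x : g (upd x) = \sum_i
    (\sum_(j < d | j != j0) z j * a i j + x * a i j0) ^+ 2 -
    c * (\sum_(j < d | j != j0) z j ^+ 2 + x ^+ 2).
  rewrite /g; congr (_ - c * _).
    apply: eq_bigr => i _; congr (_ ^+ 2); rewrite (bigD1 j0)//= /upd eqxx addrC.
    by congr (_ + _); apply: eq_bigr => j /negbTE ->.
  rewrite (bigD1 j0)//= /upd eqxx addrC.
  by congr (_ + _); apply: eq_bigr => j /negbTE ->.
have [x hx hg] := round_coordinate (index_enum 'I_n) (fun i => a i j0)
  (fun i => \sum_(j < d | j != j0) z j * a i j)
  (\sum_(j < d | j != j0) z j ^+ 2) (l j0) (u j0) c0 (q01 j0).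
exists (upd x); split.
- move=> j; rewrite ltnS leq_eqVlt /upd => /predU1P[jk|jk].
    by have -> : j = j0 by [apply: val_inj]; rewrite eqxx.
  rewrite ifN; first exact: z1.
  by rewrite -val_eqE/= ltn_eqF.
- move=> j kj; rewrite /upd ifN; first by rewrite z2// ltnW.
  by rewrite -val_eqE/= gtn_eqF.
move: hg; rewrite -wE -!gE => hg.
have e : g (upd (w j0)) = g z.
  congr g; apply/funext => j; rewrite /upd; case: eqP => // ->.
  by rewrite z2.
rewrite e in hg; apply: (le_trans hg).
have -> : \sum_(j < d | (j < k.+1)%N) (u j - l j) ^+ 2 / 4 * \sum_i a i j ^+ 2 =
    (u j0 - l j0) ^+ 2 / 4 * \sum_i a i j0 ^+ 2 +
    \sum_(j < d | (j < k)%N) (u j - l j) ^+ 2 / 4 * \sum_i a i j ^+ 2.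
  rewrite (bigD1 j0)//=; congr (_ + _); apply: eq_bigl => j.
  by rewrite ltnS leq_eqVlt -val_eqE/=; case: (ltngtP j k).
by rewrite addrA addrAC lerD2r.
Qed.

End rounding.

Section grid.
Context {R : realType}.
Variable d : nat.

(** A sign and a magnitude, in units of the mesh, for each coordinate. *)
Definition grid_index := {ffun 'I_d -> bool * 'I_(5 * d).+1}.
Definition grid_step : R := (4 * Num.sqrt d%:R)^-1.
Definition grid_point (f : grid_index) (j : 'I_d) : R :=
  grid_step * ((-1) ^+ (f j).1 * (f j).2%:R).
(** This l1-ball contains the vertices of all cells that meet the unit
sphere, see [grid_round]. *)
Definition grid_ball : {set grid_index} :=
  [set f : grid_index | (\sum_j (f j).2 <= 5 * d)%N]%SET.

(** Give a grid point of l1-norm m the weight [2^-m]. Points of the ball have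
weight at least [2^-(5d)], and the total weight is at most [4^d]: two signs and a
geometric series of sum 2 for each coordinate. *)
Lemma card_grid_ball : (#|grid_ball| <= 2 ^ (7 * d))%N.
Proof.
rewrite -(@ler_nat R).
pose wt (x : bool * 'I_(5 * d).+1) : R := 2^-1 ^+ x.2.
have half0 : (0 : R) <= 2^-1 by rewrite invr_ge0.
have wt0 x : 0 <= wt x by exact: exprn_ge0.
have geo m : \sum_(k < m) (2^-1 : R) ^+ k <= 2.
  have : (2^-1 : R) ^+ m + (\sum_(k < m) (2^-1 : R) ^+ k) / 2 = 1.
    elim: m => [|m IH]; first by rewrite big_ord0 mul0r addr0 expr0.
    rewrite big_ord_recr/= exprS; lra.
  have := exprn_ge0 m half0; lra.
have h1 (f : grid_index) : f \in grid_ball ->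
    1 <= 2 ^+ (5 * d) * \prod_j wt (f j).
  rewrite inE => hf; rewrite /wt prodrXr exprVn.
  rewrite ler_pdivlMr ?exprn_gt0// mul1r ler_eXn2l ?ltr1n//.
have h2 : \sum_(f : grid_index) \prod_j wt (f j) <= 4 ^+ d.
  rewrite -(bigA_distr_bigA (fun (_ : 'I_d) => wt)).
  rewrite prodr_const card_ord lerXn2r ?nnegrE//; first exact: sumr_ge0.
  rewrite -(pair_bigA _ (fun (_ : bool) (k : 'I_(5 * d).+1) => (2^-1 : R) ^+ k))//=.
  rewrite big_bool/=.
  have := geo (5 * d).+1; lra.
rewrite (@le_trans _ _ (\sum_(f in grid_ball) (2 ^+ (5 * d) * \prod_j wt (f j))))//.
  by rewrite -sum1_card natr_sum ler_sum.
rewrite -mulr_sumr natrX (_ : (7 = 5 + 2)%N)// mulnDl exprD.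
rewrite ler_pM2l ?exprn_gt0//.
apply: le_trans (le_trans h2 _); last by rewrite exprM expr2 -natrM.
rewrite [leRHS](bigID (fun f => f \in grid_ball))/= lerDl.
by apply: sumr_ge0 => f _; exact: prodr_ge0.
Qed.

(** The cell of [w] is found by truncating the magnitudes
[4 sqrt d |w_j| <= 2 + 2 d w_j^2], whose sum is at most [4 d]; rounding up adds at
most 1 per coordinate, whence the radius [5 d]. *)
Lemma grid_round (w : 'I_d -> R) : (0 < d)%N -> \sum_j w j ^+ 2 = 1 ->
  exists (q l u : 'I_d -> R),
    [/\ forall j, 0 <= q j <= 1,
        forall j, w j = (1 - q j) * l j + q j * u j,
        forall j, (u j - l j) ^+ 2 / 4 = (64 * d%:R)^-1 &
        forall z, (forall j, z j = l j \/ z j = u j) ->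
          exists2 f, f \in grid_ball & z = grid_point f].
Proof.
move=> d0 w1.
have dR : (0 : R) < d%:R by rewrite ltr0n.
have sd0 : 0 < Num.sqrt (d%:R : R) by rewrite sqrtr_gt0.
have st0 : 0 < grid_step by rewrite invr_gt0 mulr_gt0.
have st2 : grid_step ^+ 2 = (16 * d%:R)^-1.
  rewrite /grid_step exprVn exprMn sqr_sqrtr ?ltW//; congr (_^-1); ring.
pose y j := `|w j| / grid_step.
have y0 j : 0 <= y j by rewrite divr_ge0// ltW.
pose k j := Num.truncn (y j).
have kle j : (k j)%:R <= y j by rewrite truncn_le.
have klt j : y j < (k j)%:R + 1 by rewrite natr1 truncnS_gt.
pose s j : bool := w j < 0.
have ws j : w j = (-1) ^+ (s j) * (y j * grid_step).
  rewrite /y divfK ?gt_eqF// /s; case: ltP => [h|h].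
    by rewrite ltr0_norm// expr1 mulN1r opprK.
  by rewrite ger0_norm// expr0 mul1r.
have ksum : (\sum_j (k j).+1 <= 5 * d)%N.
  rewrite -(@ler_nat R) natr_sum.
  have h j : ((k j).+1)%:R <= 3 + 2 * d%:R * w j ^+ 2.
    have h1 : y j <= 2 + 2 * d%:R * w j ^+ 2.
      have e : y j = 2 * (2 * (Num.sqrt d%:R * `|w j|)).
        by rewrite /y /grid_step invrK; ring.
      have e2 : d%:R * w j ^+ 2 = (Num.sqrt d%:R * `|w j|) ^+ 2.
        by rewrite exprMn sqr_sqrtr ?ltW// real_normK ?num_real.
      rewrite e -mulrA e2.
      have := sqr_ge0 (Num.sqrt d%:R * `|w j| - 1); lra.
    rewrite -natr1; have := kle j; lra.
  apply: (le_trans (ler_sum _ (fun j _ => h j))).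
  rewrite big_split/= -mulr_sumr w1 sumr_const card_ord natrM -mulr_natr; lra.
have kk (b : 'I_d -> bool) : (\sum_j (k j + b j) <= 5 * d)%N.
  by apply: leq_trans ksum; apply: leq_sum => j _; case: (b j); lia.
exists (fun j => y j - (k j)%:R), (fun j => grid_step * ((-1) ^+ (s j) * (k j)%:R)),
  (fun j => grid_step * ((-1) ^+ (s j) * (k j + 1)%:R)); split.
- by move=> j; rewrite subr_ge0 kle/= lerBlDr addrC ltW.
- by move=> j; rewrite natrD {1}ws; ring.
- move=> j; rewrite -mulrBr -mulrBr natrD addrAC subrr add0r mulr1 exprMn.
  by rewrite -exprM mulnC exprM sqrrN expr1n expr1n mulr1 st2; field; rewrite gt_eqF.
move=> z hz.
have /choice[b hb] : forall j, exists b : bool,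
    z j = grid_step * ((-1) ^+ (s j) * (k j + b)%:R).
  move=> j; have [->|->] := hz j; [exists false|exists true] => //.
  by rewrite addn0.
have kb j : (k j + b j < (5 * d).+1)%N.
  rewrite ltnS; apply: leq_trans (kk b).
  by rewrite (bigD1 j)//= leq_addr.
exists [ffun j => (s j, Ordinal (kb j))].
  rewrite inE; apply: leq_trans (kk b); apply: leq_sum => j _.
  by rewrite ffunE.
by apply/funext => j; rewrite hb /grid_point ffunE.
Qed.

End grid.

(** * Uniform lower bound for empirical quadratic forms *)
Section uniform_lower_tail.
Context {R : realType} {dT : measure_display} {T : measurableType dT}.
Variable P : probability T R.

Lemma probability_bigU_le (I : finType) (Q : {pred I}) (B : I -> set T) (c : R) :
  (forall i, Q i -> measurable (B i)) -> (forall i, Q i -> (P (B i) <= c%:E)%E) ->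
  measurable (\big[setU/set0]_(i | Q i) B i) /\
  (P (\big[setU/set0]_(i | Q i) B i) <= (#|Q|%:R * c)%:E)%E.
Proof.
move=> mB PB; rewrite -sum1_card natr_sum mulr_suml.
elim/big_rec2 : _ => [|i A y Qi [mA PA]]; first by rewrite measure0.
split; first by apply: measurableU => //; exact: mB.
rewrite EFinD; apply: (le_trans (measureU2 P (mB i Qi) mA)).
by rewrite mul1r leeD// PB.
Qed.

Variables (dS : measure_display) (S : measurableType dS).
Variables (n d : nat) (Z0 : T -> S) (Z : 'I_n -> T -> S).
Hypothesis mZ0 : measurable_fun setT Z0.
Hypothesis mZ : forall i, measurable_fun setT (Z i).
Hypothesis iid : iid_copies P Z0 Z.
Variables (v : S -> 'I_d -> R) (s2 delta : R).
Hypothesis d_gt0 : (0 < d)%N.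
Hypothesis mv : forall j, measurable_fun setT (v^~ j).
Hypothesis s2_gt0 : 0 < s2.
Hypothesis delta01 : 0 < delta <= 1.
Hypothesis v_bounded : forall s, \sum_j v s j ^+ 2 <= 4 * s2 * d%:R.
Hypothesis v_mean : \int[P]_t (\sum_j v (Z0 t) j ^+ 2) <= d%:R.
Hypothesis v_lower : forall w : 'I_d -> R,
  2^-1 * \sum_j w j ^+ 2 <= \int[P]_t ((\sum_j w j * v (Z0 t) j) ^+ 2).
Hypothesis v_fourth : forall w : 'I_d -> R,
  \int[P]_t ((\sum_j w j * v (Z0 t) j) ^+ 4) <= s2 * (\sum_j w j ^+ 2) ^+ 2.
Hypothesis n_large : 196 * s2 * (d%:R + 2 * ln (4 / delta)) <= n%:R.

Let mform (w : 'I_d -> R) : measurable_fun setT (fun s => \sum_j w j * v s j).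
Proof. by apply: measurable_sum => j; exact: measurable_funM. Qed.

Let L := ln (4 / delta).

Let delta_gt0 : 0 < delta. Proof. by case/andP: delta01. Qed.

Let L_ge0 : 0 <= L.
Proof.
by apply: ln_ge0; rewrite ler_pdivlMr//; move: delta01; lra.
Qed.

Let expL : expR (- L) = delta / 4.
Proof. by rewrite expRN lnK ?posrE ?divr_gt0// invf_div. Qed.

Let dR_ge1 : (1 : R) <= d%:R. Proof. by rewrite (ler_nat R 1). Qed.

Let form_bounded (w : 'I_d -> R) s :
  `|\sum_j w j * v s j| <= \sum_j `|w j| * Num.sqrt (4 * s2 * d%:R).
Proof.
apply: (le_trans (ler_norm_sum _ _ _)); apply: ler_sum => j _.
rewrite normrM ler_wpM2l// -sqrtr_sqr ler_wsqrtr//.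
apply: le_trans (v_bounded s); rewrite (bigD1 j)//= lerDl.
by apply: sumr_ge0 => k _; exact: sqr_ge0.
Qed.

Let integ_form (w : 'I_d -> R) m :
  integ P (fun t => (\sum_j w j * v (Z0 t) j) ^+ m).
Proof.
apply: (@integ_bounded _ _ _ _ _ ((\sum_j `|w j| * Num.sqrt (4 * s2 * d%:R)) ^+ m)).
  by apply: measurable_funX; exact: (measurableT_comp (mform w)).
move=> t; rewrite normrX lerXn2r ?nnegrE//.
by apply: sumr_ge0 => j _; rewrite mulr_ge0// sqrtr_ge0.
Qed.

(** Writing N for the squared norm of [w], the parameter [lam = 1 / (4 s2 N)]
gives the exponent [n (- 1/8 + 1/32 + 1/16) / s2]. *)
Let single_tail (w : 'I_d -> R) : 0 < \sum_j w j ^+ 2 ->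
  (P [set t | \sum_i (\sum_j w j * v (Z i t) j) ^+ 2 <=
      n%:R / 4 * \sum_j w j ^+ 2]%R <= (expR (- (n%:R / (32 * s2))))%:E)%E.
Proof.
move=> w0; set N := \sum_j w j ^+ 2 in w0 *.
have lam0 : 0 < (4 * s2 * N)^-1 by rewrite invr_gt0 !mulr_gt0.
have i4 : integ P (fun t => ((\sum_j w j * v (Z0 t) j) ^+ 2) ^+ 2).
  by under eq_fun do rewrite -exprM; exact: integ_form.
have h4 : \int[P]_t (((\sum_j w j * v (Z0 t) j) ^+ 2) ^+ 2) <= s2 * N ^+ 2.
  by under eq_Rintegral do rewrite -exprM; exact: v_fourth.
have := @iid_lower_tail _ _ _ _ _ P n Z0 Z mZ0 mZ iid
  (fun s => (\sum_j w j * v s j) ^+ 2) (2^-1 * N) (s2 * N ^+ 2)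
  (4 * s2 * N)^-1 (n%:R / 4 * N)
  (measurable_funX _ (mform w)) (fun s => sqr_ge0 _) (integ_form w 2) i4
  (v_lower w) h4 lam0.
congr (_ <= (expR _)%:E)%E; field; rewrite !gt_eqF//.
Qed.

Let trace_tail :
  (P [set t | (3 * d%:R * n%:R <= \sum_i \sum_j v (Z i t) j ^+ 2)%R] <=
   (expR (- (n%:R / (8 * s2))))%:E)%E.
Proof.
have M0 : 0 < 4 * s2 * d%:R by rewrite !mulr_gt0// ltr0n.
have mU : measurable_fun setT (fun s => \sum_j v s j ^+ 2).
  by apply: measurable_sum => j; exact: measurable_funX.
have U0 s : 0 <= \sum_j v s j ^+ 2 <= 4 * s2 * d%:R.
  by rewrite v_bounded andbT; apply: sumr_ge0 => j _; exact: sqr_ge0.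
have := @iid_upper_tail _ _ _ _ _ P n Z0 Z mZ0 mZ iid
  (fun s => \sum_j v s j ^+ 2) d%:R (4 * s2 * d%:R) (3 * d%:R * n%:R)
  mU U0 M0 v_mean.
congr (_ <= (expR _)%:E)%E; field.
by rewrite !gt_eqF// ltr0n.
Qed.

(** The union bound costs [2^(7d) <= exp (6d)], while the exponent is at least
[196/32 (d + 2 L)], and [196/32 > 6]. *)
Let grid_prob : (2 ^ (7 * d))%:R * expR (- (n%:R / (32 * s2))) <= delta / 4.
Proof.
have h1 : (2 ^ (7 * d))%:R <= expR (6 * d%:R) :> R.
  rewrite natrX exprM -(natrX R 2 7) mulrC expRM_natl lerXn2r ?nnegrE ?expR_ge0//.
  rewrite (_ : expR 6 = expR 1 ^+ 6); last by rewrite -expRM_natl mulr1.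
  have e1 := expR_ge_taylor2 (@ler01 R).
  apply: (@le_trans _ _ ((5 / 2) ^+ 6)); first by rewrite expr_div_n; lra.
  by rewrite lerXn2r ?nnegrE ?expR_ge0//; lra.
rewrite -expL; apply: (@le_trans _ _ (expR (6 * d%:R) * expR (- (n%:R / (32 * s2))))).
  by rewrite ler_wpM2r ?expR_ge0.
rewrite -expRD ler_expR.
have h2 : 196 / 32 * (d%:R + 2 * L) <= n%:R / (32 * s2).
  rewrite ler_pdivlMr ?mulr_gt0//; apply: le_trans n_large.
  by rewrite le_eqVlt; apply/orP; left; apply/eqP; rewrite -/L; field.
have := L_ge0; have := dR_ge1; lra.
Qed.

Let trace_prob : expR (- (n%:R / (8 * s2))) <= delta / 4.
Proof.
rewrite -expL ler_expR lerN2.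
have h2 : 196 / 8 * (d%:R + 2 * L) <= n%:R / (8 * s2).
  rewrite ler_pdivlMr ?mulr_gt0//; apply: le_trans n_large.
  by rewrite le_eqVlt; apply/orP; left; apply/eqP; rewrite -/L; field.
have := L_ge0; have := dR_ge1; lra.
Qed.

(** At the grid points the form is at least [n / 4] times the squared norm. For
a unit vector, rounding loses at most [1 / (64 d)] times the trace of the form,
which is at most [3 d n]; and [1/4 - 3/64 >= 3/16]. *)
Lemma quadratic_form_lower_tail : exists E : set T,
  [/\ measurable E, ((1 - delta / 2)%:E <= P E)%E &
      forall t, E t -> forall w : 'I_d -> R,
        3 / 16 * n%:R * \sum_j w j ^+ 2 <=
        \sum_i (\sum_j w j * v (Z i t) j) ^+ 2].
Proof.
pose nz (f : grid_index d) := (f \in grid_ball d) &&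
   (0 < \sum_j grid_point (R := R) f j ^+ 2).
pose B (f : grid_index d) := [set t | \sum_i (\sum_j grid_point f j * v (Z i t) j) ^+ 2 <=
      n%:R / 4 * \sum_j grid_point f j ^+ 2]%R.
pose C := [set t | (3 * d%:R * n%:R <= \sum_i \sum_j v (Z i t) j ^+ 2)%R].
have mform2 (f : grid_index d) :
    measurable_fun setT (fun t => \sum_i (\sum_j grid_point f j * v (Z i t) j) ^+ 2).
  apply: measurable_sum => i; apply: measurable_funX.
  exact: (measurableT_comp (mform (grid_point f))).
have mB f : measurable (B f) by exact: measurable_sublevel.
have mC : measurable C.
  apply: measurable_superlevel.
  apply: measurable_sum => i; apply: measurable_sum => j.
  by apply: measurable_funX; exact: (measurableT_comp (mv j)).
have [mBU PBU] := @probability_bigU_le _ nz B (expR (- (n%:R / (32 * s2))))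
  (fun f _ => mB f) (fun f hf => single_tail (proj2 (andP hf))).
set BU := \big[setU/set0]_(i | nz i) B i in mBU PBU.
exists (~` (BU `|` C)); split.
- by apply: measurableC; exact: measurableU.
- rewrite probability_setC; last exact: measurableU.
  rewrite EFinB leeB//.
  apply: (le_trans (measureU2 P mBU mC)).
  rewrite (_ : delta / 2 = delta / 4 + delta / 4); last by field.
  rewrite EFinD leeD//; last first.
    by apply: (le_trans trace_tail); rewrite lee_fin.
  apply: (le_trans PBU); rewrite lee_fin; apply: le_trans grid_prob.
  rewrite ler_wpM2r ?expR_ge0// ler_nat; apply: leq_trans (@card_grid_ball R d).
  by apply: subset_leq_card; apply/fintype.subsetP => f /andP[].
move=> t tE.
have {tE} [tBU tC] : ~ BU t /\ ~ C t by split=> h; apply: tE; [left|right].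
have tB f : nz f -> ~ B f t.
  by move=> nzf tBf; apply: tBU; rewrite /BU (bigD1 f)//=; left.
move/negP : tC; rewrite -ltNge => tC.
suff unit w : \sum_j w j ^+ 2 = 1 ->
    3 / 16 * n%:R <= \sum_i (\sum_j w j * v (Z i t) j) ^+ 2.
  move=> w; have N0 : 0 <= \sum_j w j ^+ 2 by apply: sumr_ge0 => j _; exact: sqr_ge0.
  set N := \sum_j w j ^+ 2 in N0 *.
  have [->|N1] := eqVneq N 0.
    by rewrite mulr0; apply: sumr_ge0 => i _; exact: sqr_ge0.
  have Npos : 0 < N by rewrite lt_neqAle eq_sym N1.
  have sN : 0 < Num.sqrt N by rewrite sqrtr_gt0.
  have := unit (fun j => w j / Num.sqrt N).
  under eq_bigr do rewrite expr_div_n.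
  rewrite -mulr_suml -/N sqr_sqrtr// divff// => /(_ erefl).
  under eq_bigr => i _.
    under eq_bigr do rewrite mulrAC.
    rewrite -mulr_suml expr_div_n sqr_sqrtr//.
    over.
  by rewrite -mulr_suml ler_pdivlMr.
move=> w1.
have [q [l [u [q01 wE lu hgrid]]]] := grid_round d_gt0 w1.
have n4 : (0 : R) <= n%:R / 4 by rewrite divr_ge0.
have [z zlu gz] := @round_vector R n d (fun i j => v (Z i t) j) (n%:R / 4)
  w q l u n4 q01 wE.
have [f fB zf] := hgrid z zlu.
move: gz; rewrite w1 mulr1.
under [X in _ <= _ + X -> _]eq_bigr do rewrite lu.
rewrite -mulr_sumr exchange_big/= => gz.
have hz : n%:R / 4 * \sum_j z j ^+ 2 <= \sum_i (\sum_j z j * v (Z i t) j) ^+ 2.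
  have [z0|z0] := leP (\sum_j z j ^+ 2) 0.
    apply: (@le_trans _ _ 0); first by rewrite mulr_ge0_le0.
    by apply: sumr_ge0 => i _; exact: sqr_ge0.
  apply: ltW; rewrite ltNge; apply/negP; rewrite zf.
  by apply: tB; rewrite /nz fB -zf.
have ht : (64 * d%:R)^-1 * \sum_i \sum_j v (Z i t) j ^+ 2 <= 3 / 64 * n%:R.
  have d64 : (0 : R) < 64 * d%:R by rewrite mulr_gt0 // ltr0n.
  rewrite mulrC ler_pdivrMr// ltW// (lt_le_trans tC)// le_eqVlt.
  by apply/orP; left; apply/eqP; field.
have n0 : (0 : R) <= n%:R by [].
lra.
Qed.

End uniform_lower_tail.

(** * Factorization of positive definite matrices *)
Section cholesky.
Context {R : rcfType}.

(** Cholesky's elimination: completing the square in the first coordinate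
leaves the Schur complement, which is again symmetric and positive definite. *)
Lemma posdef_factor (d : nat) (H : 'M[R]_d) : H^T = H ->
  (forall w : 'cV[R]_d, w != 0 -> 0 < (w^T *m H *m w) 0 0) ->
  exists B : 'M[R]_d, B^T *m H *m B = 1%:M.
Proof.
elim: d H => [|d IH] H Hsym Hpos.
  by exists 0; apply/matrixP => -[].
change ('M[R]_(1 + d)) in H.
pose a : R := H 0 0; pose b : 'cV[R]_d := dlsubmx H; pose C : 'M[R]_d := drsubmx H.
have ula : ulsubmx H = a%:M.
  by rewrite [LHS]mx11_scalar; congr (_%:M); rewrite !mxE; congr (H _ _); apply: val_inj.
have urb : ursubmx H = b^T by rewrite /b trmx_dlsub Hsym.
have Csym : C^T = C by rewrite /C trmx_drsub Hsym.
have HE : H = block_mx a%:M b^T b C by rewrite -ula -urb submxK.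
have a0 : 0 < a.
  have /Hpos : delta_mx 0 0 != 0 :> 'cV[R]_(1 + d).
    by apply/negP => /eqP/matrixP/(_ 0 0)/eqP; rewrite !mxE !eqxx oner_eq0.
  by rewrite trmx_delta -rowE -colE !mxE.
pose D := C - a^-1 *: (b *m b^T).
have Dsym : D^T = D by rewrite /D linearB linearZ/= trmx_mul trmxK Csym.
have Dpos (v : 'cV[R]_d) : v != 0 -> 0 < (v^T *m D *m v) 0 0.
  move=> v0; pose w : 'cV[R]_(1 + d) := col_mx (- a^-1 *: (b^T *m v)) v.
  have /Hpos : w != 0.
    by apply: contra_neq v0 => w0; rewrite -[v](col_mxKd (- a^-1 *: (b^T *m v))) -/w w0 linear0.
  have -> : (w^T *m H *m w) = v^T *m D *m v.
    rewrite -mulmxA HE /w mul_block_col tr_col_mx mul_row_col.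
    rewrite mul_scalar_mx scalerA mulrN divff ?gt_eqF// scaleN1r addNr mulmx0 add0r.
    rewrite -mulmxA; congr (_ *m _).
    by rewrite /D mulmxBl -scalemxAl -scalemxAr scaleNr mulmxA addrC.
  by [].
have [B' HB'] := IH D Dsym Dpos.
pose s := Num.sqrt a.
have s0 : s != 0 by rewrite gt_eqF ?sqrtr_gt0.
have ss : s * s = a by rewrite -expr2 sqr_sqrtr// ltW.
pose B : 'M[R]_(1 + d) := block_mx (s^-1)%:M (- a^-1 *: (b^T *m B')) 0 B'.
suff key : (B^T *m (H *m B) : 'M[R]_(1 + d)) = 1%:M.
  by exists B; rewrite -mulmxA; exact: key.
rewrite /B.
rewrite HE mulmx_block tr_block_mx mulmx_block !trmx0 !mulmx0 !mul0mx !addr0.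
rewrite !tr_scalar_mx -!scalar_mxM.
have e1 : a%:M *m (- a^-1 *: (b^T *m B')) + b^T *m B' = 0.
  by rewrite mul_scalar_mx scalerA mulrN divff ?gt_eqF// scaleN1r addNr.
have e2 : b *m (- a^-1 *: (b^T *m B')) + C *m B' = D *m B'.
  by rewrite /D mulmxBl -scalemxAl -scalemxAr scaleNr mulmxA addrC.
rewrite e1 e2 !mulmx0 !add0r.
rewrite (_ : s^-1 * (a * s^-1) = 1); last by rewrite -ss; field.
rewrite (mulmxA B'^T D B') HB'.
have -> : (- a^-1 *: (b^T *m B'))^T *m (a / s)%:M + B'^T *m (b *m (s^-1)%:M) = 0.
  rewrite linearZ/= trmx_mul trmxK !mul_mx_scalar -!scalemxAr !scalerA.
  rewrite -scalerDl (_ : a / s * - a^-1 + s^-1 = 0) ?scale0r//.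
  by field; rewrite s0 gt_eqF.
by rewrite -scalar_mx_block.
Qed.

End cholesky.

(** * The risk, its gradient and its Hessian *)
Section dot_products.
Context {R : realType}.
Variable d : nat.
Implicit Types (w v : 'cV[R]_d) (x : d.-tuple R).

Lemma dot_vectE w x : dot w (vect x) = \sum_j w j 0 * tnth x j.
Proof. by rewrite /dot mxE; apply: eq_bigr => j _; rewrite !mxE. Qed.

Lemma measurable_dot (dT : measure_display) (T : measurableType dT)
    (X : T -> d.-tuple R) w : measurable_fun setT X ->
  measurable_fun setT (fun t => dot w (vect (X t))).
Proof.
move=> mX; under eq_fun do rewrite dot_vectE.
apply: measurable_sum => j; apply: measurable_funM => //.
exact: (measurableT_comp (measurable_tnth j)).
Qed.

Lemma measurable_residual (dT : measure_display) (T : measurableType dT)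
    (X : T -> d.-tuple R) (Y : T -> R) w :
  measurable_fun setT X -> measurable_fun setT Y ->
  measurable_fun setT (fun t => residual (X t) (Y t) w).
Proof. by move=> mX mY; apply: measurable_funB => //; exact: measurable_dot. Qed.

Lemma dellE (p t : R) : 1 < p < 2 -> dell p t = t * `|t| `^ (p - 2) / (p - 1).
Proof.
move=> p12; rewrite /dell /spow; congr (_ / _).
rewrite -(@mulr_powR_subr2 _ p p12 `|t|)// mulrA; congr (_ * _).
by rewrite [RHS]numEsg.
Qed.

Lemma measurable_dell (p : R) : 1 < p < 2 -> measurable_fun setT (dell p).
Proof.
move=> p12; rewrite (_ : dell p = fun t => t * `|t| `^ (p - 2) / (p - 1)).
  apply: measurable_funM => //; apply: measurable_funM => //.
  by apply: (measurableT_comp (measurable_powR _)).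
by apply/funext => t; rewrite dellE.
Qed.

End dot_products.

Section risk_derivatives.
Context {R : realType} {dT : measure_display} {T : measurableType dT}.
Variables (P : probability T R) (d : nat) (X : T -> d.-tuple R) (Y : T -> R).
Hypotheses (mX : measurable_fun setT X) (mY : measurable_fun setT Y).
Variable p : R.
Hypothesis p12 : 1 < p < 2.
Hypothesis Y_mom : integ P (fun t => `|Y t| `^ p).
Hypothesis X_mom : forall j : 'I_d, integ P (fun t => tnth (X t) j ^+ 2).

Let mx (j : 'I_d) : measurable_fun setT (fun t => tnth (X t) j).
Proof. exact: (measurableT_comp (measurable_tnth j)). Qed.

Let mdot (w : 'cV[R]_d) : measurable_fun setT (fun t => dot w (vect (X t))).
Proof. exact: measurable_dot. Qed.

Let mres (w : 'cV[R]_d) : measurable_fun setT (fun t => residual (X t) (Y t) w).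
Proof. exact: measurable_residual. Qed.

Lemma powR_le_1Dsqr (y : R) : `|y| `^ p <= 1 + y ^+ 2.
Proof.
have y2 : `|y| `^ 2 = y ^+ 2 by rewrite (@powR_mulrn _ _ 2)// real_normK ?num_real.
have [y1|y1] := leP `|y| 1.
  have h : `|y| `^ p <= 1 `^ p.
    by apply: ge0_ler_powR; rewrite ?nnegrE//; move: p12; lra.
  by move: h; rewrite powR1; have := sqr_ge0 y; lra.
have : `|y| `^ p <= `|y| `^ 2 by apply: ler_powR; [exact: ltW|move: p12; lra].
rewrite y2; lra.
Qed.

Lemma powR_add_le (y z : R) : `|y + z| `^ p <= 4 * (`|y| `^ p + `|z| `^ p).
Proof.
have p0 : 0 <= p by move: p12; lra.
have two : (2 : R) `^ p <= 4.
  apply: (@le_trans _ _ (2 `^ 2)); first by apply: ler_powR; move: p12; lra.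
  by rewrite (@powR_mulrn _ _ 2)//; lra.
have bound (m : R) : 0 <= m -> `|y + z| <= 2 * m -> `|y + z| `^ p <= 4 * m `^ p.
  move=> m0 h; apply: (@le_trans _ _ ((2 * m) `^ p)).
    by apply: ge0_ler_powR; rewrite ?nnegrE// mulr_ge0.
  by rewrite powRM// ler_wpM2r ?powR_ge0.
have yz := ler_normD y z.
have y0 := powR_ge0 `|y| p; have z0 := powR_ge0 `|z| p.
have [h|h] := leP `|y| `|z|.
  have : `|y + z| `^ p <= 4 * `|z| `^ p by apply: bound => //; lra.
  lra.
have : `|y + z| `^ p <= 4 * `|y| `^ p by apply: bound => //; lra.
lra.
Qed.

Lemma powR_mul_le (y z : R) :
  `|y| `^ (p - 1) * `|z| <= `|y| `^ p + `|z| `^ p.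
Proof.
have p0 : 0 < p by move: p12; lra.
have p1 : 0 <= p - 1 by move: p12; lra.
have y0 := powR_ge0 `|y| p; have z0 := powR_ge0 `|z| p.
have [h|h] := leP `|y| `|z|.
  apply: (@le_trans _ _ (`|z| `^ p)); last by lra.
  rewrite -(mulr_powRB1 (normr_ge0 z) p0) [leRHS]mulrC ler_wpM2r//.
  by apply: ge0_ler_powR; rewrite ?nnegrE.
apply: (@le_trans _ _ (`|y| `^ p)); last by lra.
rewrite -(mulr_powRB1 (normr_ge0 y) p0) [leRHS]mulrC ler_wpM2l ?powR_ge0//.
exact: ltW.
Qed.

Lemma integ_coord_mul i j : integ P (fun t => tnth (X t) i * tnth (X t) j).
Proof.
apply: (integ_le _ _ (integD (X_mom i) (X_mom j))).
  exact: measurable_funM.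
move=> t /=; rewrite normrM -(@real_normK _ (tnth (X t) i)) ?num_real//.
rewrite -(@real_normK _ (tnth (X t) j)) ?num_real//.
have := sqr_ge0 (`|tnth (X t) i| - `|tnth (X t) j|).
have := sqr_ge0 (`|tnth (X t) i| + `|tnth (X t) j|).
have := mulr_ge0 (normr_ge0 (tnth (X t) i)) (normr_ge0 (tnth (X t) j)).
lra.
Qed.

Lemma integ_dot_sqr (w : 'cV[R]_d) : integ P (fun t => dot w (vect (X t)) ^+ 2).
Proof.
rewrite (_ : (fun t => _) = fun t => \sum_i \sum_j
    (w i 0 * w j 0) * (tnth (X t) i * tnth (X t) j)).
  apply: integ_sum => i _; apply: integ_sum => j _.
  by apply: integZ; exact: integ_coord_mul.
apply/funext => t; rewrite dot_vectE expr2 mulr_suml; apply: eq_bigr => i _.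
by rewrite mulr_sumr; apply: eq_bigr => j _; ring.
Qed.

Lemma integ_dot_powR (w : 'cV[R]_d) : integ P (fun t => `|dot w (vect (X t))| `^ p).
Proof.
apply: (integ_le _ _ (integD (integ_cst P 1) (integ_dot_sqr w))).
  by apply: (measurableT_comp (measurable_powR _)); exact: measurableT_comp.
by move=> t; rewrite ger0_norm ?powR_ge0// powR_le_1Dsqr.
Qed.

Lemma integ_residual_powR (w : 'cV[R]_d) :
  integ P (fun t => `|residual (X t) (Y t) w| `^ p).
Proof.
have h := integD (integ_dot_powR w) Y_mom.
apply: (integ_le _ _ (integZ 4 h)).
  apply: (measurableT_comp (measurable_powR _)).
  by apply: measurableT_comp => //; exact: mres.
move=> t; rewrite ger0_norm ?powR_ge0//.
by rewrite (le_trans (powR_add_le _ _))// normrN.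
Qed.

Lemma integ_loss (w : 'cV[R]_d) : integ P (fun t => loss p (X t) (Y t) w).
Proof.
have := integZ (p * (p - 1))^-1 (integ_residual_powR w).
by under eq_fun do rewrite mulrC.
Qed.

Lemma integ_dell_dot (w u : 'cV[R]_d) :
  integ P (fun t => dell p (residual (X t) (Y t) w) * dot u (vect (X t))).
Proof.
have p1 : 0 < p - 1 by move: p12; lra.
have h := integZ (p - 1)^-1 (integD (integ_residual_powR w) (integ_dot_powR u)).
apply: (integ_le _ _ h).
  apply: measurable_funM; last exact: mdot.
  by apply: (measurableT_comp (measurable_dell p12)); exact: mres.
move=> t; rewrite normrM /dell normrM normfV (gtr0_norm p1) /spow normrM.
rewrite mulrAC mulrC ler_pM2l ?invr_gt0//.
rewrite (le_trans _ (powR_mul_le _ _))// ler_wpM2r//.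
rewrite (@ger0_norm _ (powR _ _)) ?powR_ge0// ler_piMl ?powR_ge0//.
by rewrite normr_sg; case: (_ != 0).
Qed.

Lemma riskE (w : 'cV[R]_d) :
  risk P X Y p w = (\int[P]_t loss p (X t) (Y t) w)%:E.
Proof. by rewrite /risk unlock integE//; exact: integ_loss. Qed.

Lemma residual_shift t (w u : 'cV[R]_d) (h : R) :
  residual (X t) (Y t) (w + h *: u) =
  residual (X t) (Y t) w + h * dot u (vect (X t)).
Proof. exact: residual_line. Qed.

(** The remainder of the loss is a Bregman divergence, at most a constant
times [|h s|^p] by [bregman_le_holder]; integrating this bound differentiates
under the expectation. *)
Lemma is_derive_risk (w u : 'cV[R]_d) :
  is_derive (0 : R) (1 : R) (fun h => fine (risk P X Y p (w + h *: u)))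
   (\int[P]_t (dell p (residual (X t) (Y t) w) * dot u (vect (X t)))).
Proof.
pose C := 2 / (p - 1) * \int[P]_t (`|dot u (vect (X t))| `^ p).
apply: (@is_derive_superlinear _ _ _ C p); first by move: p12; lra.
move=> h; rewrite !riskE /= scale0r addr0.
have il := integ_loss (w + h *: u); have i0 := integ_loss w.
have id := integ_dell_dot w u.
rewrite -RintegralZl// -RintegralB// -RintegralB//; last 2 first.
  exact: integB.
  exact: integZ.
have e t : loss p (X t) (Y t) (w + h *: u) - loss p (X t) (Y t) w -
    h * (dell p (residual (X t) (Y t) w) * dot u (vect (X t))) =
    bregman p (residual (X t) (Y t) w) (h * dot u (vect (X t))).
  by rewrite /loss residual_shift /bregman; ring.
have ib := integB (integB il i0) (integZ h id).
have k0 : 0 <= 2 / (p - 1) by rewrite divr_ge0//; move: p12; lra.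
rewrite ger0_norm; last first.
  by apply: Rintegral_ge0 => t _; rewrite e bregman_ge0.
have -> : C * `|h| `^ p = 2 / (p - 1) * (`|h| `^ p *
    \int[P]_t (`|dot u (vect (X t))| `^ p)) by rewrite /C; ring.
rewrite -RintegralZl//; last exact: integ_dot_powR.
rewrite -RintegralZl//; last by apply: integZ; exact: integ_dot_powR.
apply: mean_le => //; first by do 2 apply: integZ; exact: integ_dot_powR.
move=> t; rewrite e (le_trans (bregman_le_holder p12 _ _))//.
by rewrite normrM powRM.
Qed.

Lemma derive_risk (w u : 'cV[R]_d) :
  'D_u (fun v => fine (risk P X Y p v)) w =
  \int[P]_t (dell p (residual (X t) (Y t) w) * dot u (vect (X t))).
Proof.
by rewrite derive_along_line; have /@derive_val := is_derive_risk w u.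
Qed.

Lemma first_order_condition (wstar u : 'cV[R]_d) :
  (forall w, (risk P X Y p wstar <= risk P X Y p w)%E) ->
  \int[P]_t (dell p (residual (X t) (Y t) wstar) * dot u (vect (X t))) = 0.
Proof.
move=> wmin.
have [_ <-] := is_derive_risk wstar u.
suff [_ ->//] : is_derive (0 : R) (1 : R)
  (fun h => fine (risk P X Y p (wstar + h *: u))) 0.
apply: (@derive1_at_min _ _ (-1) 1); first lra.
- move=> s _.
  have H := is_derive_risk (wstar + s *: u) u.
  rewrite -(subrr s) in H.
  have sh : is_derive s (1 : R) (fun h : R => h - s) (1 : R).
    by apply: is_derive_eq; rewrite oppr0 addr0.
  have [+ _] := @is_derive1_comp _ _ (fun h : R => h - s) s _ _ H sh.
  set f1 := (X in derivable X _ _ -> _); set f2 := (X in _ -> derivable X _ _).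
  suff -> : f1 = f2 by [].
  apply/funext => h; rewrite /f1 /f2 /=.
  by rewrite -addrA -scalerDl (addrC s) subrK.
- by rewrite in_itv/=; lra.
- move=> s _ /=; rewrite scale0r addr0; have := wmin (wstar + s *: u).
  by rewrite !riskE lee_fin.
Qed.

End risk_derivatives.

Section risk_hessian.
Context {R : realType} {dT : measure_display} {T : measurableType dT}.
Variables (P : probability T R) (d : nat) (X : T -> d.-tuple R) (Y : T -> R).

Lemma mean_restrict (b : T -> bool) (f : T -> R) :
  measurable [set t | b t] -> P [set t | b t] = 1%E -> integ P f ->
  \int[P]_t f t = \int[P]_t ((b t)%:R * f t).
Proof.
move=> mb Pb fi.
have mf := integ_measurable fi.
have mB := measurable_fun_natr (R := R) mb.
rewrite /Rintegral; congr fine; apply: ae_eq_integral => //.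
- exact/measurable_EFinP.
- by apply/measurable_EFinP; exact: measurable_funM.
exists (~` [set t | b t]); split.
- exact: measurableC.
- by have := probability_setC P mb; rewrite Pb subee.
move=> t /= H bt; apply: H => _; rewrite bt mul1r //.
Qed.

Hypotheses (mX : measurable_fun setT X) (mY : measurable_fun setT Y).
Variable p : R.
Hypothesis p12 : 1 < p < 2.
Hypothesis Y_mom : integ P (fun t => `|Y t| `^ p).
Hypothesis X_mom : forall j : 'I_d, integ P (fun t => tnth (X t) j ^+ 2).
Variable wstar : 'cV[R]_d.

Let r t := residual (X t) (Y t) wstar.
Let om t := `|r t| `^ (p - 2).

Hypothesis r_neq0 : P [set t | r t != 0] = 1%E.
Hypothesis wX_mom : forall j : 'I_d,
  integ P (fun t => om t * tnth (X t) j ^+ 2).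

Let mx (j : 'I_d) : measurable_fun setT (fun t => tnth (X t) j).
Proof. exact: (measurableT_comp (measurable_tnth j)). Qed.

Let mr : measurable_fun setT r.
Proof. exact: measurable_residual. Qed.

Let mom : measurable_fun setT om.
Proof.
by apply: (measurableT_comp (measurable_powR _)); exact: measurableT_comp.
Qed.

Let mr0 : measurable [set t | r t != 0].
Proof. exact: measurable_neq0_set. Qed.

Lemma integ_weighted_coord_mul i j :
  integ P (fun t => om t * tnth (X t) i * tnth (X t) j).
Proof.
apply: (integ_le _ _ (integD (wX_mom i) (wX_mom j))).
  by do 2 apply: measurable_funM => //.
move=> t /=; rewrite !normrM (ger0_norm (powR_ge0 _ _)) -mulrDr -mulrA.
rewrite ler_wpM2l ?powR_ge0//.
rewrite -(@real_normK _ (tnth (X t) i)) ?num_real//.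
rewrite -(@real_normK _ (tnth (X t) j)) ?num_real//.
have := sqr_ge0 (`|tnth (X t) i| - `|tnth (X t) j|).
have := sqr_ge0 (`|tnth (X t) i| + `|tnth (X t) j|).
have := mulr_ge0 (normr_ge0 (tnth (X t) i)) (normr_ge0 (tnth (X t) j)).
lra.
Qed.

(** Dominated convergence along sequences. The difference quotients are
multiplied by the indicator of a nonzero residual, an event of probability 1, so
that [spow_lipschitz] dominates them by a multiple of
[om (X_i^2 + X_j^2)]; on the excluded event [om] is 0 as well. *)
Lemma derive2_risk (i j : 'I_d) :
  'D_(delta_mx i 0) (fun v => 'D_(delta_mx j 0) (fun v => fine (risk P X Y p v)) v)
    wstar = \int[P]_t (om t * tnth (X t) i * tnth (X t) j).
Proof.
rewrite derive_along_line.
have -> : (fun h : R => 'D_(delta_mx j 0) (fun v => fine (risk P X Y p v))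
              (wstar + h *: delta_mx i 0)) =
   (fun h => \int[P]_t (dell p (r t + h * tnth (X t) i) * tnth (X t) j)).
  apply/funext => h; rewrite derive_risk//; apply: eq_Rintegral => t _.
  by rewrite residual_shift !dot_delta.
pose q h t := (r t != 0)%:R *
   (h^-1 * (dell p (r t + h * tnth (X t) i) * tnth (X t) j - dell p (r t) * tnth (X t) j)).
have iD h : integ P (fun t => dell p (r t + h * tnth (X t) i) * tnth (X t) j).
  have := integ_dell_dot mX mY p12 Y_mom X_mom (wstar + h *: delta_mx i 0) (delta_mx j 0).
  by under eq_fun do rewrite residual_shift !dot_delta.
have iD0 : integ P (fun t => dell p (r t) * tnth (X t) j).
  by have := iD 0; under eq_fun do rewrite mul0r addr0.
have qE h : h^-1 * (\int[P]_t (dell p (r t + h * tnth (X t) i) * tnth (X t) j) -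
     \int[P]_t (dell p (r t) * tnth (X t) j)) = \int[P]_t q h t.
  have iB := integB (iD h) iD0.
  rewrite -(RintegralB measurableT (iD h) iD0).
  rewrite -(RintegralZl h^-1 measurableT iB).
  exact: (mean_restrict mr0 r_neq0 (integZ h^-1 iB)).
have mq h : measurable_fun setT (q h).
  apply: measurable_funM; first exact: measurable_fun_natr.
  by apply: integ_measurable (integZ h^-1 (integB (iD h) iD0)).
have qdom h t : h != 0 -> `|q h t| <=
   2 / (p - 1) * (om t * tnth (X t) i ^+ 2 + om t * tnth (X t) j ^+ 2).
  move=> h0; rewrite /q -mulrDr.
  have p1 : 0 < p - 1 by move: p12; lra.
  have C0 : 0 <= 2 / (p - 1) by rewrite divr_ge0 // ltW.
  have [r0|r0] := eqVneq (r t) 0.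
    rewrite mul0r normr0 mulr_ge0// mulr_ge0 ?powR_ge0// addr_ge0// sqr_ge0//.
  rewrite mul1r -mulrBl.
  have hn : 0 < `|h| by rewrite normr_gt0.
  have hl := spow_lipschitz p12 (h * tnth (X t) i) r0.
  rewrite /dell -mulrBl !normrM !normfV (gtr0_norm p1).
  rewrite -/(om t) in hl.
  have hl2 : `|h|^-1 * `|spow p (r t + h * tnth (X t) i) - spow p (r t)| <=
     2 * `|tnth (X t) i| * om t.
    rewrite mulrC ler_pdivrMr// (le_trans hl)// normrM.
    by rewrite le_eqVlt; apply/orP; left; apply/eqP; ring.
  pose x : R := `|tnth (X t) i|; pose z : R := `|tnth (X t) j|.
  rewrite -/x -/z.
  rewrite -/x in hl2.
  set D := `|spow p _ - _| in hl2 *.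
  have -> : `|h|^-1 * (D / (p - 1) * z) = (p - 1)^-1 * (`|h|^-1 * D * z) by ring.
  have -> : 2 / (p - 1) * (om t * (tnth (X t) i ^+ 2 + tnth (X t) j ^+ 2)) =
    (p - 1)^-1 * (2 * om t * (x ^+ 2 + z ^+ 2)).
    by rewrite /x /z !real_normK ?num_real//; ring.
  rewrite ler_pM2l ?invr_gt0//.
  apply: (le_trans (ler_wpM2r (normr_ge0 _) hl2)).
  rewrite -/x -/z (_ : 2 * x * om t * z = 2 * om t * (x * z)); last by ring.
  apply: ler_wpM2l; first by rewrite mulr_ge0// powR_ge0.
  have xz : 0 <= x * z by exact: (mulr_ge0 (normr_ge0 _) (normr_ge0 _)).
  have := sqr_ge0 (x - z); have := sqr_ge0 (x + z); lra.
rewrite /derive; apply: cvg_lim => //; apply/cvgr_dnbhsP => u [un0 u0].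
have -> : (fun n => (u n)^-1 *: (((fun h : R => \int[P]_t
     (dell p (r t + h * tnth (X t) i) * tnth (X t) j)) \o shift 0) ((u n) *: 1) -
     \int[P]_t (dell p (r t + 0 * tnth (X t) i) * tnth (X t) j))) =
   (fun n => \int[P]_t q (u n) t).
  have e0 : \int[P]_t (dell p (r t + 0 * tnth (X t) i) * tnth (X t) j) =
      \int[P]_t (dell p (r t) * tnth (X t) j).
    by apply: eq_Rintegral => t _; rewrite mul0r addr0.
  by apply/funext => n; rewrite e0 -qE /= addr0 [u n *: 1]mulr1.
have cvgq t : q (u n) t @[n --> \oo] --> om t * tnth (X t) i * tnth (X t) j.
  rewrite /q; have [r0|r0] := eqVneq (r t) 0.
    rewrite /om r0 normr0 powR0 ?mul0r; last by rewrite lt_eqF//; move: p12; lra.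
    by under eq_fun do rewrite mul0r; exact: cvg_cst.
  under eq_fun do rewrite mul1r.
  have [dq dqE] := is_derive_dell_affine p12 (tnth (X t) i) (tnth (X t) j) r0.
  move: dq dqE; rewrite /derivable /derive => H lE; rewrite lE in H.
  move/cvgr_dnbhsP : H => /(_ u (conj un0 u0)).
  by under eq_fun do rewrite /= addr0 [u _ *: 1]mulr1 mul0r addr0.
have idom : integ P (fun t => 2 / (p - 1) *
   (om t * tnth (X t) i ^+ 2 + om t * tnth (X t) j ^+ 2)).
  by apply: integZ; exact: integD.
have ilim := integ_weighted_coord_mul i j.
have iq n : integ P (q (u n)).
  exact: (integ_le (mq _) (fun t => qdom _ t (un0 n)) idom).
have L : (\int[P]_t (q (u n) t)%:E)%E @[n --> \oo] -->
    (\int[P]_t (om t * tnth (X t) i * tnth (X t) j)%:E)%E.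
  apply: (dominated_cvg measurableT _ _ _ idom).
  - by move=> n; apply/measurable_EFinP.
  - by move=> t _; apply: cvg_EFin; [exact: nearW|exact: cvgq].
  - by [].
  - by move=> n t _; rewrite lee_fin; exact: qdom.
rewrite (integE ilim) in L.
have -> : (fun n => \int[P]_t q (u n) t) = (fun n => fine (\int[P]_t (q (u n) t)%:E)%E).
  by [].
exact: fine_cvg.
Qed.

End risk_hessian.

(** * Weighted moments *)
Section finite_sums.
Context {R : realDomainType}.

Lemma cauchy_schwarz_sum (I : finType) (a b : I -> R) :
  (\sum_i a i * b i) ^+ 2 <= (\sum_i a i ^+ 2) * (\sum_i b i ^+ 2).
Proof.
have h : 0 <= \sum_i \sum_j (a i * b j - a j * b i) ^+ 2.
  by apply: sumr_ge0 => i _; apply: sumr_ge0 => j _; exact: sqr_ge0.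
have e : \sum_i \sum_j (a i * b j - a j * b i) ^+ 2 =
    (\sum_i a i ^+ 2) * (\sum_i b i ^+ 2) * 2 - (\sum_i a i * b i) ^+ 2 * 2.
  transitivity (\sum_i \sum_j (a i ^+ 2 * b j ^+ 2 + a j ^+ 2 * b i ^+ 2
       - ((a i * b i) * (a j * b j) + (a i * b i) * (a j * b j)))).
    by apply: eq_bigr => i _; apply: eq_bigr => j _; ring.
  under eq_bigr do rewrite sumrB !big_split/=.
  rewrite sumrB !big_split/= [X in _ + X - _]exchange_big/=.
  by rewrite expr2 !big_distrlr/=; ring.
by move: h; rewrite e; lra.
Qed.

Lemma sqr_sum_le (d : nat) (a : 'I_d -> R) :
  (\sum_i a i) ^+ 2 <= d%:R * \sum_i a i ^+ 2.
Proof.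
have := cauchy_schwarz_sum (fun=> 1) a.
under eq_bigr do rewrite mul1r.
by under [X in _ <= X * _ -> _]eq_bigr do rewrite expr1n; rewrite sumr_const card_ord.
Qed.

End finite_sums.

Section weighted_moments.
Context {R : realType} {dT : measure_display} {T : measurableType dT}.
Variables (P : probability T R) (d : nat) (X : T -> d.-tuple R) (Y : T -> R).
Hypotheses (mX : measurable_fun setT X) (mY : measurable_fun setT Y).
Variable p : R.
Hypothesis p12 : 1 < p < 2.
Hypothesis Y_mom : integ P (fun t => `|Y t| `^ p).
Hypothesis X_mom : forall j : 'I_d, integ P (fun t => tnth (X t) j ^+ 2).
Variable wstar : 'cV[R]_d.
Hypothesis X_nondegenerate : forall w : 'cV[R]_d,
  P [set t | dot w (vect (X t)) = 0] = 1%E -> w = 0.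

Let r t := residual (X t) (Y t) wstar.
Let om t := `|r t| `^ (p - 2).

Hypothesis r_neq0 : P [set t | r t != 0] = 1%E.
Hypothesis r_mom : integ P (fun t => om t ^+ 2).
Hypothesis wX_mom4 : forall j : 'I_d,
  integ P (fun t => om t ^+ 2 * tnth (X t) j ^+ 4).

Let mx (j : 'I_d) : measurable_fun setT (fun t => tnth (X t) j).
Proof. exact: (measurableT_comp (measurable_tnth j)). Qed.

Let mdot (w : 'cV[R]_d) : measurable_fun setT (fun t => dot w (vect (X t))).
Proof. exact: measurable_dot. Qed.

Let mr : measurable_fun setT r.
Proof. exact: measurable_residual. Qed.

Let mom : measurable_fun setT om.
Proof.
by apply: (measurableT_comp (measurable_powR _)); exact: measurableT_comp.
Qed.

Lemma weighted_sqr_moment j : integ P (fun t => om t * tnth (X t) j ^+ 2).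
Proof.
apply: (integ_le _ _ (integD (integ_cst P 1) (wX_mom4 j))).
  by apply: measurable_funM => //; exact: measurable_funX.
move=> t; rewrite ger0_norm; last first.
  by apply: mulr_ge0; [exact: powR_ge0|exact: sqr_ge0].
have := sqr_ge0 (om t * tnth (X t) j ^+ 2 - 1).
have := sqr_ge0 (om t * tnth (X t) j ^+ 2).
have -> : om t ^+ 2 * tnth (X t) j ^+ 4 = (om t * tnth (X t) j ^+ 2) ^+ 2 by ring.
lra.
Qed.

(** The norm of [w] for the Hessian of the loss at one data point, squared. *)
Definition weighted_form (w : 'cV[R]_d) t := om t * dot w (vect (X t)) ^+ 2.

Lemma weighted_form_ge0 w t : 0 <= weighted_form w t.
Proof. by apply: mulr_ge0; [exact: powR_ge0|exact: sqr_ge0]. Qed.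

Lemma weighted_formE w t : weighted_form w t =
  \sum_i \sum_j (w i 0 * w j 0) * (om t * tnth (X t) i * tnth (X t) j).
Proof.
rewrite /weighted_form dot_vectE expr2 mulr_suml mulr_sumr; apply: eq_bigr => i _.
by rewrite !mulr_sumr; apply: eq_bigr => j _; ring.
Qed.

Lemma integ_weighted_form w : integ P (weighted_form w).
Proof.
rewrite (funext (weighted_formE w)).
apply: integ_sum => i _; apply: integ_sum => j _; apply: integZ.
exact: (integ_weighted_coord_mul mX mY weighted_sqr_moment).
Qed.

Lemma integ_weighted_form_sqr w : integ P (fun t => weighted_form w t ^+ 2).
Proof.
have h : integ P (fun t => (\sum_i w i 0 ^+ 2) ^+ 2 * d%:R *
   \sum_j (om t ^+ 2 * tnth (X t) j ^+ 4)).
  by apply: integZ; apply: integ_sum.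
apply: (integ_le _ _ h).
  by apply: measurable_funX; exact: integ_measurable (integ_weighted_form w).
move=> t; rewrite ger0_norm ?sqr_ge0// /weighted_form exprMn -mulr_sumr.
rewrite [leRHS](_ : _ = om t ^+ 2 * ((\sum_i w i 0 ^+ 2) ^+ 2 *
  (d%:R * \sum_i tnth (X t) i ^+ 4))); last by ring.
apply: ler_wpM2l; first exact: sqr_ge0.
rewrite dot_vectE.
have h1 := cauchy_schwarz_sum (fun i => w i 0) (fun i => tnth (X t) i).
have h2 := sqr_sum_le (fun i => tnth (X t) i ^+ 2).
have e4 : \sum_i (tnth (X t) i ^+ 2) ^+ 2 = \sum_i tnth (X t) i ^+ 4.
  by apply: eq_bigr => i _; rewrite -exprM.
rewrite e4 in h2.
apply: le_trans (ler_wpM2l (sqr_ge0 _) h2).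
rewrite -exprMn lerXn2r ?nnegrE ?sqr_ge0//.
by apply: mulr_ge0; apply: sumr_ge0 => i _; exact: sqr_ge0.
Qed.

Lemma risk_hessianE :
  risk_hessian P X Y p wstar =
  \matrix_(i, j) \int[P]_t (om t * tnth (X t) i * tnth (X t) j).
Proof.
apply/matrixP => i j; rewrite !mxE.
exact: (derive2_risk mX mY p12 Y_mom X_mom r_neq0 weighted_sqr_moment).
Qed.

Let H := risk_hessian P X Y p wstar.

Lemma risk_hessian_form w : (w^T *m H *m w) 0 0 = \int[P]_t weighted_form w t.
Proof.
have ic := integ_weighted_coord_mul mX mY weighted_sqr_moment.
under eq_Rintegral => t _ do rewrite weighted_formE.
rewrite mean_sum; last first.
  by move=> i _; apply: integ_sum => j _; apply: integZ; exact: ic.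
rewrite -mulmxA mxE; apply: eq_bigr => i _.
rewrite mean_sum; last by move=> j _; apply: integZ; exact: ic.
rewrite !mxE mulr_sumr; apply: eq_bigr => j _.
rewrite RintegralZl//; last exact: ic.
by rewrite /H risk_hessianE !mxE; ring.
Qed.

Lemma risk_hessian_sym : H^T = H.
Proof.
rewrite /H risk_hessianE; apply/matrixP => i j; rewrite !mxE.
by apply: eq_Rintegral => t _; rewrite mulrAC.
Qed.

Let mr0 : measurable [set t | r t != 0].
Proof. exact: measurable_neq0_set. Qed.

Lemma probability1_sub (A B C : set T) :
  measurable A -> measurable B -> measurable C ->
  P A = 1%E -> P B = 1%E -> A `&` B `<=` C -> P C = 1%E.
Proof.
move=> mA mB mC PA PB ABC.
have PAc : P (~` A) = 0%E by have := probability_setC P mA; rewrite PA subee.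
have PBc : P (~` B) = 0%E by have := probability_setC P mB; rewrite PB subee.
have PCc : P (~` C) = 0%E.
  apply/eqP; rewrite -measure_le0.
  have sub : ~` C `<=` ~` A `|` ~` B by rewrite -setCI; exact: subsetC.
  apply: (le_trans (le_measure P _ _ sub)).
  - by rewrite inE; exact: measurableC.
  - by rewrite inE; apply: measurableU; exact: measurableC.
  apply: (le_trans (measureU2 P (measurableC mA) (measurableC mB))).
  by rewrite [X in (X + _)%E]PAc [X in (_ + X)%E]PBc adde0.
by have := probability_setC P (measurableC mC); rewrite setCK PCc sube0.
Qed.

(** The weight is almost surely nonzero, so that a direction in which the form
vanishes is almost surely orthogonal to [X]. *)
Lemma risk_hessian_posdef (w : 'cV[R]_d) : w != 0 -> 0 < (w^T *m H *m w) 0 0.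
Proof.
move=> w0; rewrite risk_hessian_form lt_neqAle.
rewrite Rintegral_ge0 ?andbT; last by move=> t _; exact: weighted_form_ge0.
apply: contra_neq w0 => /esym E0; apply: X_nondegenerate.
have iw := integ_weighted_form w.
have P0 := mean_eq0 iw (weighted_form_ge0 w) E0.
apply: (probability1_sub _ mr0 _ P0 r_neq0).
- exact: measurable_zero_set (integ_measurable iw).
- exact: measurable_zero_set.
move=> t [/= wt0 rt0]; apply/eqP; move/eqP: wt0.
rewrite /weighted_form mulf_eq0 sqrf_eq0 /om powR_eq0 normr_eq0.
by rewrite (negbTE rt0).
Qed.

Lemma dot_second_moment_gt0 (w : 'cV[R]_d) : w != 0 ->
  0 < \int[P]_t (dot w (vect (X t)) ^+ 2).
Proof.
move=> w0; rewrite lt_neqAle Rintegral_ge0 ?andbT; last by move=> t _; exact: sqr_ge0.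
apply: contra_neq w0 => /esym E0; apply: X_nondegenerate.
have iw := integ_dot_sqr mX X_mom w.
have := mean_eq0 iw (fun t => sqr_ge0 _) E0.
rewrite (_ : [set t | dot w (vect (X t)) ^+ 2 = 0] = [set t | dot w (vect (X t)) = 0])//.
apply/seteqP; split => t /= => [/eqP|->]; last by rewrite expr0n.
by rewrite sqrf_eq0 => /eqP.
Qed.

Lemma weight_second_moment_gt0 : 0 < \int[P]_t (om t ^+ 2).
Proof.
rewrite lt_neqAle Rintegral_ge0 ?andbT; last by move=> t _; exact: sqr_ge0.
apply/negP => /eqP/esym E0.
have P0 := mean_eq0 r_mom (fun t => sqr_ge0 _) E0.
have : P set0 = 1%E.
  apply: (probability1_sub _ mr0 _ P0 r_neq0) => //.
    by apply: measurable_zero_set; exact: measurable_funX.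
  move=> t [/= omt rt]; move/eqP: omt.
  by rewrite sqrf_eq0 /om powR_eq0 normr_eq0 (negbTE rt).
by rewrite measure0 => /eqP; rewrite eq_sym onee_eq0.
Qed.

Lemma Lq_normE q w :
  Lq_norm P X Y p wstar q w =
  ((\int[P]_t (Num.sqrt (weighted_form w t) `^ q)%:E) `^ q^-1)%E.
Proof.
rewrite /Lq_norm unlock; congr (poweR _ _).
apply: eq_integral => t _; rewrite hessian_loss// /mxnorm.
rewrite -scalemxAr -scalemxAl.
have -> : (`|residual (X t) (Y t) wstar| `^ (p - 2) *:
   (w^T *m (vect (X t) *m (vect (X t))^T) *m w)) 0 0 = weighted_form w t.
  rewrite mxE /weighted_form mulmxA -mulmxA; congr (_ * _).
  rewrite mxE big_ord1 expr2; congr (_ * _).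
  by rewrite /dot -[in RHS](trmxK (vect (X t))) -trmx_mul [RHS]mxE.
by rewrite abse_EFin ger0_norm ?sqrtr_ge0// poweR_EFin.
Qed.

(** The comparison of [L^4] and [L^2] norms that [sigma2] expresses, raised to
the fourth power; nondegeneracy makes the denominators nonzero. *)
Lemma fourth_moment_le (s2 : R) : sigma2 P X Y p wstar = s2%:E ->
  forall w, \int[P]_t (weighted_form w t ^+ 2) <=
    s2 * (\int[P]_t weighted_form w t) ^+ 2.
Proof.
move=> s2E w.
have [->|w0] := eqVneq w 0.
  have e t : weighted_form 0 t = 0.
    by rewrite /weighted_form dot_vectE big1 ?expr0n ?mulr0// => j _; rewrite mxE mul0r.
  under eq_Rintegral do rewrite e expr0n/=.
  under [X in _ <= _ * X ^+ 2]eq_Rintegral do rewrite e.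
  by rewrite mean_cst expr0n/= mulr0.
have M2 := risk_hessian_posdef w0; rewrite risk_hessian_form in M2.
set m2 := \int[P]_t weighted_form w t in M2 *.
set m4 := \int[P]_t (weighted_form w t ^+ 2).
have m40 : 0 <= m4 by apply: Rintegral_ge0 => t _; exact: sqr_ge0.
have L2 : Lq_norm P X Y p wstar 2 w = (m2 `^ 2^-1)%:E.
  rewrite Lq_normE.
  rewrite -poweR_EFin -(integE (integ_weighted_form w)); congr (poweR _ _).
  apply: eq_integral => t _; congr (_%:E).
  rewrite (@powR_mulrn _ _ 2); last exact: sqrtr_ge0.
  by rewrite sqr_sqrtr; last exact: weighted_form_ge0.
have L4 : Lq_norm P X Y p wstar 4 w = (m4 `^ 4^-1)%:E.
  rewrite Lq_normE.
  rewrite -poweR_EFin -(integE (integ_weighted_form_sqr w)); congr (poweR _ _).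
  apply: eq_integral => t _; congr (_%:E).
  rewrite (@powR_mulrn _ _ 4); last exact: sqrtr_ge0.
  by rewrite (exprM _ 2 2) sqr_sqrtr; last exact: weighted_form_ge0.
pose S := ereal_sup [set (Lq_norm P X Y p wstar 4 w / Lq_norm P X Y p wstar 2 w)%E
             | w in [set w : 'cV[R]_d | w != 0%R]].
have SE : (S ^+ 4)%E = s2%:E by [].
have m20 : 0 < m2 `^ 2^-1 by exact: powR_gt0.
have leS : ((m4 `^ 4^-1 / m2 `^ 2^-1)%:E <= S)%E.
  apply: ereal_sup_ubound; exists w => //.
  by rewrite L2 L4 inver gt_eqF// -EFinM.
have ratio0 : 0 <= m4 `^ 4^-1 / m2 `^ 2^-1 by rewrite divr_ge0 ?powR_ge0.
case: S SE leS => [S| |] SE leS; last by move: leS; rewrite leeNy_eq.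
  have {}SE : S ^+ 4 = s2 by move: SE; rewrite -EFin_expe => -[].
  rewrite lee_fin in leS.
  have root4 : (m4 `^ 4^-1) ^+ 4 = m4.
    rewrite -[LHS]powR_mulrn; last exact: powR_ge0.
    by rewrite -powRrM mulVf ?pnatr_eq0// powRr1.
  have root2 : (m2 `^ 2^-1) ^+ 4 = m2 ^+ 2.
    rewrite -[LHS]powR_mulrn; last exact: powR_ge0.
    rewrite -powRrM (_ : 2^-1 * 4%:R = 2%:R); last by field.
    by rewrite (@powR_mulrn _ _ 2) ?(ltW M2).
  have : (m4 `^ 4^-1 / m2 `^ 2^-1) ^+ 4 <= s2.
    by rewrite -SE; apply: (lerXn2r 4) (leS); rewrite nnegrE// (le_trans _ leS).
  rewrite (expr_div_n (m4 `^ 4^-1) (m2 `^ 2^-1) 4) root4 root2.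
  by rewrite ler_pdivrMr; last exact: exprn_gt0.
by move: SE; rewrite !expeS expe0 mule1 !mulyy.
Qed.

End weighted_moments.

(** * Effect of the truncation on the curvature *)
Section final_estimates.
Context {R : realType}.
Variable p : R.
Hypothesis p12 : 1 < p < 2.

Lemma powR_antitone (y z : R) : 0 < y -> y <= z -> z `^ (p - 2) <= y `^ (p - 2).
Proof.
move=> y0 yz; have z0 : 0 < z by exact: lt_le_trans yz.
rewrite -opprB !powRN lef_pV2 ?posrE ?powR_gt0//.
by apply: ge0_ler_powR; rewrite ?nnegrE; move: p12; lra.
Qed.

Lemma powR_double (z : R) : 0 <= z -> 2^-1 * z `^ (p - 2) <= (2 * z) `^ (p - 2).
Proof.
move=> z0; rewrite powRM// ler_wpM2r ?powR_ge0//.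
rewrite -[X in X <= _](@powR_inv1 R 2)//.
by apply: ler_powR; move: p12; lra.
Qed.

(** The fraction of the curvature at the minimizer that is kept at distance [D]
from it. *)
Definition truncation_factor (D kap : R) : R := Num.min 1 (D `^ (2 - p) * kap)^-1.

(** If [|s| <= |r|] the weight decreases by a factor of at most 2. Otherwise
[(|r| + |s|)^(p-2) >= |s|^(p-2) / 2], and [om |s|^(2-p) <= D^(2-p) kap] by the
truncation levels [M] of [om^2] and [A] of the squared dual norm of the data
point. *)
Lemma truncated_weight_le (r s D A M kap : R) : 0 < D -> 0 < kap -> 0 <= A ->
  kap ^+ 2 = M * A `^ (2 - p) ->
  (`|r| `^ (p - 2)) ^+ 2 <= M -> s ^+ 2 <= D ^+ 2 * A ->
  2^-1 * truncation_factor D kap * (`|r| `^ (p - 2) * s ^+ 2) <=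
  s ^+ 2 * (`|r| + `|s|) `^ (p - 2).
Proof.
move=> D0 kap0 A0 kapE rM sD; set om := `|r| `^ (p - 2) in rM *.
set m := truncation_factor D kap.
have om0 : 0 <= om by exact: powR_ge0.
have pos : 0 < D `^ (2 - p) * kap by rewrite mulr_gt0// powR_gt0.
have m0 : 0 <= m by rewrite /m /truncation_factor le_min ler01/= invr_ge0 ltW.
have m1 : m <= 1 by rewrite /m /truncation_factor ge_min lexx.
have m2 : m <= (D `^ (2 - p) * kap)^-1.
  by rewrite /m /truncation_factor ge_min lexx orbT.
have [->|s0] := eqVneq s 0; first by rewrite expr0n/= !mulr0 mul0r.
have [r0|r0] := eqVneq r 0.
  rewrite /om r0 normr0 powR0 ?mul0r ?mulr0; last by rewrite lt_eqF//; move: p12; lra.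
  by rewrite mulr_ge0 ?sqr_ge0 ?powR_ge0.
have sn : 0 < `|s| by rewrite normr_gt0.
have rn : 0 < `|r| by rewrite normr_gt0.
suff : 2^-1 * m * om <= (`|r| + `|s|) `^ (p - 2).
  move=> h; rewrite mulrA [leRHS]mulrC; exact: ler_wpM2r (sqr_ge0 _) _ _ h.
have [h|h] := leP `|s| `|r|.
  apply: (@le_trans _ _ ((2 * `|r|) `^ (p - 2))); last first.
    by apply: powR_antitone; lra.
  apply: (le_trans _ (powR_double (ltW rn))).
  by rewrite -mulrA ler_pM2l// ler_piMl.
apply: (@le_trans _ _ ((2 * `|s|) `^ (p - 2))); last first.
  by apply: powR_antitone; lra.
apply: (le_trans _ (powR_double (ltW sn))).
rewrite -mulrA ler_pM2l//.
have key : om * `|s| `^ (2 - p) <= D `^ (2 - p) * kap.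
  have s2p : 0 <= `|s| `^ (2 - p) by exact: powR_ge0.
  rewrite -(@ler_pXn2r _ 2) ?nnegrE//; [|exact: mulr_ge0|exact: ltW].
  rewrite !exprMn kapE.
  have sqE (y : R) : 0 <= y -> (y `^ (2 - p)) ^+ 2 = (y ^+ 2) `^ (2 - p).
    by move=> y0; rewrite -powR_mulrn ?powR_ge0// powRAC powR_mulrn.
  rewrite !sqE ?(ltW D0)// real_normK ?num_real// mulrCA -powRM ?sqr_ge0//.
  apply: ler_pM; rewrite ?sqr_ge0 ?powR_ge0//.
  by apply: ge0_ler_powR; rewrite ?nnegrE ?sqr_ge0 ?mulr_ge0 ?sqr_ge0//; move: p12; lra.
have om_le : om <= D `^ (2 - p) * kap * `|s| `^ (p - 2).
  have inv : `|s| `^ (2 - p) * `|s| `^ (p - 2) = 1.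
    rewrite -powRD; last by rewrite (gt_eqF sn) implybT.
    by rewrite (_ : 2 - p + (p - 2) = 0) ?powRr0//; ring.
  rewrite -[leLHS]mulr1 -[X in _ * X <= _]inv mulrA.
  exact: ler_wpM2r (powR_ge0 _ _) _ _ key.
apply: (le_trans (ler_wpM2l m0 om_le)).
rewrite mulrA ler_piMl ?powR_ge0//.
by apply: (le_trans (ler_wpM2r (ltW pos) m2)); rewrite mulVf// gt_eqF.
Qed.

(** If the factor is 1 then [D^2 <= 2 (128/3)^2 Q], and
[4 (128/3)^2 <= 2^15]. Otherwise the factor times [D] is [D^(p-1) / kap], so the
hypothesis bounds [D^(2(p-1))], which is raised to the power [1/(p-1)]; the constants
are collected by [4 (128/3)^2 * 16 * 16^(2-p) <= 2^21]. *)
Lemma excess_from_truncated_bound (D kap s2 cp cs Q : R) :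
  0 < D -> 0 < kap -> 0 < s2 -> 0 < cp -> 0 < cs -> 0 <= Q ->
  kap ^+ 2 = (16 * s2 * cs) * (16 * s2 * cp) `^ (2 - p) ->
  (3 / 128 * truncation_factor D kap * D) ^+ 2 <= 2 * Q ->
  2 / (p - 1) * D ^+ 2 <=
  2 ^+ 15 / (p - 1) * Q +
  (p - 1)^-1 * (2 ^+ 21 * (Q * s2 `^ (3 - p) * cp `^ (2 - p) * cs)) `^ (1 / (p - 1)).
Proof.
move=> D0 kap0 s20 cp0 cs0 Q0 kapE H.
have p1 : 0 < p - 1 by move: p12; lra.
set Z := 2 ^+ 21 * _; set W := _ `^ (1 / (p - 1)).
have W0 : 0 <= W by exact: powR_ge0.
have -> : 2 / (p - 1) * D ^+ 2 = (p - 1)^-1 * (2 * D ^+ 2) by ring.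
have -> : 2 ^+ 15 / (p - 1) * Q = (p - 1)^-1 * (2 ^+ 15 * Q) by ring.
rewrite -mulrDr ler_pM2l ?invr_gt0//.
have pos : 0 < D `^ (2 - p) * kap by rewrite mulr_gt0// powR_gt0.
have [h|h] := leP 1 ((D `^ (2 - p) * kap)^-1).
  have {}H : (3 / 128 * D) ^+ 2 <= 2 * Q.
    by move: H; rewrite /truncation_factor (min_idPl h) mulr1.
  rewrite exprMn in H.
  have -> : 2 ^+ 15 * Q = 32 * 32 * 32 * Q by ring.
  have : 0 <= D ^+ 2 by exact: sqr_ge0.
  lra.
have Dp : D * (D `^ (2 - p) * kap)^-1 = D `^ (p - 1) / kap.
  rewrite invfM mulrA; congr (_ / _).
  rewrite -powRN -{1}(powRr1 (ltW D0)) -powRD; last by rewrite (gt_eqF D0) implybT.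
  by congr (_ `^ _); ring.
have {}H : (D `^ (p - 1)) ^+ 2 <= (128 / 3) ^+ 2 * 2 * Q * kap ^+ 2.
  move: H; rewrite /truncation_factor (min_idPr (ltW h)) -mulrA.
  rewrite [X in (_ * X) ^+ 2]mulrC Dp exprMn [X in _ * X <= _]expr_div_n.
  have k2 : 0 < kap ^+ 2 by rewrite exprn_gt0.
  rewrite mulrA ler_pdivrMr// => H; lra.
suff : 2 * D ^+ 2 <= W.
  have : 0 <= 2 ^+ 15 * Q by rewrite mulr_ge0// exprn_ge0.
  lra.
have X0 : 0 <= Q * s2 `^ (3 - p) * cp `^ (2 - p) * cs.
  by rewrite !mulr_ge0 ?powR_ge0// ltW.
have D2 : 0 <= 2 * D ^+ 2 by rewrite mulr_ge0// sqr_ge0.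
have -> : 2 * D ^+ 2 = ((2 * D ^+ 2) `^ (p - 1)) `^ (1 / (p - 1)).
  by rewrite -powRrM mul1r divff ?gt_eqF// powRr1.
apply: ge0_ler_powR; rewrite ?nnegrE ?powR_ge0//.
- by rewrite divr_ge0// ltW.
- by rewrite /Z mulr_ge0 // exprn_ge0.
have two : (2 : R) `^ (p - 1) <= 2.
  by rewrite -[leRHS](@powRr1 _ 2)//; apply: ler_powR; move: p12; lra.
rewrite powRM ?sqr_ge0//.
have -> : (D ^+ 2) `^ (p - 1) = (D `^ (p - 1)) ^+ 2.
  by rewrite -powR_mulrn ?(ltW D0)// powRAC powR_mulrn ?powR_ge0.
have sixteen : (16 : R) `^ (2 - p) <= 16.
  by rewrite -[leRHS](@powRr1 _ 16)//; apply: ler_powR; move: p12; lra.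
have s2E : s2 * s2 `^ (2 - p) = s2 `^ (3 - p).
  rewrite -{1}(powRr1 (ltW s20)) -powRD; last by rewrite (gt_eqF s20) implybT.
  by congr (_ `^ _); ring.
have kap2 : Q * kap ^+ 2 <= 256 * (Q * s2 `^ (3 - p) * cp `^ (2 - p) * cs).
  have kapE0 := kapE; have e16 : (16 * s2 * cp) `^ (2 - p) =
      16 `^ (2 - p) * s2 `^ (2 - p) * cp `^ (2 - p).
    by rewrite !powRM ?mulr_ge0 ?(ltW s20) ?(ltW cp0).
  rewrite e16 in kapE0.
  rewrite [kap ^+ 2]kapE0.
  have -> : Q * (16 * s2 * cs * (16 `^ (2 - p) * s2 `^ (2 - p) * cp `^ (2 - p)))
    = 16 * 16 `^ (2 - p) * (Q * s2 `^ (3 - p) * cp `^ (2 - p) * cs).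
    by rewrite -s2E; ring.
  by rewrite ler_wpM2r//; lra.
have h1 : 2 `^ (p - 1) * (D `^ (p - 1)) ^+ 2 <= 2 * (D `^ (p - 1)) ^+ 2.
  by rewrite ler_wpM2r// sqr_ge0.
apply: (le_trans h1).
rewrite /Z; have -> : 2 ^+ 21 = 128 * 128 * 128 :> R by ring.
lra.
Qed.

End final_estimates.

(** * Whitened and truncated data *)
Section whitening.
Context {R : realType}.
Variables (d : nat) (H B : 'M[R]_d).
Hypothesis BHB : B^T *m H *m B = 1%:M.

Lemma whitening_inverse : B *m (B^T *m H) = 1%:M.
Proof. exact: mulmx1C. Qed.

Lemma whitening_invmx : invmx H = B *m B^T.
Proof.
have e : B *m B^T *m H = 1%:M by rewrite -mulmxA whitening_inverse.
have [_ uH] := mulmx1_unit e.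
by rewrite -[RHS]mulmx1 -(mulmxV uH) mulmxA e mul1mx.
Qed.

(** The coordinates of [B^T x], in which the inverse of [H] becomes the
standard scalar product. *)
Definition whitened (x : d.-tuple R) (j : 'I_d) : R := dot (col j B) (vect x).

Lemma dot_whitened (w : 'cV[R]_d) (x : d.-tuple R) :
  dot (B *m w) (vect x) = \sum_j w j 0 * whitened x j.
Proof.
rewrite /dot trmx_mul -mulmxA mxE; apply: eq_bigr => j _; rewrite mxE; congr (_ * _).
rewrite /whitened /dot !mxE; apply: eq_bigr => i _; by rewrite !mxE.
Qed.

Lemma mxnorm_whitened (g : R) (x : d.-tuple R) :
  mxnorm (invmx H) (g *: vect x) ^+ 2 = \sum_j (g * whitened x j) ^+ 2.
Proof.
have e : ((g *: vect x)^T *m invmx H *m (g *: vect x)) 0 0 =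
    \sum_j (g * whitened x j) ^+ 2.
  have -> : (g *: vect x)^T *m invmx H *m (g *: vect x) =
      (B^T *m (g *: vect x))^T *m (B^T *m (g *: vect x)).
    by rewrite whitening_invmx trmx_mul trmxK !mulmxA.
  rewrite mxE; apply: eq_bigr => j _; rewrite mxE expr2.
  suff -> : (B^T *m (g *: vect x)) j 0 = g * whitened x j by [].
  rewrite -scalemxAr mxE; congr (_ * _); rewrite /whitened /dot !mxE.
  by apply: eq_bigr => i _; rewrite !mxE.
rewrite /mxnorm e sqr_sqrtr//.
by apply: sumr_ge0 => j _; exact: sqr_ge0.
Qed.

Lemma trace_whitened (M : 'M[R]_d) :
  \tr (invmx H *m M) = \sum_j ((col j B)^T *m M *m col j B) 0 0.
Proof.
rewrite whitening_invmx -mulmxA mxtrace_mulC /mxtrace; apply: eq_bigr => j _.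
by rewrite tr_col -row_mul !mxE; apply: eq_bigr => i _; rewrite !mxE.
Qed.

End whitening.

Section good_event.
Context {R : realType} {dT : measure_display} {T : measurableType dT}.
Variables (P : probability T R) (d n : nat).
Variables (X : T -> d.-tuple R) (Y : T -> R).
Variables (Xs : 'I_n -> T -> d.-tuple R) (Ys : 'I_n -> T -> R).
Hypotheses (mX : measurable_fun setT X) (mY : measurable_fun setT Y).
Hypotheses (mXs : forall i, measurable_fun setT (Xs i))
           (mYs : forall i, measurable_fun setT (Ys i)).
Variable p : R.
Hypothesis p12 : 1 < p < 2.
Hypothesis Y_mom : integ P (fun t => `|Y t| `^ p).
Hypothesis X_mom : forall j : 'I_d, integ P (fun t => tnth (X t) j ^+ 2).
Variable wstar : 'cV[R]_d.
Hypothesis X_nondegenerate : forall w : 'cV[R]_d,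
  P [set t | dot w (vect (X t)) = 0] = 1%E -> w = 0.
Let r t := residual (X t) (Y t) wstar.
Let om t := `|r t| `^ (p - 2).
Hypothesis r_neq0 : P [set t | r t != 0] = 1%E.
Hypothesis r_mom : integ P (fun t => om t ^+ 2).
Hypothesis wX_mom4 : forall j : 'I_d,
  integ P (fun t => om t ^+ 2 * tnth (X t) j ^+ 4).

Let H := risk_hessian P X Y p wstar.
Variable B : 'M[R]_d.
Hypothesis BHB : B^T *m H *m B = 1%:M.

Let wf := weighted_form X Y p wstar.
Let wc (x : d.-tuple R) j := whitened B x j.

Lemma c_pE : c_p P X Y p wstar = \int[P]_t (\sum_j wc (X t) j ^+ 2).
Proof.
rewrite /c_p (trace_whitened BHB) mean_sum; last first.
  by move=> j _; exact: integ_dot_sqr.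
apply: eq_bigr => j _; set u := col j B.
have ic := integ_coord_mul mX X_mom.
have e2 i k : second_moment P X i k = \int[P]_t (tnth (X t) i * tnth (X t) k).
  by rewrite mxE unlock.
transitivity (\int[P]_t (\sum_i \sum_k (u i 0 * u k 0) * (tnth (X t) i * tnth (X t) k))).
  rewrite mean_sum; last first.
    by move=> i _; apply: integ_sum => k _; apply: integZ; exact: ic.
  rewrite -mulmxA mxE; apply: eq_bigr => i _.
  rewrite mean_sum; last by move=> k _; apply: integZ; exact: ic.
  rewrite mxE [X in _ * X]mxE mulr_sumr; apply: eq_bigr => k _.
  rewrite RintegralZl//; last exact: ic.
  by rewrite e2 [X in _ * X]mulrC mulrA.
apply: eq_Rintegral => t _; rewrite /wc /whitened dot_vectE expr2 mulr_suml.
apply: eq_bigr => i _; rewrite mulr_sumr; apply: eq_bigr => k _; ring.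
Qed.

(** In the coordinates given by [B] the Hessian of the risk is the identity. *)
Lemma weighted_form_whitened (w : 'cV[R]_d) :
  \int[P]_t wf (B *m w) t = \sum_j w j 0 ^+ 2.
Proof.
rewrite -(risk_hessian_form mX mY p12 Y_mom X_mom r_neq0 wX_mom4).
rewrite trmx_mul -!mulmxA (mulmxA B^T) (mulmxA _ B) BHB mul1mx mxE.
by apply: eq_bigr => j _; rewrite !mxE expr2.
Qed.

Lemma weighted_form_col j : \int[P]_t wf (col j B) t = 1.
Proof.
rewrite colE weighted_form_whitened (bigD1 j)//= mxE !eqxx expr1n big1 ?addr0//.
by move=> k kj; rewrite mxE (negbTE kj) expr0n.
Qed.

Variables (s2 delta : R).
Hypothesis s2_gt0 : 0 < s2.
Hypothesis fourth : forall w, \int[P]_t (wf w t ^+ 2) <= s2 * (\int[P]_t wf w t) ^+ 2.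
Hypothesis d_gt0 : (0 < d)%N.
Hypothesis delta01 : 0 < delta <= 1.
Hypothesis n_large : 196 * s2 * (d%:R + 2 * ln (4 / delta)) <= n%:R.
Hypothesis iid : iid_copies P (fun t => (X t, Y t)) (fun i t => (Xs i t, Ys i t)).

Let cp := \int[P]_t (\sum_j wc (X t) j ^+ 2).
Let cs := \int[P]_t (om t ^+ 2).

Lemma whitened_second_moment_gt0 : 0 < \int[P]_t (\sum_j wc (X t) j ^+ 2).
Proof.
rewrite mean_sum; last by move=> j _; exact: integ_dot_sqr.
pose j0 := Ordinal d_gt0; rewrite (bigD1 j0)//= ltr_wpDr//.
  by apply: sumr_ge0 => j _; apply: Rintegral_ge0 => t _; exact: sqr_ge0.
apply: (dot_second_moment_gt0 mX X_mom X_nondegenerate).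
apply/negP => /eqP b0; have := weighted_form_col j0.
rewrite b0 /wf; under eq_Rintegral => t _.
  rewrite /weighted_form (_ : dot 0 _ = 0) ?expr0n ?mulr0; last first.
    by rewrite dot_vectE big1// => i _; rewrite mxE mul0r.
  over.
by rewrite mean_cst => /eqP; rewrite eq_sym oner_eq0.
Qed.

Let cp_gt0 : 0 < cp. Proof. exact: whitened_second_moment_gt0. Qed.

Let cs_gt0 : 0 < cs.
Proof. exact: (weight_second_moment_gt0 mX mY r_neq0 r_mom). Qed.

Let S := (d.-tuple R * R)%type.
Let rs (s : S) := residual s.1 s.2 wstar.
Let oms s := `|rs s| `^ (p - 2).

(** Each of the three constraints fails with probability at most
[1 / (16 s2)]: the first two by Markov's inequality, the third by Chebyshev's since
the weighted squared norm has second moment at most [s2 d^2]. The first two control the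
loss of curvature in [truncated_weight_le], the third bounds the vectors whose
empirical quadratic form is studied. *)
Definition good : set S :=
  [set s | \sum_j wc s.1 j ^+ 2 <= 16 * s2 * cp] `&`
  [set s | oms s ^+ 2 <= 16 * s2 * cs] `&`
  [set s | oms s * \sum_j wc s.1 j ^+ 2 <= 4 * s2 * d%:R].

Let mwc j : measurable_fun setT (fun s : S => wc s.1 j).
Proof. by apply: measurable_dot; exact: measurable_fst. Qed.

Let mrs : measurable_fun setT rs.
Proof. by apply: measurable_residual; [exact: measurable_fst|exact: measurable_snd]. Qed.

Let mrsp (q : R) : measurable_fun setT (fun s => `|rs s| `^ q).
Proof.
by apply: (measurableT_comp (measurable_powR _)); exact: measurableT_comp.
Qed.

Let mwc2 : measurable_fun setT (fun s : S => \sum_j wc s.1 j ^+ 2).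
Proof. by apply: measurable_sum => j; exact: measurable_funX. Qed.

Let mgood : measurable good.
Proof.
apply: measurableI; last by apply: measurable_sublevel; apply: measurable_funM => //; exact: mrsp.
apply: measurableI; apply: measurable_sublevel => //.
by apply: measurable_funX; exact: mrsp.
Qed.

(** The square root of the weight makes the squared linear forms of [v] equal
to the truncated weighted forms, see [v_form]. *)
Let v (s : S) (j : 'I_d) : R := \1_good s * (`|rs s| `^ ((p - 2) / 2) * wc s.1 j).

Let mv j : measurable_fun setT (v^~ j).
Proof.
apply: measurable_funM; first exact: measurable_indic.
by apply: measurable_funM; [exact: mrsp|exact: mwc].
Qed.

Let half s : (`|rs s| `^ ((p - 2) / 2)) ^+ 2 = oms s.
Proof.
by rewrite -powR_mulrn ?powR_ge0// -powRrM divfK// pnatr_eq0.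
Qed.

Let ind2 s : (\1_good s : R) ^+ 2 = \1_good s.
Proof. by rewrite indicE; case: (_ \in _); rewrite ?expr1n ?expr0n. Qed.

Let v_sqr s : \sum_j v s j ^+ 2 = \1_good s * (oms s * \sum_j wc s.1 j ^+ 2).
Proof.
rewrite !mulr_sumr; apply: eq_bigr => j _.
by rewrite /v !exprMn half ind2.
Qed.

Let v_form s (w : 'I_d -> R) : (\sum_j w j * v s j) ^+ 2 =
  \1_good s * (oms s * dot (B *m \col_j w j) (vect s.1) ^+ 2).
Proof.
rewrite dot_whitened -ind2 -half -!exprMn; congr (_ ^+ 2).
rewrite !mulr_sumr; apply: eq_bigr => j _; rewrite /v !mxE -/(wc _ _); ring.
Qed.

Let wc_sum_ge0 (x : d.-tuple R) : 0 <= \sum_j wc x j ^+ 2.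
Proof. by apply: sumr_ge0 => j _; exact: sqr_ge0. Qed.

Let ind01 s : 0 <= (\1_good s : R) <= 1.
Proof. by rewrite indicE; case: (_ \in _); rewrite ?lexx ?ler01. Qed.

Let v_bounded s : \sum_j v s j ^+ 2 <= 4 * s2 * d%:R.
Proof.
rewrite v_sqr indicE; have [sg|sg] := pselect (good s).
  by rewrite mem_set// mul1r; case: sg.
by rewrite memNset// mul0r !mulr_ge0// ltW.
Qed.

Let integ_wf w : integ P (wf w).
Proof. exact: (integ_weighted_form mX mY wX_mom4). Qed.

Let integ_wf2 w : integ P (fun t => wf w t ^+ 2).
Proof. exact: (integ_weighted_form_sqr mX mY wX_mom4). Qed.

Let wf0 w t : 0 <= wf w t. Proof. exact: weighted_form_ge0. Qed.

Let trace_wf t : om t * (\sum_j wc (X t) j ^+ 2) = \sum_j wf (col j B) t.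
Proof. by rewrite mulr_sumr. Qed.

Let v_mean : \int[P]_t (\sum_j v (X t, Y t) j ^+ 2) <= d%:R.
Proof.
have iw : integ P (fun t => \sum_j wf (col j B) t) by apply: integ_sum.
have -> : d%:R = \int[P]_t (\sum_j wf (col j B) t) :> R.
  rewrite mean_sum//; under eq_bigr do rewrite weighted_form_col.
  by rewrite sumr_const card_ord.
apply: mean_le => //.
  apply: (@integ_bounded _ _ _ _ _ (4 * s2 * d%:R)).
    apply: measurable_sum => j; apply: measurable_funX.
    by apply: (measurableT_comp (mv j)); exact: measurable_fun_pair.
  move=> t; rewrite ger0_norm ?v_bounded//.
  by apply: sumr_ge0 => j _; exact: sqr_ge0.
move=> t; rewrite v_sqr -trace_wf; have /andP[_ ind1] := ind01 (X t, Y t).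
apply: ler_piMl ind1.
by apply: mulr_ge0; [exact: powR_ge0|exact: wc_sum_ge0].
Qed.

Let v_formE (w : 'I_d -> R) t : (\sum_j w j * v (X t, Y t) j) ^+ 2 =
  \1_good (X t, Y t) * wf (B *m \col_j w j) t.
Proof. exact: v_form. Qed.

Let integ_v_form (w : 'I_d -> R) :
  integ P (fun t => (\sum_j w j * v (X t, Y t) j) ^+ 2).
Proof.
apply: (integ_le _ _ (integ_wf (B *m \col_j w j))).
  apply: measurable_funX; apply: measurable_sum => j; apply: measurable_funM => //.
  by apply: (measurableT_comp (mv j)); exact: measurable_fun_pair.
move=> t; rewrite ger0_norm ?sqr_ge0// v_formE.
have /andP[_ ind1] := ind01 (X t, Y t); exact: ler_piMl (wf0 _ _) ind1.
Qed.

Let sum_col (w : 'I_d -> R) : \sum_j (\col_j w j) j (0 : 'I_1) ^+ 2 = \sum_j w j ^+ 2.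
Proof. by apply: eq_bigr => j _; rewrite mxE. Qed.

Let v_fourth (w : 'I_d -> R) :
  \int[P]_t ((\sum_j w j * v (X t, Y t) j) ^+ 4) <= s2 * (\sum_j w j ^+ 2) ^+ 2.
Proof.
apply: (@le_trans _ _ (\int[P]_t (wf (B *m \col_j w j) t ^+ 2))); last first.
  by apply: (le_trans (fourth _)); rewrite weighted_form_whitened sum_col.
have le4 t : (\sum_j w j * v (X t, Y t) j) ^+ 4 <= wf (B *m \col_j w j) t ^+ 2.
  rewrite (exprM _ 2 2) v_formE exprMn ind2; have /andP[_ ind1] := ind01 (X t, Y t).
  exact: ler_piMl (sqr_ge0 _) ind1.
apply: mean_le => //; apply: (integ_le _ _ (integ_wf2 (B *m \col_j w j))).
  apply: measurable_funX; apply: measurable_sum => j; apply: measurable_funM => //.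
  by apply: (measurableT_comp (mv j)); exact: measurable_fun_pair.
by move=> t; rewrite ger0_norm// (exprM _ 2 2) sqr_ge0.
Qed.

(** Let V be the weighted form in the direction [u] and N its mean. Off the
good set [V <= V^2 / (4 s2 N) + s2 N] by the arithmetic-geometric inequality, so
the truncation of V is at least [V - V^2 / (4 s2 N) - s2 N b], where b is the
indicator of the complement. The first two terms together have mean at least
[N - N/4], and [s2 N b] has mean at most [3/16 N]. *)
Let v_lower (w : 'I_d -> R) :
  2^-1 * \sum_j w j ^+ 2 <= \int[P]_t ((\sum_j w j * v (X t, Y t) j) ^+ 2).
Proof.
set N := \sum_j w j ^+ 2.
have N0 : 0 <= N by apply: sumr_ge0 => j _; exact: sqr_ge0.
have [N1|Npos] := eqVneq N 0.
  by rewrite N1 mulr0; apply: Rintegral_ge0 => t _; exact: sqr_ge0.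
have {Npos N0}N0 : 0 < N by rewrite lt_neqAle eq_sym Npos.
set u := B *m \col_j w j.
pose f1 t := wf u t.
pose f2 t := (4 * s2 * N)^-1 * wf u t ^+ 2.
(* g1 + g2 + g3 is an integrable majorant of the indicator of the bad set *)
pose g1 t := (16 * s2 * cp)^-1 * \sum_j wc (X t) j ^+ 2.
pose g2 t := (16 * s2 * cs)^-1 * om t ^+ 2.
pose g3 t := (4 * s2 * d%:R) ^- 2 * (\sum_j wf (col j B) t) ^+ 2.
have dR0 : (0 : R) < d%:R by rewrite ltr0n.
have c1 : 0 < 16 * s2 * cp by rewrite !mulr_gt0.
have c2 : 0 < 16 * s2 * cs by rewrite !mulr_gt0.
have c3 : 0 < 4 * s2 * d%:R by rewrite !mulr_gt0.
have c4 : 0 < 4 * s2 * N by rewrite !mulr_gt0.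
have i1 : integ P f1 by exact: integ_wf.
have i2 : integ P f2 by apply: integZ; exact: integ_wf2.
have j1 : integ P g1 by apply: integZ; apply: integ_sum => j _; exact: integ_dot_sqr.
have j2 : integ P g2 by exact: integZ.
have icol : integ P (fun t => d%:R * \sum_j wf (col j B) t ^+ 2).
  by apply: integZ; apply: integ_sum => j _; exact: integ_wf2.
have icol2 : integ P (fun t => (\sum_j wf (col j B) t) ^+ 2).
  apply: (integ_le _ _ icol).
    apply: measurable_funX; apply: measurable_sum => j.
    exact: integ_measurable (integ_wf _).
  by move=> t; rewrite ger0_norm ?sqr_ge0// sqr_sum_le.
have j3 : integ P g3 by exact: integZ.
have point t : f1 t - f2 t - s2 * N * (g1 t + g2 t + g3 t) <=
    (\sum_j w j * v (X t, Y t) j) ^+ 2.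
  rewrite v_formE -/u -/(f1 t).
  have f20 : 0 <= f2 t by rewrite /f2 mulr_ge0 ?sqr_ge0// invr_ge0 ltW.
  have g10 : 0 <= g1 t by rewrite /g1 mulr_ge0 ?wc_sum_ge0// invr_ge0 ltW.
  have g20 : 0 <= g2 t by rewrite /g2 mulr_ge0 ?sqr_ge0// invr_ge0 ltW.
  have g30 : 0 <= g3 t by rewrite /g3 mulr_ge0 ?sqr_ge0// invr_ge0 sqr_ge0.
  have sN : 0 < s2 * N by rewrite mulr_gt0.
  rewrite indicE; have [tg|tg] := pselect (good (X t, Y t)).
    rewrite mem_set// mul1r.
    have : 0 <= s2 * N * (g1 t + g2 t + g3 t) by rewrite mulr_ge0 ?(ltW sN)// !addr_ge0.
    lra.
  rewrite memNset// mul0r.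
  have bad : 1 <= g1 t + g2 t + g3 t.
    have [h1|h1] := leP (\sum_j wc (X t) j ^+ 2) (16 * s2 * cp); last first.
      have : 1 < g1 t by rewrite /g1 mulrC ltr_pdivlMr// mul1r.
      lra.
    have [h2|h2] := leP (om t ^+ 2) (16 * s2 * cs); last first.
      have : 1 < g2 t by rewrite /g2 mulrC ltr_pdivlMr// mul1r.
      lra.
    have [h3|h3] := leP (om t * \sum_j wc (X t) j ^+ 2) (4 * s2 * d%:R).
      by exfalso; apply: tg; split=> //; split.
    have : 1 <= g3 t.
      rewrite /g3 mulrC ler_pdivlMr ?exprn_gt0// mul1r -trace_wf.
      by rewrite lerXn2r ?nnegrE ?ltW// (lt_trans c3).
    lra.
  have am : f1 t <= f2 t + s2 * N.
    have h := sqr_ge0 (f1 t - 2 * (s2 * N)).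
    rewrite -subr_ge0 (_ : f2 t + s2 * N - f1 t = (4 * s2 * N)^-1 * (f1 t - 2 * (s2 * N)) ^+ 2).
      by rewrite mulr_ge0// invr_ge0 ltW.
    by rewrite /f2 /f1; field; rewrite !gt_eqF.
  have : s2 * N * 1 <= s2 * N * (g1 t + g2 t + g3 t) by rewrite ler_pM2l.
  lra.
have ig : integ P (fun t => g1 t + g2 t + g3 t) by do 2 apply: integD => //.
have iL : integ P (fun t => f1 t - f2 t - s2 * N * (g1 t + g2 t + g3 t)).
  by apply: integB; [exact: integB|exact: integZ].
apply: le_trans (mean_le iL (integ_v_form w) point).
rewrite RintegralB//; [|exact: integB|exact: integZ].
rewrite RintegralB// RintegralZl// RintegralD//; last exact: integD.
rewrite RintegralD//.
have e1 : \int[P]_t f1 t = N by rewrite /f1 weighted_form_whitened sum_col.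
have e2 : \int[P]_t f2 t <= N / 4.
  rewrite /f2 (RintegralZl _ measurableT (integ_wf2 u)) [leLHS]mulrC.
  rewrite ler_pdivrMr// (le_trans (fourth _))//.
  rewrite weighted_form_whitened sum_col -/N le_eqVlt; apply/orP; left; apply/eqP.
  by field.
have e3 : \int[P]_t g1 t = (16 * s2)^-1.
  rewrite /g1 RintegralZl//; last by apply: integ_sum => j _; exact: integ_dot_sqr.
  by rewrite -/cp; field; rewrite !gt_eqF.
have e4 : \int[P]_t g2 t = (16 * s2)^-1.
  by rewrite /g2 RintegralZl// -/cs; field; rewrite !gt_eqF.
have e5 : \int[P]_t g3 t <= (16 * s2)^-1.
  rewrite /g3 (RintegralZl _ measurableT icol2) [leLHS]mulrC ler_pdivrMr ?exprn_gt0//.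
  apply: (le_trans (mean_le icol2 icol (fun t => sqr_sum_le _))).
  rewrite RintegralZl//; last by apply: integ_sum.
  rewrite mean_sum//.
  have : \sum_j \int[P]_t (wf (col j B) t ^+ 2) <= d%:R * s2.
    rewrite -[d in d%:R]card_ord -sum1_card natr_sum mulr_suml; apply: ler_sum => j _.
    by rewrite mul1r (le_trans (fourth _))// weighted_form_col expr1n mulr1.
  move=> /(ler_wpM2l (ltW dR0)) h; apply: (le_trans h).
  by rewrite le_eqVlt; apply/orP; left; apply/eqP; field; rewrite gt_eqF.
rewrite e1 e3 e4.
have : s2 * N * ((16 * s2)^-1 + (16 * s2)^-1 + \int[P]_t g3 t) <=
   s2 * N * ((16 * s2)^-1 + (16 * s2)^-1 + (16 * s2)^-1).
  by rewrite ler_pM2l ?mulr_gt0// lerD2l.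
have -> : s2 * N * ((16 * s2)^-1 + (16 * s2)^-1 + (16 * s2)^-1) = 3 / 16 * N.
  by field; rewrite gt_eqF.
lra.
Qed.

Lemma truncated_lower_tail : exists E : set T,
  [/\ measurable E, ((1 - delta / 2)%:E <= P E)%E &
      forall t, E t -> forall w : 'cV[R]_d,
        3 / 16 * n%:R * \sum_j w j 0 ^+ 2 <=
        \sum_i \1_good (Xs i t, Ys i t) *
           (oms (Xs i t, Ys i t) * dot (B *m w) (vect (Xs i t)) ^+ 2)].
Proof.
have mZ0 : measurable_fun setT (fun t => (X t, Y t)) by exact: measurable_fun_pair.
have mZ i : measurable_fun setT (fun t => (Xs i t, Ys i t)) by exact: measurable_fun_pair.
have [E [mE PE HE]] := quadratic_form_lower_tail mZ0 mZ iid d_gt0 mv s2_gt0 delta01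
  v_bounded v_mean v_lower v_fourth n_large.
exists E; split=> // t Et w.
have := HE t Et (fun j => w j 0).
have ew : \col_j w j 0 = w by apply/colP => j; rewrite mxE.
by under [X in _ <= X -> _]eq_bigr do rewrite v_form ew.
Qed.

End good_event.

(** * Excess risk of the empirical minimizer *)
Lemma probability_setI_ge (R : realType) (dT : measure_display)
    (T : measurableType dT) (P : probability T R) (E1 E2 : set T) (a b : R) :
  measurable E1 -> measurable E2 ->
  ((1 - a)%:E <= P E1)%E -> ((1 - b)%:E <= P E2)%E ->
  ((1 - (a + b))%:E <= P (E1 `&` E2))%E.
Proof.
move=> mE1 mE2.
have compl (E : set T) (c : R) : measurable E -> ((1 - c)%:E <= P E)%E ->
    (P (~` E) <= c%:E)%E.
  move=> mE PE; have -> := probability_setC P mE.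
  have PA : P E \is a fin_num by exact: fin_num_measure.
  by move: PE; rewrite -(fineK PA) -EFinB !lee_fin; lra.
move=> /(compl _ _ mE1) PE1 /(compl _ _ mE2) PE2.
have mC1 := measurableC mE1; have mC2 := measurableC mE2.
have -> : E1 `&` E2 = ~` (~` E1 `|` ~` E2) by rewrite setCU !setCK.
have -> := probability_setC P (measurableU _ _ mC1 mC2).
rewrite EFinB leeB//; apply: (le_trans (measureU2 P mC1 mC2)).
by rewrite EFinD; exact: leeD PE1 PE2.
Qed.

Lemma residual_split (R : realType) (d : nat) (x : d.-tuple R) (y : R)
    (w w0 : 'cV[R]_d) :
  residual x y w = residual x y w0 + dot (w - w0) (vect x).
Proof.
by have := residual_line x y w0 (w - w0) 1; rewrite scale1r mul1r (addrC w0) subrK.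
Qed.

(** The bound is non-strict, so the case of mean 0 is separate: then [f] is 0
almost surely. *)
Lemma markov_event (R : realType) (dT : measure_display) (T : measurableType dT)
    (P : probability T R) (f : T -> R) (delta : R) : 0 < delta ->
  integ P f -> (forall t, 0 <= f t) -> exists E : set T,
  [/\ measurable E, ((1 - delta / 2)%:E <= P E)%E &
      forall t, E t -> f t <= 2 / delta * \int[P]_t f t].
Proof.
move=> d0 fi f0; have mf := integ_measurable fi.
set m := \int[P]_t f t.
have m0 : 0 <= m by exact: Rintegral_ge0.
have [m_eq0|m_neq0] := eqVneq m 0.
  exists [set t | f t = 0]; split.
  - exact: measurable_zero_set.
  - by rewrite (mean_eq0 fi f0 m_eq0) lee_fin lerBlDr lerDl divr_ge0// ltW.
  - by move=> t /= ->; rewrite mulr_ge0// divr_ge0// ltW.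
have mpos : 0 < m by rewrite lt_neqAle eq_sym m_neq0.
have a0 : 0 < 2 / delta * m by rewrite mulr_gt0// divr_gt0.
pose A := [set t | 2 / delta * m <= f t].
have mA : measurable A by exact: measurable_superlevel.
exists (~` A); split.
- exact: measurableC.
- have := probability_setC P mA => ->.
  rewrite EFinB leeB//.
  have := markov_ge0 P mf f0 a0; rewrite (integE fi) -/m -/A => h.
  have PA : P A \is a fin_num by exact: fin_num_measure.
  rewrite -(fineK PA) lee_fin; rewrite -(fineK PA) -EFinM lee_fin in h.
  have h2 : fine (P A) <= m / (2 / delta * m) by rewrite ler_pdivlMr// mulrC.
  by apply: (le_trans h2); rewrite le_eqVlt; apply/orP; left; apply/eqP; field;
     rewrite !gt_eqF.
- by move=> t /negP; rewrite -ltNge => /ltW.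
Qed.

Lemma divide_noise_bound (R : realFieldType) (c D G nn dl : R) :
  0 < D -> 0 < nn -> 0 < dl ->
  (c * nn * D ^+ 2) ^+ 2 <= D ^+ 2 * (2 / dl * (nn * G)) ->
  (c * D) ^+ 2 <= 2 * (G / (nn * dl)).
Proof.
move=> D0 n0 dl0 h.
have k0 : 0 < nn ^+ 2 * D ^+ 2 by rewrite mulr_gt0// exprn_gt0.
rewrite -(ler_pM2r k0).
have -> : (c * D) ^+ 2 * (nn ^+ 2 * D ^+ 2) = (c * nn * D ^+ 2) ^+ 2 by ring.
have -> // : 2 * (G / (nn * dl)) * (nn ^+ 2 * D ^+ 2) = D ^+ 2 * (2 / dl * (nn * G)).
by field; rewrite !gt_eqF.
Qed.

Section excess_risk.
Context {R : realType} {dT : measure_display} {T : measurableType dT}.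
Variables (P : probability T R) (d n : nat).
Variables (X : T -> d.-tuple R) (Y : T -> R).
Variables (Xs : 'I_n -> T -> d.-tuple R) (Ys : 'I_n -> T -> R).
Hypotheses (mX : measurable_fun setT X) (mY : measurable_fun setT Y).
Hypotheses (mXs : forall i, measurable_fun setT (Xs i))
           (mYs : forall i, measurable_fun setT (Ys i)).
Variable p : R.
Hypothesis p12 : 1 < p < 2.
Hypothesis Y_mom : integ P (fun t => `|Y t| `^ p).
Hypothesis X_mom : forall j : 'I_d, integ P (fun t => tnth (X t) j ^+ 2).
Variable wstar : 'cV[R]_d.
Hypothesis X_nondegenerate : forall w : 'cV[R]_d,
  P [set t | dot w (vect (X t)) = 0] = 1%E -> w = 0.
Hypothesis wstar_min : forall w, (risk P X Y p wstar <= risk P X Y p w)%E.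
Let r t := residual (X t) (Y t) wstar.
Let om t := `|r t| `^ (p - 2).
Hypothesis r_neq0 : P [set t | r t != 0] = 1%E.
Hypothesis r_mom : integ P (fun t => om t ^+ 2).
Hypothesis wX_mom4 : forall j : 'I_d,
  integ P (fun t => om t ^+ 2 * tnth (X t) j ^+ 4).
Let H := risk_hessian P X Y p wstar.
Let wf := weighted_form X Y p wstar.

Let wf0 w t : 0 <= wf w t. Proof. exact: weighted_form_ge0. Qed.

Let integ_wf w : integ P (wf w).
Proof. exact: (integ_weighted_form mX mY wX_mom4). Qed.

(** The first-order condition removes the linear term, so that the excess risk
is the mean of Bregman divergences; these are bounded by the quadratic term where
the residual is nonzero. *)
Lemma excess_risk_le w :
  \int[P]_t loss p (X t) (Y t) w - \int[P]_t loss p (X t) (Y t) wstar <=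
  2 / (p - 1) * \int[P]_t wf (w - wstar) t.
Proof.
have p1 : 0 < p - 1 by move: p12; lra.
set u := w - wstar.
have il w' := integ_loss mX mY p12 Y_mom X_mom w'.
have id := integ_dell_dot mX mY p12 Y_mom X_mom wstar u.
have g0 := first_order_condition mX mY p12 Y_mom X_mom u wstar_min.
have iL := integB (il w) (il wstar).
have e : \int[P]_t loss p (X t) (Y t) w - \int[P]_t loss p (X t) (Y t) wstar =
    \int[P]_t (bregman p (r t) (dot u (vect (X t)))).
  rewrite -(RintegralB measurableT (il w) (il wstar)).
  have := RintegralB measurableT iL id; rewrite g0 subr0 => <-.
  apply: eq_Rintegral => t _.
  by rewrite /loss (residual_split _ _ w wstar) /bregman -/(r t); ring.
have ib : integ P (fun t => bregman p (r t) (dot u (vect (X t)))).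
  apply: (integ_le _ _ (integZ (2 / (p - 1)) (integ_dot_powR mX p12 X_mom u))).
    apply: (@integ_measurable _ _ _ P).
    rewrite (_ : (fun _ => _) = fun t => loss p (X t) (Y t) w - loss p (X t) (Y t) wstar
       - dell p (r t) * dot u (vect (X t))); first exact: integB.
    apply/funext => t.
    by rewrite /loss (residual_split _ _ w wstar) /bregman -/(r t); ring.
  by move=> t; rewrite ger0_norm ?bregman_ge0// bregman_le_holder.
have mr : measurable_fun setT r by exact: measurable_residual.
have mr0 := measurable_neq0_set mr.
rewrite e (mean_restrict mr0 r_neq0 ib) -(RintegralZl _ measurableT (integ_wf u)).
have pt t : (r t != 0)%:R * bregman p (r t) (dot u (vect (X t))) <=
    2 / (p - 1) * wf u t.
  have [r0|r0] := eqVneq (r t) 0.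
    by rewrite mul0r mulr_ge0 ?wf0// divr_ge0// ltW.
  by rewrite mul1r; exact: bregman_le_quadratic.
apply: mean_le => //; last exact: integZ.
apply: (integ_le _ _ (integZ (2 / (p - 1)) (integ_wf u))).
  apply: measurable_funM; last exact: integ_measurable ib.
  exact: measurable_fun_natr.
by move=> t; rewrite ger0_norm// mulr_ge0// bregman_ge0.
Qed.

Lemma empirical_basic_inequality (x : 'I_n -> d.-tuple R) (y : 'I_n -> R)
    (w : 'cV[R]_d) : (0 < n)%N ->
  empirical_risk x y p w <= empirical_risk x y p wstar ->
  \sum_i (4^-1 * (dot (w - wstar) (vect (x i)) ^+ 2 *
     (`|residual (x i) (y i) wstar| + `|dot (w - wstar) (vect (x i))|) `^ (p - 2))) <=
  - \sum_i dell p (residual (x i) (y i) wstar) * dot (w - wstar) (vect (x i)).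
Proof.
move=> n0; rewrite /empirical_risk ler_pM2l ?invr_gt0 ?ltr0n// => h.
rewrite -subr_ge0 -opprD oppr_ge0 -big_split/=.
apply: (@le_trans _ _ (\sum_i loss p (x i) (y i) w - \sum_i loss p (x i) (y i) wstar)); last lra.
rewrite -sumrB; apply: ler_sum => i _.
set u := w - wstar; set s := dot u _; set ri := residual _ _ wstar.
have h2 := bregman_ge p12 ri s.
have -> : loss p (x i) (y i) w = ell p (ri + s).
  by rewrite /loss (residual_split _ _ w wstar).
move: h2; rewrite /bregman /loss -/ri; lra.
Qed.

Variable B : 'M[R]_d.
Hypothesis BHB : B^T *m H *m B = 1%:M.
Variables (s2 delta : R).
Hypothesis fourth : forall w, \int[P]_t (wf w t ^+ 2) <= s2 * (\int[P]_t wf w t) ^+ 2.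
Hypothesis d_gt0 : (0 < d)%N.
Hypothesis delta01 : 0 < delta <= 1.
Hypothesis n_large : 196 * s2 * (d%:R + 2 * ln (4 / delta)) <= n%:R.
Hypothesis iid : iid_copies P (fun t => (X t, Y t)) (fun i t => (Xs i t, Ys i t)).

(** Jensen's inequality for a weighted form of mean 1; with [d > 0] it makes
the lower bound on the sample size positive. *)
Lemma kurtosis_ge1 : 1 <= s2.
Proof.
pose j0 := Ordinal d_gt0; set u := col j0 B.
have e1 : \int[P]_t wf u t = 1.
  exact: (weighted_form_col mX mY p12 Y_mom X_mom r_neq0 wX_mom4 BHB).
have := fourth u; rewrite e1 expr1n mulr1; apply: le_trans.
have i2 : integ P (fun t => wf u t ^+ 2).
  exact: (integ_weighted_form_sqr mX mY wX_mom4).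
have i1 := integ_wf u.
have iR : integ P (fun t => 2 * wf u t - 1).
  by apply: integB; [exact: integZ|exact: integ_cst].
rewrite (_ : 1 = \int[P]_t (2 * wf u t - 1)).
  by apply: mean_le => // t; have := sqr_ge0 (wf u t - 1); lra.
rewrite RintegralB//; [|exact: integZ|exact: integ_cst].
rewrite RintegralZl// e1 mean_cst; lra.
Qed.

Let s2_gt0 : 0 < s2. Proof. exact: lt_le_trans kurtosis_ge1. Qed.

Let delta_gt0 : 0 < delta. Proof. by case/andP: delta01. Qed.

Lemma sample_size_gt0 : (0 < n)%N.
Proof.
rewrite -(ltr_nat R); apply: lt_le_trans n_large.
have L0 : 0 <= ln (4 / delta) by apply: ln_ge0; rewrite ler_pdivlMr//; move: delta01; lra.
have dR : (1 : R) <= d%:R by rewrite (ler_nat R 1).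
by rewrite !mulr_gt0//; lra.
Qed.

Let cp := c_p P X Y p wstar.
Let cs := \int[P]_t (om t ^+ 2).
Let wc (x : d.-tuple R) j := whitened B x j.
Let gj (s : (d.-tuple R * R)%type) j := dell p (residual s.1 s.2 wstar) * wc s.1 j.
Let G := \int[P]_t (\sum_j gj (X t, Y t) j ^+ 2).

Hypothesis G_fin : integ P (fun t => \sum_j gj (X t, Y t) j ^+ 2).

Let mgj j : measurable_fun setT (gj^~ j).
Proof.
apply: measurable_funM.
  apply: (measurableT_comp (measurable_dell p12)).
  by apply: measurable_residual; [exact: measurable_fst|exact: measurable_snd].
by apply: measurable_dot; exact: measurable_fst.
Qed.

(** In whitened coordinates the squared dual norm of the sum of the gradients
is a sum of squares of centered sums. *)
Lemma gradient_event : exists E : set T,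
  [/\ measurable E, ((1 - delta / 2)%:E <= P E)%E &
      forall t, E t ->
        \sum_j (\sum_i gj (Xs i t, Ys i t) j) ^+ 2 <= 2 / delta * (n%:R * G)].
Proof.
have mZ0 : measurable_fun setT (fun t => (X t, Y t)) by exact: measurable_fun_pair.
have mZ i : measurable_fun setT (fun t => (Xs i t, Ys i t)) by exact: measurable_fun_pair.
have ig j : integ P (fun t => gj (X t, Y t) j).
  exact: (integ_dell_dot mX mY p12 Y_mom X_mom wstar (col j B)).
have ig2 j : integ P (fun t => gj (X t, Y t) j ^+ 2).
  apply: (integ_le _ _ G_fin).
    by apply: measurable_funX; exact: integ_measurable (ig j).
  move=> t; rewrite ger0_norm ?sqr_ge0// [leRHS](bigD1 j)//= lerDl.
  by apply: sumr_ge0 => k _; exact: sqr_ge0.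
have E0 j : \int[P]_t gj (X t, Y t) j = 0.
  exact: (first_order_condition mX mY p12 Y_mom X_mom (col j B) wstar_min).
have sm j := iid_second_moment mZ0 mZ iid (mgj j) (ig j) (E0 j) (ig2 j).
have iF : integ P (fun t => \sum_j (\sum_i gj (Xs i t, Ys i t) j) ^+ 2).
  by apply: integ_sum => j _; exact: (sm j).1.
have EF : \int[P]_t (\sum_j (\sum_i gj (Xs i t, Ys i t) j) ^+ 2) = n%:R * G.
  rewrite mean_sum; last by move=> j _; exact: (sm j).1.
  rewrite /G mean_sum// mulr_sumr; apply: eq_bigr => j _; exact: (sm j).2.
have [E [mE PE HE]] := markov_event delta_gt0 iF
  (fun t => sumr_ge0 _ (fun j _ => sqr_ge0 _)).
by exists E; split=> // t /HE; rewrite EF.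
Qed.

(** With [D] the norm of [w - wstar] and [m] the truncation factor, the lower
bound on the truncated form and [truncated_weight_le] show that the left-hand
side in [empirical_basic_inequality] is at least [(1/8) m (3/16) n D^2];
by Cauchy-Schwarz the right-hand side is at most [D] times the norm of the noise. *)
Lemma excess_of_events (x : 'I_n -> d.-tuple R) (y : 'I_n -> R) (w : 'cV[R]_d) :
  (forall v : 'cV[R]_d, 3 / 16 * n%:R * \sum_j v j 0 ^+ 2 <=
     \sum_i \1_(good P X Y p wstar B s2) (x i, y i) *
       (`|residual (x i) (y i) wstar| `^ (p - 2) *
        dot (B *m v) (vect (x i)) ^+ 2)) ->
  \sum_j (\sum_i gj (x i, y i) j) ^+ 2 <= 2 / delta * (n%:R * G) ->
  empirical_risk x y p w <= empirical_risk x y p wstar ->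
  2 / (p - 1) * \int[P]_t wf (w - wstar) t <=
  2 ^+ 15 / (p - 1) * (G / (n%:R * delta)) +
  (p - 1)^-1 * (2 ^+ 21 * (G / (n%:R * delta) * s2 `^ (3 - p) *
     cp `^ (2 - p) * cs)) `^ (1 / (p - 1)).
Proof.
move=> lower noise erm; set u := w - wstar.
have p1 : 0 < p - 1 by move: p12; lra.
have n0 := sample_size_gt0.
have nR : (0 : R) < n%:R by rewrite ltr0n.
have Q0 : 0 <= G / (n%:R * delta).
  apply: divr_ge0; last by apply: mulr_ge0; exact: ltW.
  apply: Rintegral_ge0 => t _.
  by apply: sumr_ge0 => j _; exact: sqr_ge0.
pose th := B^T *m H *m u.
have uE : B *m th = u by rewrite /th mulmxA (whitening_inverse BHB) mul1mx.
set Dsq := \sum_j th j 0 ^+ 2.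
have wfE : \int[P]_t wf u t = Dsq.
  rewrite -uE.
  exact: (weighted_form_whitened mX mY p12 Y_mom X_mom r_neq0 wX_mom4 BHB).
have Dsq0 : 0 <= Dsq by apply: sumr_ge0 => j _; exact: sqr_ge0.
rewrite wfE.
have [Dsq_eq0|Dsq_neq0] := eqVneq Dsq 0.
  rewrite Dsq_eq0 mulr0 addr_ge0//.
    by rewrite mulr_ge0// divr_ge0 ?exprn_ge0// ltW.
  by rewrite mulr_ge0 ?powR_ge0// invr_ge0 ltW.
have Dpos : 0 < Num.sqrt Dsq by rewrite sqrtr_gt0 lt_neqAle eq_sym Dsq_neq0.
set D := Num.sqrt Dsq in Dpos.
have DE : D ^+ 2 = Dsq by rewrite sqr_sqrtr.
have cpE : cp = \int[P]_z (\sum_j wc (X z) j ^+ 2) by exact: (c_pE mX X_mom BHB).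
have cp0 : 0 < cp.
  rewrite cpE; exact: (whitened_second_moment_gt0 mX mY p12 Y_mom X_mom
    X_nondegenerate r_neq0 wX_mom4 BHB d_gt0).
have cs0 : 0 < cs by exact: (weight_second_moment_gt0 mX mY r_neq0 r_mom).
pose A := 16 * s2 * cp; pose M := 16 * s2 * cs.
have A0 : 0 < A by rewrite !mulr_gt0.
have M0 : 0 < M by rewrite !mulr_gt0.
pose kap := Num.sqrt (M * A `^ (2 - p)).
have kap0 : 0 < kap by rewrite sqrtr_gt0 mulr_gt0// powR_gt0.
have kapE : kap ^+ 2 = M * A `^ (2 - p) by rewrite sqr_sqrtr// mulr_ge0 ?powR_ge0// ltW.
rewrite -DE.
apply: (excess_from_truncated_bound p12 Dpos kap0 s2_gt0 cp0 cs0 Q0 kapE).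
apply: (divide_noise_bound Dpos nR delta_gt0).
set m := truncation_factor p D kap.
have m0 : 0 <= m.
  rewrite /m /truncation_factor le_min ler01/= invr_ge0.
  by apply: mulr_ge0; [exact: powR_ge0|exact: ltW].
pose s i := dot u (vect (x i)).
have sE i : s i = \sum_j th j 0 * wc (x i) j by rewrite /s -uE dot_whitened.
pose ind i : R := \1_(good P X Y p wstar B s2) (x i, y i).
pose omi i := `|residual (x i) (y i) wstar| `^ (p - 2).
have term i : 8^-1 * m * (ind i * (omi i * s i ^+ 2)) <=
   4^-1 * (s i ^+ 2 * (`|residual (x i) (y i) wstar| + `|s i|) `^ (p - 2)).
  rewrite /ind indicE.
  have [gi|gi] := pselect (good P X Y p wstar B s2 (x i, y i)); last first.
    by rewrite memNset// mul0r mulr0 mulr_ge0// mulr_ge0 ?sqr_ge0 ?powR_ge0.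
  rewrite mem_set// mul1r.
  case: gi => -[/= g1 g2] _.
  rewrite -/(wc _) -cpE -/A in g1.
  have sD : s i ^+ 2 <= D ^+ 2 * A.
    rewrite sE DE; apply: (le_trans (cauchy_schwarz_sum _ _)).
    exact: ler_wpM2l.
  have h := truncated_weight_le p12 Dpos kap0 (ltW A0) kapE g2 sD.
  rewrite -/m in h.
  have -> : 8^-1 * m * (omi i * s i ^+ 2) = 4^-1 * (2^-1 * m * (omi i * s i ^+ 2)) by field.
  by apply: ler_wpM2l.
have basic := empirical_basic_inequality n0 erm.
have sum_le : 8^-1 * m * \sum_i ind i * (omi i * s i ^+ 2) <=
    - \sum_i dell p (residual (x i) (y i) wstar) * s i.
  apply: le_trans basic; rewrite mulr_sumr; apply: ler_sum => i _; exact: term.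
have low := lower th; rewrite uE -/Dsq -DE in low.
have main : 3 / 128 * m * n%:R * D ^+ 2 <=
    - \sum_i dell p (residual (x i) (y i) wstar) * s i.
  apply: le_trans sum_le.
  have -> : 3 / 128 * m * n%:R * D ^+ 2 = 8^-1 * m * (3 / 16 * n%:R * D ^+ 2) by field.
  apply: ler_wpM2l low; by apply: mulr_ge0.
have swap : \sum_i dell p (residual (x i) (y i) wstar) * s i =
   \sum_j th j 0 * \sum_i gj (x i, y i) j.
  under eq_bigr do rewrite sE mulr_sumr.
  rewrite exchange_big/=; apply: eq_bigr => j _; rewrite mulr_sumr.
  by apply: eq_bigr => i _; rewrite /gj/= mulrCA.
have lhs0 : 0 <= 3 / 128 * m * n%:R * D ^+ 2.
  by rewrite !mulr_ge0 ?sqr_ge0// ltW.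
apply: (@le_trans _ _ ((- \sum_i dell p (residual (x i) (y i) wstar) * s i) ^+ 2)).
  by rewrite lerXn2r ?nnegrE// (le_trans lhs0).
rewrite sqrrN swap; apply: (le_trans (cauchy_schwarz_sum _ _)).
by rewrite -/Dsq DE; apply: ler_wpM2l.
Qed.

Lemma excess_risk_event (what : T -> 'cV[R]_d) :
  (forall t w, empirical_risk (fun i => Xs i t) (fun i => Ys i t) p (what t)
     <= empirical_risk (fun i => Xs i t) (fun i => Ys i t) p w) ->
  exists E : set T,
  [/\ measurable E, ((1 - delta)%:E <= P E)%E &
    forall t, E t ->
      \int[P]_z loss p (X z) (Y z) (what t) - \int[P]_z loss p (X z) (Y z) wstar <=
      2 ^+ 15 / (p - 1) * (G / (n%:R * delta)) +
      (p - 1)^-1 * (2 ^+ 21 * (G / (n%:R * delta) * s2 `^ (3 - p) *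
         cp `^ (2 - p) * cs)) `^ (1 / (p - 1))].
Proof.
move=> what_min.
have [E1 [mE1 PE1 HE1]] := truncated_lower_tail mX mY mXs mYs p12 Y_mom X_mom
  X_nondegenerate r_neq0 r_mom wX_mom4 BHB s2_gt0 fourth d_gt0 delta01 n_large iid.
have [E2 [mE2 PE2 HE2]] := gradient_event.
exists (E1 `&` E2); split; first exact: measurableI.
  rewrite (_ : delta = delta / 2 + delta / 2); last by field.
  exact: probability_setI_ge.
move=> t [Et1 Et2].
have nR : (0 : R) < n%:R by rewrite ltr0n; exact: sample_size_gt0.
apply: (le_trans (excess_risk_le (what t))).
exact: (excess_of_events (HE1 t Et1) (HE2 t Et2) (what_min t wstar)).
Qed.

End excess_risk.

Lemma sigma2_cases (dT : measure_display) (T : measurableType dT)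
    (R : realType) (P : probability T R) (d : nat)
    (X : T -> d.-tuple R) (Y : T -> R) (p : R) (wstar : 'cV[R]_d) :
  sigma2 P X Y p wstar = +oo%E \/ exists s2 : R, sigma2 P X Y p wstar = s2%:E.
Proof.
rewrite /sigma2; set S := ereal_sup _; case: S => [S| |].
- by right; exists (S ^+ 4); rewrite EFin_expe.
- by left; rewrite !expeS expe0 mule1 !mulyy.
- by left; rewrite !expeS expe0 mule1 !mulNyNy ?mulyNy ?mulNyNy.
Qed.

(** The supremum over the empty set is [-oo], and its fourth power is
[+oo]. *)
Lemma sigma2_dim0 (dT : measure_display) (T : measurableType dT)
    (R : realType) (P : probability T R) (d : nat)
    (X : T -> d.-tuple R) (Y : T -> R) (p : R) (wstar : 'cV[R]_d) : d = 0%N ->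
  sigma2 P X Y p wstar = +oo%E.
Proof.
move=> d0; subst d.
rewrite /sigma2 (_ : [set _ | _ in _] = set0); last first.
  by apply/seteqP; split => // z [w /= /eqP]; rewrite [w]flatmx0.
by rewrite ereal_sup0 !expeS expe0 mule1 mulNyNy.
Qed.

(** The powers of sigma and of its square are related by
[sigma^(6-2p) = s2^(3-p)]. *)
Lemma excess_bound_EFin (R : realType) (p G m s2 cp cs : R) : 0 < m -> 0 <= s2 ->
  ((2 ^+ 15 / (p - 1))%:E * (G%:E / m%:E)
   + ((p - 1)^-1)%:E * (((2 ^+ 21)%:E * G%:E * (sqrte s2%:E) `^ (6 - 2 * p)
       * cp%:E `^ (2 - p) * cs%:E) / m%:E) `^ (1 / (p - 1)))%E =
  (2 ^+ 15 / (p - 1) * (G / m) + (p - 1)^-1 *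
   (2 ^+ 21 * (G / m * s2 `^ (3 - p) * cp `^ (2 - p) * cs)) `^ (1 / (p - 1)))%:E.
Proof.
move=> m0 s0; have mn : m != 0 by rewrite gt_eqF.
have -> : s2 `^ (3 - p) = (Num.sqrt s2) `^ (6 - 2 * p).
  by rewrite -powR12_sqrt// -powRrM; congr (_ `^ _); field.
have -> : sqrte s2%:E = (Num.sqrt s2)%:E by [].
rewrite (poweR_EFin (Num.sqrt s2)) (poweR_EFin cp) inver (negbTE mn) -!EFinM -EFinD.
by congr (_ + _ * (_ `^ _))%:E; ring.
Qed.

Lemma excess_bound_pinfty (R : realType) (p m : R) (y : \bar R) : 1 < p -> 0 < m ->
  (0 <= y)%E -> ((2 ^+ 15 / (p - 1))%:E * (+oo / m%:E) + y)%E = +oo%E.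
Proof.
move=> p1 m0 y0; rewrite inver gt_eqF// gt0_mulye ?lte_fin ?invr_gt0//.
rewrite gt0_muley ?addye ?gt_eqF ?(lt_le_trans _ y0)//.
by rewrite lte_fin divr_gt0 ?exprn_gt0// subr_gt0.
Qed.

Theorem theorem5 (R : realType) (dT : measure_display) (T : measurableType dT)
  (P : probability T R) (d n : nat)
  (X : {RV P >-> d.-tuple R}) (Y : {RV P >-> R})
  (Xs : 'I_n -> {RV P >-> d.-tuple R}) (Ys : 'I_n -> {RV P >-> R})
  (p delta : R) (wstar : 'cV[R]_d) (what : T -> 'cV[R]_d)
  (iid : iid_copies P (fun t => (X t, Y t)) (fun i t => (Xs i t, Ys i t)))
  (X_nondegenerate : forall w : 'cV[R]_d,
     P [set t | dot w (vect (X t)) = 0] = 1%E -> w = 0)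
  (wstar_min : forall w : 'cV[R]_d,
     (risk P X Y p wstar <= risk P X Y p w)%E)
  (what_min : forall (t : T) (w : 'cV[R]_d),
     empirical_risk (fun i => Xs i t) (fun i => Ys i t) p (what t)
     <= empirical_risk (fun i => Xs i t) (fun i => Ys i t) p w)
  (p_range : 1 < p < 2) (delta_range : 0 < delta <= 1)
  (residual_neq0 :
     P [set t | 0 < `|residual (X t) (Y t) wstar| `^ (2 - p)] = 1%E)
  (residual_moment :
     ('E_P[fun t => (`|residual (X t) (Y t) wstar| `^ (2 * (p - 2)))%R]
      < +oo)%E)
  (Y_moment : ('E_P[fun t => (`|Y t| `^ p)%R] < +oo)%E)
  (X_moment : forall j : 'I_d,
     ('E_P[fun t => (tnth (X t) j ^+ 2)%R] < +oo)%E)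
  (weighted_moment : forall j : 'I_d,
     ('E_P[fun t => (`|residual (X t) (Y t) wstar| `^ (2 * (p - 2))
                     * tnth (X t) j ^+ 4)%R] < +oo)%E)
  (n_large :
     (196%:E * sigma2 P X Y p wstar * (d%:R + 2 * ln (4 / delta))%:E
      <= n%:R%:E)%E) :
  exists E : set T,
    [/\ measurable E,
        ((1 - delta)%:E <= P E)%E &
        forall t, E t ->
          (risk P X Y p (what t) - risk P X Y p wstar
           <= (2 ^+ 15 / (p - 1))%:E
              * (gradient_moment P X Y p wstar / (n%:R * delta)%:E)
            + ((p - 1)^-1)%:E
              * (((2 ^+ 21)%:E * gradient_moment P X Y p wstar
                  * sigma P X Y p wstar `^ (6 - 2 * p)
                  * (c_p P X Y p wstar)%:E `^ (2 - p)
                  * c_p_star P X Y p wstar)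
                 / (n%:R * delta)%:E) `^ (1 / (p - 1)))%E].
Proof.
have mX : measurable_fun setT X by exact: measurable_funP.
have mY : measurable_fun setT Y by exact: measurable_funP.
have mXs i : measurable_fun setT (Xs i) by exact: measurable_funP.
have mYs i : measurable_fun setT (Ys i) by exact: measurable_funP.
have p12 := p_range.
pose r t := residual (X t) (Y t) wstar.
pose om t := `|r t| `^ (p - 2).
have omE t : `|r t| `^ (2 * (p - 2)) = om t ^+ 2.
  by rewrite /om -powR_mulrn ?powR_ge0// -powRrM mulrC.
have mr : measurable_fun setT r by exact: measurable_residual.
have mom : measurable_fun setT om.
  by apply: (measurableT_comp (measurable_powR _)); exact: measurableT_comp.
have mx (j : 'I_d) : measurable_fun setT (fun t => tnth (X t) j).
  exact: (measurableT_comp (measurable_tnth j)).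
have Y_mom : integ P (fun t => `|Y t| `^ p).
  apply: integ_ge0.
  - by apply: (measurableT_comp (measurable_powR _)); exact: measurableT_comp.
  - by move=> t; exact: powR_ge0.
  - by move: Y_moment; rewrite unlock.
have X_mom (j : 'I_d) : integ P (fun t => tnth (X t) j ^+ 2).
  apply: integ_ge0; first exact: measurable_funX.
  - by move=> t; exact: sqr_ge0.
  - by have := X_moment j; rewrite unlock.
have r_mom : integ P (fun t => om t ^+ 2).
  apply: integ_ge0; first exact: measurable_funX.
  - by move=> t; exact: sqr_ge0.
  - by move: residual_moment; rewrite unlock; under eq_integral do rewrite omE.
have wX_mom4 (j : 'I_d) : integ P (fun t => om t ^+ 2 * tnth (X t) j ^+ 4).
  apply: integ_ge0.
  - by apply: measurable_funM; exact: measurable_funX.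
  - by move=> t; rewrite mulr_ge0 ?sqr_ge0// (exprM _ 2 2) sqr_ge0.
  - have := weighted_moment j; rewrite unlock.
    by under eq_integral do rewrite omE.
have r_neq0 : P [set t | r t != 0] = 1%E.
  rewrite -residual_neq0; congr (P _); apply/seteqP; split => t /= rt.
    by rewrite powR_gt0// normr_gt0.
  apply: contraPneq rt => rt; rewrite -/(r t) rt normr0 powR0 ?ltxx//.
  by rewrite gt_eqF//; move: p12; lra.
have /andP[delta_gt0 delta_le1] := delta_range.
have L_gt0 : 0 < ln (4 / delta) by apply: ln_gt0; rewrite ltr_pdivlMr//; lra.
have dL0 : 0 < d%:R + 2 * ln (4 / delta) by rewrite ltr_wpDl ?ler0n// mulr_gt0.
have [s2inf|[s2 s2E]] := sigma2_cases P X Y p wstar.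
  by move: n_large; rewrite s2inf gt0_muley ?lte_fin// gt0_mulye ?lte_fin.
have d_gt0 : (0 < d)%N.
  case: (posnP d) => // d0; exfalso.
  by have := sigma2_dim0 P X Y p wstar d0; rewrite s2E.
have nE : 196 * s2 * (d%:R + 2 * ln (4 / delta)) <= n%:R.
  by move: n_large; rewrite s2E -!EFinM lee_fin.
have [B BHB] : exists B : 'M[R]_d,
    B^T *m risk_hessian P X Y p wstar *m B = 1%:M.
  apply: posdef_factor.
    exact: (risk_hessian_sym mX mY p12 Y_mom X_mom r_neq0 wX_mom4).
  move=> w; exact: (risk_hessian_posdef mX mY p12 Y_mom X_mom X_nondegenerate
    r_neq0 wX_mom4).
have fourth := fourth_moment_le mX mY p12 Y_mom X_mom X_nondegenerate r_neq0
  wX_mom4 s2E.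
have s2_ge1 := kurtosis_ge1 mX mY p12 Y_mom X_mom r_neq0 wX_mom4 BHB fourth d_gt0.
have n_gt0 := sample_size_gt0 mX mY p12 Y_mom X_mom r_neq0 wX_mom4 BHB fourth
  d_gt0 delta_range nE.
have m_gt0 : 0 < n%:R * delta by rewrite mulr_gt0// ltr0n.
pose g t := \sum_j (dell p (r t) * whitened B (X t) j) ^+ 2.
have gE : gradient_moment P X Y p wstar = (\int[P]_t (g t)%:E)%E.
  rewrite /gradient_moment unlock; apply: eq_integral => t _.
  by rewrite gradient_loss// (mxnorm_whitened BHB).
have riskE' := riskE mX mY p12 Y_mom X_mom.
(* If the gradient moment is infinite the right-hand side is +oo, and the
   whole space can serve as the event. *)
have [gfin|ginf] := ltP (\int[P]_t (g t)%:E)%E +oo%E; last first.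
  exists setT; split => //.
    by rewrite probability_setT lee_fin; lra.
  move=> t _; rewrite gE; move: ginf; rewrite leye_eq => /eqP ->.
  rewrite excess_bound_pinfty ?leey//; first by case/andP: p12.
  by rewrite mule_ge0 ?poweR_ge0// lee_fin invr_ge0; move: p12; lra.
have mg : measurable_fun setT g.
  apply: measurable_sum => j; apply: measurable_funX; apply: measurable_funM.
    by apply: (measurableT_comp (measurable_dell _)).
  exact: measurable_dot.
have g_int : integ P g.
  by apply: integ_ge0 => // t; apply: sumr_ge0 => j _; exact: sqr_ge0.
have [E [mE PE HE]] := excess_risk_event mX mY mXs mYs p12 Y_mom X_mom
  X_nondegenerate wstar_min r_neq0 r_mom wX_mom4 BHB fourth d_gt0 delta_range nE
  iid g_int what_min.
exists E; split => // t /HE.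
have csE : c_p_star P X Y p wstar = (\int[P]_t (om t ^+ 2))%:E.
  rewrite -integE// /c_p_star unlock; apply: eq_integral => z _.
  by rewrite -omE /r /residual distrC.
by rewrite gE csE integE// /sigma s2E !riskE' excess_bound_EFin// (le_trans _ s2_ge1).
Qed.
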